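(* Let $P$ be a real-valued $\mathcal{C}^\infty$-smooth function on a neighborhood of $0$ in $\mathbb{C}$ and let $(M_P,0)$ be the germ at the origin of the $\mathcal{C}^\infty$-smooth hypersurface in $\mathbb{C}^2$ defined by the equation $\rho(z_1,z_2)=\mathrm{Re}\,z_1+P(z_2)=0$, satisfying the conditions: (i) the connected component of $z_2=0$ in the zero set of $P$ is $\{0\}$; (ii) $P$ vanishes to infinite order at $z_2=0$. Then any holomorphic vector field vanishing at the origin and tangent to $(M_P,0)$ is either identically zero, or, after a change of variable in $z_2$, of the form $i\beta z_2\,\partial_{z_2}$ for some non-zero real number $\beta$, in which case $M_P$ is rotationally symmetric, i.e. $P(z_2)=P(|z_2|)$ (in the new variable $z_2$).
   Context: All objects are germs at the origin. A holomorphic vector field $H=h_1(z_1,z_2)\partial_{z_1}+h_2(z_1,z_2)\partial_{z_2}$ defined near the origin is tangent to $M_P$ if $(\mathrm{Re}\,H)\rho(z)=0$ for all $z\in M_P$ near $0$, i.e. $\mathrm{Re}\big[\tfrac12 h_1(z_1,z_2)+P_{z_2}(z_2)h_2(z_1,z_2)\big]=0$ on $M_P$, where $P_{z_2}=\partial P/\partial z_2$. A change of variable in $z_2$ is a local biholomorphism of $(\mathbb{C},0)$ acting on the $z_2$ coordinate; after it, $P$ denotes the function expressed in the new coordinate. *)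

(* Defs.v *)
(* Germs at the origin are represented by total
   functions, and every condition on them is localized by [locally].
   A point of [C] is the pair of its real and imaginary parts. *)
From Stdlib Require Import Reals Lra.
From Coquelicot Require Import Coquelicot.
Open Scope R_scope.

Definition C2 : NormedModule C_AbsRing :=
  prod_NormedModule C_AbsRing C_NormedModule C_NormedModule.

Definition origin2 : C * C := (RtoC 0, RtoC 0).

(* On an open set [U] this is C^infinity smoothness: [ex_diff_n _ n] asks that
   all iterated partial derivatives up to order n exist and are continuous. *)
Definition smooth_on (U : C -> Prop) (P : C -> R) : Prop :=
  forall (n : nat) (z : C), U z ->
    ex_diff_n (fun x y => P (x, y)) n (Re z) (Im z).

Definition vanishes_to_infinite_order (P : C -> R) : Prop :=
  forall p q : nat, partial_derive p q (fun x y => P (x, y)) 0 0 = 0.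

Definition connected {T : UniformSpace} (A : T -> Prop) : Prop :=
  forall V W : T -> Prop, open V -> open W ->
    (forall x, A x -> V x \/ W x) ->
    (exists x, A x /\ V x) -> (exists x, A x /\ W x) ->
    exists x, A x /\ V x /\ W x.

Definition connected_component {T : UniformSpace} (A : T -> Prop) (x y : T)
  : Prop :=
  exists B : T -> Prop,
    (forall t, B t -> A t) /\ connected B /\ B x /\ B y.

(* d/dz = (d/dx - i d/dy) / 2 *)
Definition wirtinger (f : C -> R) (z : C) : C :=
  (Derive (fun x => f (x, Im z)) (Re z) / 2,
   - (Derive (fun y => f (Re z, y)) (Im z) / 2)).

(* M_P is the germ at the origin of the zero set of [rho P]. *)
Definition rho (P : C -> R) (z : C * C) : R := Re (fst z) + P (snd z).

(* Complex Frechet differentiability at every point near the origin of C^2.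
   [H z = (h1 z, h2 z)] stands for the vector field h1 d/dz1 + h2 d/dz2. *)
Definition holomorphic_vector_field (H : C * C -> C * C) : Prop :=
  locally origin2 (fun z => @ex_filterdiff C_AbsRing C2 C2 H (locally z)).

Definition apply_field (H : C * C -> C * C) (r : C * C -> R) (z : C * C) : C :=
  (fst (H z) * wirtinger (fun w => r (w, snd z)) (fst z)
   + snd (H z) * wirtinger (fun w => r (fst z, w)) (snd z))%C.

(* For a real function r, (Re H) r = Re (H r). *)
Definition tangent_to_M (P : C -> R) (H : C * C -> C * C) : Prop :=
  locally origin2 (fun z =>
    rho P z = 0 -> Re (apply_field H (rho P) z) = 0).

Lemma wirtinger_rho1 (P : C -> R) (z1 z2 : C) :
  wirtinger (fun w => rho P (w, z2)) z1 = RtoC (/ 2).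
Proof.
unfold wirtinger, rho, RtoC; simpl; f_equal.
- rewrite (is_derive_unique _ _ 1); [lra | auto_derive; auto; ring].
- rewrite Derive_const; lra.
Qed.

Lemma wirtinger_rho2 (P : C -> R) (z1 z2 : C) :
  wirtinger (fun w => rho P (z1, w)) z2 = wirtinger P z2.
Proof.
unfold wirtinger, rho, RtoC, Derive; simpl.
do 3 f_equal; [| f_equal]; apply Lim_ext; intros h; f_equal; ring.
Qed.

Lemma tangent_to_M_explicit (P : C -> R) (H : C * C -> C * C) :
  tangent_to_M P H <->
  locally origin2 (fun z =>
    Re (fst z) + P (snd z) = 0 ->
    Re (RtoC (/ 2) * fst (H z) + wirtinger P (snd z) * snd (H z))%C = 0).
Proof.
unfold tangent_to_M, apply_field; split; intros [e He]; exists e;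
  intros [z1 z2] Hz Hr; specialize (He _ Hz Hr);
  rewrite ?wirtinger_rho1, ?wirtinger_rho2 in *;
  rewrite <- He; f_equal; simpl; ring.
Qed.

(* [phi] is the coordinate change w = phi z of (C,0), [psi] its inverse. *)
Definition local_biholomorphism (phi psi : C -> C) : Prop :=
  phi (RtoC 0) = RtoC 0 /\ psi (RtoC 0) = RtoC 0 /\
  locally (RtoC 0) (fun z : C => ex_derive phi z) /\
  locally (RtoC 0) (fun w : C => ex_derive psi w) /\
  locally (RtoC 0) (fun z : C => psi (phi z) = z) /\
  locally (RtoC 0) (fun w : C => phi (psi w) = w).

(* The vector field H in the coordinates (z1, w) with w = phi z2. *)
Definition push_field (phi psi : C -> C) (H : C * C -> C * C) (v : C * C)
  : C * C :=
  let z := (fst v, psi (snd v)) in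
  (fst (H z), (C_derive phi (snd z) * snd (H z))%C).

Definition rotation_field (beta : R) (v : C * C) : C * C :=
  (RtoC 0, (Ci * RtoC beta * snd v)%C).

Definition rotationally_symmetric (P : C -> R) : Prop :=
  locally (RtoC 0) (fun w : C => P w = P (RtoC (Cmod w))).

(* Main.v *)
Require Import Defs.
From Stdlib Require Import Reals Lra Lia Psatz ClassicalEpsilon.
From Coquelicot Require Import Coquelicot.
Open Scope R_scope.

(** Write [h1], [h2] for the components of [H], [dP z v] for the derivative of
    [P] at [z] in the direction [v], and call flat whatever is [O(|z|^n)] for
    all [n]. On the points [(i t - P z, z)] of [M_P], with [t] real, tangency says
    [[
      Re (h1 (i t - P z, z)) + dP z (h2 (i t - P z, z)) = 0.
    ]]
    The second term is flat in [z], so the real part of the holomorphic function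
    [h1 (i t, .)] is constant to all orders; hence [h1] does not depend on [z2],
    and its real part vanishes on the imaginary axis ([h1_indep]). Expanding in
    [P], the field [g = h2 (i t, .)] satisfies [dP (g) = - lam P] up to
    [O(|P| (|P| + |dP|))], with a real constant [lam = lam (t)].

    The heart of the proof is [field_dichotomy]: for such a [g], necessarily
    [lam = 0], and [g] is either zero or equal to [i beta z + O(|z|^2)] with
    [beta] real and non-zero. An integral curve of [g] that starts at a zero of
    [P] stays in the zero set of [P], so [g 0 <> 0] would contradict the isolation
    of the zero [0] ([order0_impossible]). In every other
    excluded case [P], restricted to integral curves of [g], would decay too
    slowly for a flat function or change exponentially along closed curves. Following
    the curves is avoided by a maximum principle: [P ^ 2 * Y], for a weight [Y]
    positive only near [0], has an interior maximum, where the derivative of [P]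
    along [g] is determined by that of [Y] ([critical_point]). The weights are
    [Re (1 / (c z^(m-1)))] for a zero of order [m >= 2], a power of [1 / |z|] for
    a simple zero with non-imaginary derivative, and [- |phi| ^ 2] for a center,
    where [phi] is the coordinate in which [g] is a linear rotation
    ([linearization]). Each weight is shifted by a constant.

    Applied to every [h2 (i t, .)], the dichotomy gives [Re h1' (i t) = 0], which
    together with [Re h1 (i t) = 0] forces [h1 = 0] ([h1_zero]). Applied to real
    combinations of [h2 (i t, .)] and [g = h2 (i t0, .)] without linear part, it
    shows that these fields are proportional, so [h2 (z1, z2) = f z1 * g z2] with
    [f] real on the imaginary axis ([h2_product]). At the maxima of
    [P ^ 2 * (c - |phi| ^ 2)], tangency says that [f (i t - P)] is real. These
    points accumulate at [0], so [f'] vanishes on the axis and [f] is constant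
    ([factor_real_derivative]). Therefore [H = g d/dz2] is [i beta w d/dw] in the
    coordinate [w = phi z2], and [dP (g) = 0] says that [P] is constant on the
    circles [|w| = const] ([rotation_coordinate]).

    As [H] is only assumed to be complex differentiable at each point, the
    one-variable theory starts from Goursat's theorem: integrals over boundaries
    of squares give the Taylor expansion with remainder ([taylor]). Two-variable
    functions are studied through their slices. *)

(** * Complex derivatives *)

Notation is_cderive := (@is_derive C_AbsRing C_NormedModule).

Lemma lt_Rmin x a b : x < Rmin a b -> x < a /\ x < b.
Proof. intros H. split; (eapply Rlt_le_trans; [exact H|]); [apply Rmin_l | apply Rmin_r]. Qed.

Lemma le_Rmin x a b : x <= Rmin a b -> x <= a /\ x <= b.
Proof. intros H. split; (eapply Rle_trans; [exact H|]); [apply Rmin_l | apply Rmin_r]. Qed.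

Lemma locally_C_eps (z : C) (Q : C -> Prop) :
  @locally (AbsRing_UniformSpace C_AbsRing) z Q <->
  exists d, 0 < d /\ forall w, Cmod (w - z) < d -> Q w.
Proof.
split.
- intros [e He]; exists e; split; [apply cond_pos | intros w Hw; apply He, Hw].
- intros [d [Hd H]]; exists (mkposreal d Hd); intros w Hw; apply H, Hw.
Qed.

Lemma is_cderive_eps (f : C -> C) (z l : C) :
  is_cderive f z l <->
  forall eps, 0 < eps -> exists d, 0 < d /\ forall w, Cmod (w - z) < d ->
    Cmod (f w - f z - l * (w - z)) <= eps * Cmod (w - z).
Proof.
split.
- intros [_ H] eps He.
  destruct (proj1 (locally_C_eps _ _) (H z (fun P HP => HP) (mkposreal eps He)))
    as [d [Hd Hw]].
  exists d; split; auto. intros w Hwz. specialize (Hw w Hwz).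
  replace (f w - f z - l * (w - z))%C with (f w - f z - (w - z) * l)%C by ring.
  exact Hw.
- intros H; split; [apply is_linear_scal_l |].
  intros x Hx eps.
  assert (x = z) as ->.
  { symmetry; exact (is_filter_lim_locally_unique (V := AbsRing_NormedModule C_AbsRing) z x Hx).
    }
  apply locally_C_eps. destruct (H eps (cond_pos eps)) as [d [Hd Hw]].
  exists d; split; auto. intros w Hwz. specialize (Hw w Hwz).
  replace (f w - f z - l * (w - z))%C with (f w - f z - (w - z) * l)%C in Hw by ring.
  exact Hw.
Qed.

(** [C] carries two normed module structures over itself, with the same norm but
    different balls; the rules for products and compositions concern the other
    one. *)
Lemma is_cderive_AbsRing (f : C -> C) (z l : C) :
  is_cderive f z l <->
  @is_derive C_AbsRing (AbsRing_NormedModule C_AbsRing) f z l.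
Proof.
split; intros [_ H]; (split; [apply is_linear_scal_l | exact H]).
Qed.

Lemma is_cderive_mult f g z df dg :
  is_cderive f z df -> is_cderive g z dg ->
  is_cderive (fun w => f w * g w)%C z (df * g z + f z * dg)%C.
Proof.
intros Hf%is_cderive_AbsRing Hg%is_cderive_AbsRing. apply is_cderive_AbsRing.
exact (@is_derive_mult C_AbsRing f g z df dg Hf Hg Cmult_comm).
Qed.

Lemma is_cderive_plus f g z df dg :
  is_cderive f z df -> is_cderive g z dg ->
  is_cderive (fun w => f w + g w)%C z (df + dg)%C.
Proof. exact (@is_derive_plus C_AbsRing C_NormedModule f g z df dg). Qed.

Lemma is_cderive_minus f g z df dg :
  is_cderive f z df -> is_cderive g z dg ->
  is_cderive (fun w => f w - g w)%C z (df - dg)%C.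
Proof. exact (@is_derive_minus C_AbsRing C_NormedModule f g z df dg). Qed.

Lemma is_cderive_const (c z : C) : is_cderive (fun _ => c) z (RtoC 0).
Proof. exact (@is_derive_const C_AbsRing C_NormedModule c z). Qed.

Lemma is_cderive_id (z : C) : is_cderive (fun w => w) z (RtoC 1).
Proof. apply is_cderive_AbsRing. exact (@is_derive_id C_AbsRing z). Qed.

Lemma is_cderive_comp f g z df dg :
  is_cderive f (g z) df -> is_cderive g z dg ->
  is_cderive (fun w => f (g w)) z (dg * df)%C.
Proof.
intros Hf Hg%is_cderive_AbsRing.
exact (@is_derive_comp C_AbsRing C_NormedModule f g z df dg Hf Hg).
Qed.

Definition ccont (f : C -> C) (z : C) :=
  forall eps, 0 < eps -> exists d, 0 < d /\ forall w, Cmod (w - z) < d ->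
    Cmod (f w - f z) < eps.

Lemma is_cderive_ccont f z l : is_cderive f z l -> ccont f z.
Proof.
intros H eps He. destruct (proj1 (is_cderive_eps _ _ _) H 1) as [d [Hd H1]]; [lra|].
assert (0 <= Cmod l) by apply Cmod_ge_0.
assert (He' : 0 < eps / (2 + Cmod l)) by (apply Rdiv_lt_0_compat; lra).
exists (Rmin d (eps / (2 + Cmod l))); split; [now apply Rmin_case|].
intros w Hw. destruct (lt_Rmin _ _ _ Hw) as [Hw1 Hw2].
specialize (H1 w Hw1).
replace (f w - f z)%C with ((f w - f z - l * (w - z)) + l * (w - z))%C by ring.
eapply Rle_lt_trans; [apply Cmod_triangle|]. rewrite Cmod_mult.
assert (0 <= Cmod (w - z)) by apply Cmod_ge_0.
apply Rle_lt_trans with ((1 + Cmod l) * Cmod (w - z)); [lra|].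
apply Rle_lt_trans with ((1 + Cmod l) * (eps / (2 + Cmod l))).
- apply Rmult_le_compat_l; lra.
- apply Rlt_le_trans with ((2 + Cmod l) * (eps / (2 + Cmod l))).
  + apply Rmult_lt_compat_r; lra.
  + right; field; lra.
Qed.

Lemma is_cderive_inv (z : C) : z <> 0%C -> is_cderive Cinv z (- / (z * z))%C.
Proof.
intros Hz. apply is_cderive_eps. intros eps He.
assert (Hm : 0 < Cmod z) by now apply Cmod_gt_0.
assert (Hm3 : 0 < Cmod z ^ 3) by now apply pow_lt.
exists (Rmin (Cmod z / 2) (eps * Cmod z ^ 3 / 2)); split.
{ apply Rmin_case; [lra|]. apply Rdiv_lt_0_compat; [apply Rmult_lt_0_compat|]; lra. }
intros w Hw. destruct (lt_Rmin _ _ _ Hw) as [Hw1 Hw2].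
assert (Hwm : Cmod z / 2 < Cmod w).
{ assert (Cmod z <= Cmod w + Cmod (w - z)).
  { replace z with (w + - (w - z))%C at 1 by ring.
    eapply Rle_trans; [apply Cmod_triangle|]. rewrite Cmod_opp. lra. } lra. }
assert (w <> 0%C) by (apply Cmod_gt_0; lra).
replace (/ w - / z - - / (z * z) * (w - z))%C with ((w - z) * (w - z) / (z * z * w))%C
  by (field; auto).
rewrite Cmod_div by (repeat apply Cmult_neq_0; auto).
rewrite !Cmod_mult. assert (0 <= Cmod (w - z)) by apply Cmod_ge_0.
apply Rle_div_l. { repeat apply Rmult_lt_0_compat; lra. }
apply Rle_trans with ((eps * Cmod z ^ 3 / 2) * Cmod (w - z)).
{ apply Rmult_le_compat_r; lra. }
apply Rle_trans with (eps * (Cmod z * Cmod z * (Cmod z / 2)) * Cmod (w - z)).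
{ right; field. }
replace (eps * Cmod (w - z) * (Cmod z * Cmod z * Cmod w))
  with (eps * (Cmod z * Cmod z * Cmod w) * Cmod (w - z)) by ring.
apply Rmult_le_compat_r; auto. apply Rmult_le_compat_l; [lra|].
apply Rmult_le_compat_l; [apply Rmult_le_pos; lra | lra].
Qed.

(** * Complex line integrals along horizontal and vertical segments *)

Definition CInt (f : R -> C) (a b : R) : C := @RInt C_R_CompleteNormedModule f a b.

Definition rcont (f : R -> C) (x : R) := @continuous R_UniformSpace C_UniformSpace f x.
Definition is_rderive (f : R -> C) (x : R) (l : C) :=
  @is_derive R_AbsRing C_R_NormedModule f x l.

Lemma norm_C_R (x : C) : @norm _ C_R_NormedModule x = Cmod x.
Proof.
change (sqrt (Rabs (fst x) ^ 2 + Rabs (snd x) ^ 2) = sqrt (fst x ^ 2 + snd x ^ 2)).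
now rewrite !pow2_abs.
Qed.

Lemma rcont_eps (f : R -> C) (x : R) :
  (forall eps, 0 < eps -> exists d, 0 < d /\ forall t, Rabs (t - x) < d ->
    Cmod (f t - f x) < eps) -> rcont f x.
Proof.
intros H P [e He]. destruct (H e (cond_pos e)) as [d [Hd H1]].
exists (mkposreal d Hd). intros t Ht. apply He.
apply C_NormedModule_mixin_compat1. apply H1, Ht.
Qed.

Lemma rcont_elim (f : R -> C) (x : R) : rcont f x ->
  forall eps, 0 < eps -> exists d, 0 < d /\ forall t, Rabs (t - x) < d ->
    Cmod (f t - f x) < eps.
Proof.
intros H eps He. destruct (H (fun z => Cmod (z - f x) < eps)%C) as [d Hd].
- apply (locally_C (f x)), locally_C_eps. exists eps; auto.
- exists d. split; [apply cond_pos | exact Hd].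
Qed.

Lemma rcont_const (u : C) (x : R) : rcont (fun _ => u) x.
Proof. exact (continuous_const (u : C_UniformSpace) x). Qed.

Lemma rcont_minus f g x : rcont f x -> rcont g x -> rcont (fun t => f t - g t)%C x.
Proof. exact (continuous_minus (V := C_R_NormedModule) f g x). Qed.

Lemma rcont_Cmult (c : C) f x : rcont f x -> rcont (fun t => c * f t)%C x.
Proof.
intros H. apply rcont_eps. intros eps He.
assert (Hc := Cmod_ge_0 c).
assert (He' : 0 < eps / (Cmod c + 1)) by (apply Rdiv_lt_0_compat; lra).
destruct (rcont_elim f x H _ He') as [d [Hd H1]].
exists d; split; auto. intros t Ht. specialize (H1 t Ht).
replace (c * f t - c * f x)%C with (c * (f t - f x))%C by ring.
rewrite Cmod_mult. apply (Rlt_div_r (Cmod (f t - f x)) eps) in H1; [|lra].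
assert (0 <= Cmod (f t - f x)) by apply Cmod_ge_0. lra.
Qed.

Lemma is_rderive_eps (f : R -> C) (x : R) (l : C) :
  (forall eps, 0 < eps -> exists d, 0 < d /\ forall t, Rabs (t - x) < d ->
    Cmod (f t - f x - RtoC (t - x) * l) <= eps * Rabs (t - x)) -> is_rderive f x l.
Proof.
intros H. split; [apply is_linear_scal_l|].
intros y Hy eps.
assert (y = x) as ->.
{ symmetry; exact (is_filter_lim_locally_unique (V := R_NormedModule) x y Hy). }
destruct (H eps (cond_pos eps)) as [d [Hd H1]].
exists (mkposreal d Hd). intros t Ht. specialize (H1 t Ht).
rewrite norm_C_R. rewrite scal_R_Cmult. exact H1.
Qed.

Definition cont_on (f : R -> C) (a b : R) :=
  forall x, Rmin a b <= x <= Rmax a b -> rcont f x.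

Lemma CInt_correct f a b : cont_on f a b ->
  @is_RInt C_R_NormedModule f a b (CInt f a b).
Proof.
intros H. apply (@RInt_correct C_R_CompleteNormedModule).
apply (@ex_RInt_continuous C_R_CompleteNormedModule). exact H.
Qed.

Lemma CInt_unique f a b l : @is_RInt C_R_NormedModule f a b l -> CInt f a b = l.
Proof. exact (@is_RInt_unique C_R_CompleteNormedModule f a b l). Qed.

Lemma CInt_Chasles f a b c : cont_on f a b -> cont_on f b c ->
  (CInt f a b + CInt f b c)%C = CInt f a c.
Proof.
intros H1%CInt_correct H2%CInt_correct. symmetry. apply CInt_unique.
exact (is_RInt_Chasles f a b c _ _ H1 H2).
Qed.

Lemma CInt_swap f a b : cont_on f a b -> CInt f b a = (- CInt f a b)%C.
Proof.
intros H1%CInt_correct. apply CInt_unique. exact (is_RInt_swap f b a _ H1).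
Qed.

Lemma CInt_point f a : CInt f a a = 0%C.
Proof. apply CInt_unique. exact (is_RInt_point f a). Qed.

Lemma CInt_bound f a b M : cont_on f a b ->
  (forall x, Rmin a b <= x <= Rmax a b -> Cmod (f x) <= M) ->
  Cmod (CInt f a b) <= Rabs (b - a) * M.
Proof.
intros H1%CInt_correct H2. rewrite <- norm_C_R.
refine (norm_RInt_le_const_abs f a b _ M _ H1).
intros x Hx. rewrite norm_C_R. now apply H2.
Qed.

Lemma CInt_minus f g a b : cont_on f a b -> cont_on g a b ->
  CInt (fun t => f t - g t)%C a b = (CInt f a b - CInt g a b)%C.
Proof.
intros H1%CInt_correct H2%CInt_correct. apply CInt_unique.
exact (is_RInt_minus f g a b _ _ H1 H2).
Qed.

Lemma CInt_ext f g a b : (forall x, Rmin a b <= x <= Rmax a b -> f x = g x) ->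
  CInt f a b = CInt g a b.
Proof.
intros H. apply (@RInt_ext C_R_CompleteNormedModule). intros x Hx; apply H; lra.
Qed.

Lemma CInt_FTC f df a b :
  (forall x, Rmin a b <= x <= Rmax a b -> is_rderive f x (df x)) ->
  cont_on df a b -> CInt df a b = (f b - f a)%C.
Proof.
intros H1 H2. apply CInt_unique.
exact (@is_RInt_derive C_R_CompleteNormedModule f df a b H1 H2).
Qed.

(** The integral is defined by real scalars only, so complex linearity is read
    off the real and imaginary parts. *)
Lemma CInt_Cmult (c : C) f a b : cont_on f a b ->
  CInt (fun t => c * f t)%C a b = (c * CInt f a b)%C.
Proof.
intros H%CInt_correct. apply CInt_unique.
assert (H1 := is_RInt_fct_extend_fst (U := R_NormedModule) (V := R_NormedModule) f a b _ H).
assert (H2 := is_RInt_fct_extend_snd (U := R_NormedModule) (V := R_NormedModule) f a b _ H).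
apply (is_RInt_fct_extend_pair (U := R_NormedModule) (V := R_NormedModule)
  (fun t => c * f t)%C a b); simpl.
- exact (is_RInt_minus _ _ _ _ _ _ (is_RInt_scal _ _ _ (fst c) _ H1)
    (is_RInt_scal _ _ _ (snd c) _ H2)).
- exact (is_RInt_plus _ _ _ _ _ _ (is_RInt_scal _ _ _ (fst c) _ H2)
    (is_RInt_scal _ _ _ (snd c) _ H1)).
Qed.

Lemma is_cderive_eq (f : C -> C) (z l l' : C) :
  is_cderive f z l -> l = l' -> is_cderive f z l'.
Proof. now intros H <-. Qed.

(** Matching on the head of the function keeps unification from unfolding the
    operations of [C]. *)
Ltac cderive := try assumption; lazymatch goal with
  | |- @is_derive _ _ (fun w => Cminus (@?f w) (@?g w)) _ _ =>
    apply (is_cderive_minus f g); cderive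
  | |- @is_derive _ _ (fun w => Cplus (@?f w) (@?g w)) _ _ =>
    apply (is_cderive_plus f g); cderive
  | |- @is_derive _ _ (fun w => Cmult (@?f w) (@?g w)) _ _ =>
    apply (is_cderive_mult f g); cderive
  | |- @is_derive _ _ (fun w => w) _ _ => apply is_cderive_id
  | |- @is_derive _ _ (fun w => ?c) _ _ => apply (is_cderive_const c)
  | _ => idtac end.

(** * Nested rectangles *)

Definition half (a b a' b' : R) :=
  (a' = a /\ b' = (a + b) / 2) \/ (a' = (a + b) / 2 /\ b' = b).

Lemma nested_intervals (a b : nat -> R) :
  a 0%nat <= b 0%nat -> (forall n, half (a n) (b n) (a (S n)) (b (S n))) ->
  (forall n, b n - a n = (b 0%nat - a 0%nat) / 2 ^ n) /\
  exists x, forall n, a 0%nat <= a n <= x /\ x <= b n <= b 0%nat.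
Proof.
intros H0 H.
assert (Hl : forall n, b n - a n = (b 0%nat - a 0%nat) / 2 ^ n).
{ intros n. induction n as [|n IH]; [simpl; field|].
  replace ((b 0%nat - a 0%nat) / 2 ^ S n) with ((b 0%nat - a 0%nat) / 2 ^ n / 2)
    by (simpl; field; apply pow_nonzero; lra).
  destruct (H n) as [[-> ->]|[-> ->]]; lra. }
split; auto.
assert (Hle : forall n, a n <= b n).
{ intros n. assert (0 <= (b 0%nat - a 0%nat) / 2 ^ n).
  { apply Rdiv_le_0_compat; [lra|]. apply pow_lt; lra. } rewrite <- Hl in H1. lra. }
assert (Hm : forall n k, a n <= a (n + k)%nat /\ b (n + k)%nat <= b n).
{ intros n k. induction k as [|k IH]; [rewrite Nat.add_0_r; lra|].
  rewrite Nat.add_succ_r. specialize (Hle (n + k)%nat).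
  destruct (H (n + k)%nat) as [[-> ->]|[-> ->]]; lra. }
assert (Hab : forall n m, a n <= b m).
{ intros n m. destruct (Nat.le_ge_cases n m) as [L|L].
  - replace m with (n + (m - n))%nat by lia. apply Rle_trans with (a (n + (m-n))%nat).
    apply Hm. apply Hle.
  - replace n with (m + (n - m))%nat by lia. apply Rle_trans with (b (m + (n-m))%nat).
    apply Hle. apply Hm. }
destruct (completeness (fun x => exists n, x = a n)) as [x [Hx1 Hx2]].
- exists (b 0%nat). intros y [n ->]. apply Hab.
- exists (a 0%nat). now exists 0%nat.
- exists x. intros n. destruct (Hm 0%nat n) as [A B]. simpl in A, B.
  repeat split; auto.
  + apply Hx1; now exists n.
  + apply Hx2. intros y [m ->]. apply Hab.
Qed.

(** The only compactness argument needed in the plane: a property of rectangles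
    which is always inherited by one of the four quarters persists on
    arbitrarily small rectangles around some point. *)
Lemma nested_rectangles (B : R -> R -> R -> R -> Prop) (a b c d : R) :
  a <= b -> c <= d -> B a b c d ->
  (forall a b c d, a <= b -> c <= d -> B a b c d ->
    exists a' b' c' d', half a b a' b' /\ half c d c' d' /\ B a' b' c' d') ->
  exists x y, forall n, exists a' b' c' d',
    a <= a' <= x /\ x <= b' <= b /\ c <= c' <= y /\ y <= d' <= d /\
    b' - a' = (b - a) / 2 ^ n /\ d' - c' = (d - c) / 2 ^ n /\ B a' b' c' d'.
Proof.
intros Hab Hcd HB Hstep.
set (ok := fun q : (R * R) * (R * R) =>
  fst (fst q) <= snd (fst q) /\ fst (snd q) <= snd (snd q) /\
  B (fst (fst q)) (snd (fst q)) (fst (snd q)) (snd (snd q))).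
assert (Hnext : forall q : {q | ok q}, exists q' : {q | ok q},
  half (fst (fst (proj1_sig q))) (snd (fst (proj1_sig q)))
    (fst (fst (proj1_sig q'))) (snd (fst (proj1_sig q'))) /\
  half (fst (snd (proj1_sig q))) (snd (snd (proj1_sig q)))
    (fst (snd (proj1_sig q'))) (snd (snd (proj1_sig q')))).
{ intros [q [H1 [H2 H3]]]. destruct (Hstep _ _ _ _ H1 H2 H3) as (a' & b' & c' & d' & h1 & h2 &
    h3).
  assert (Hok : ok ((a', b'), (c', d'))).
  { unfold half in *; split; [|split]; simpl; auto; lra. }
  exists (exist ok _ Hok); simpl; auto. }
set (next := fun q => proj1_sig (constructive_indefinite_description _ (Hnext q))).
assert (Hn : forall q, _) by exact (fun q => proj2_sig (constructive_indefinite_description _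
  (Hnext q))).
change (forall q : {q | ok q}, half (fst (fst (proj1_sig q))) (snd (fst (proj1_sig q)))
    (fst (fst (proj1_sig (next q)))) (snd (fst (proj1_sig (next q)))) /\
  half (fst (snd (proj1_sig q))) (snd (snd (proj1_sig q)))
    (fst (snd (proj1_sig (next q)))) (snd (snd (proj1_sig (next q))))) in Hn.
assert (Hok : ok ((a, b), (c, d))) by (split; [|split]; simpl; auto).
set (s := fix s n := match n with O => exist ok _ Hok | S n => next (s n) end).
destruct (nested_intervals (fun n => fst (fst (proj1_sig (s n))))
  (fun n => snd (fst (proj1_sig (s n))))) as [Hl [x Hx]]; [exact Hab | intros n; apply (Hn (s
    n))|].
destruct (nested_intervals (fun n => fst (snd (proj1_sig (s n))))
  (fun n => snd (snd (proj1_sig (s n))))) as [Hl' [y Hy]]; [exact Hcd | intros n; apply (Hn (s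
    n))|].
exists x, y. intros n.
exists (fst (fst (proj1_sig (s n)))), (snd (fst (proj1_sig (s n)))),
  (fst (snd (proj1_sig (s n)))), (snd (snd (proj1_sig (s n)))).
specialize (Hx n). specialize (Hy n). specialize (Hl n). specialize (Hl' n). simpl in *.
destruct Hx as [? ?], Hy as [? ?]. repeat (split; [assumption|]).
apply (proj2_sig (s n)).
Qed.

Lemma half_pow_small (L d : R) : 0 < d -> exists n, L / 2 ^ n < d.
Proof.
intros Hd. destruct (pow_lt_1_zero (/ 2)) with (y := d / (Rabs L + 1)) as [n Hn].
- rewrite Rabs_right; lra.
- apply Rdiv_lt_0_compat; auto. assert (H := Rabs_pos L). lra.
- exists n. specialize (Hn n (le_n n)). rewrite Rabs_right in Hn.
  + rewrite pow_inv in Hn. assert (H := Rabs_pos L). apply Rlt_div_r in Hn; [|lra].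
    eapply Rle_lt_trans; [|exact Hn]. unfold Rdiv. rewrite Rmult_comm.
    apply Rmult_le_compat_l.
    * left. apply Rinv_0_lt_compat, pow_lt; lra.
    * assert (H' := Rle_abs L). lra.
  + apply Rle_ge. apply pow_le; lra.
Qed.

(** * Integrals over boundaries of rectangles *)

Lemma Cmod_horizontal (t x y : R) : Cmod ((t, y) - (x, y))%C = Rabs (t - x).
Proof.
unfold Cmod; simpl. replace (_ * _ + _) with (Rsqr (t - x)) by (unfold Rsqr; ring).
apply sqrt_Rsqr_abs.
Qed.

Lemma Cmod_vertical (t x y : R) : Cmod ((x, t) - (x, y))%C = Rabs (t - y).
Proof.
unfold Cmod; simpl. replace (_ * _ + _) with (Rsqr (t - y)) by (unfold Rsqr; ring).
apply sqrt_Rsqr_abs.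
Qed.

Lemma ccont_horizontal f x y : ccont f (x, y) -> rcont (fun t => f (t, y)) x.
Proof.
intros H. apply rcont_eps. intros eps He. destruct (H eps He) as [d [Hd H1]].
exists d; split; auto. intros t Ht. apply H1. now rewrite Cmod_horizontal.
Qed.

Lemma ccont_vertical f x y : ccont f (x, y) -> rcont (fun t => f (x, t)) y.
Proof.
intros H. apply rcont_eps. intros eps He. destruct (H eps He) as [d [Hd H1]].
exists d; split; auto. intros t Ht. apply H1. now rewrite Cmod_vertical.
Qed.

Lemma is_cderive_horizontal f x y l :
  is_cderive f (x, y) l -> is_rderive (fun t => f (t, y)) x l.
Proof.
intros H. apply is_rderive_eps. intros eps He.
destruct (proj1 (is_cderive_eps _ _ _) H eps He) as [d [Hd H1]].
exists d; split; auto. intros t Ht. specialize (H1 (t, y)).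
rewrite Cmod_horizontal in H1. specialize (H1 Ht).
replace (RtoC (t - x) * l)%C with (l * ((t, y) - (x, y)))%C; auto.
apply injective_projections; simpl; ring.
Qed.

Lemma is_cderive_vertical f x y l :
  is_cderive f (x, y) l -> is_rderive (fun t => f (x, t)) y (Ci * l)%C.
Proof.
intros H. apply is_rderive_eps. intros eps He.
destruct (proj1 (is_cderive_eps _ _ _) H eps He) as [d [Hd H1]].
exists d; split; auto. intros t Ht. specialize (H1 (x, t)).
rewrite Cmod_vertical in H1. specialize (H1 Ht).
replace (RtoC (t - y) * (Ci * l))%C with (l * ((x, t) - (x, y)))%C; auto.
apply injective_projections; simpl; ring.
Qed.

(** The edges are oriented, and the corners may be given in any order. *)
Definition rect_int (f : C -> C) (a b c d : R) : C :=
  (CInt (fun x => f (x, c)) a b - CInt (fun x => f (x, d)) a b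
   + Ci * (CInt (fun y => f (b, y)) c d - CInt (fun y => f (a, y)) c d))%C.

Definition between (a b x : R) := Rmin a b <= x <= Rmax a b.

Definition in_rect (a b c d : R) (z : C) := between a b (fst z) /\ between c d (snd z).

Definition cont_rect (f : C -> C) (a b c d : R) :=
  forall z, in_rect a b c d z -> ccont f z.

Lemma between_l a b : between a b a.
Proof. split; [apply Rmin_l | apply Rmax_l]. Qed.
Lemma between_r a b : between a b b.
Proof. split; [apply Rmin_r | apply Rmax_r]. Qed.

Lemma cont_h f a b c d y : cont_rect f a b c d -> between c d y ->
  cont_on (fun x => f (x, y)) a b.
Proof. intros H Hy x Hx. apply ccont_horizontal, H. split; assumption. Qed.

Lemma cont_v f a b c d x : cont_rect f a b c d -> between a b x ->
  cont_on (fun y => f (x, y)) c d.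
Proof. intros H Hy y Hx. apply ccont_vertical, H. split; assumption. Qed.

Lemma between_sub a b m x y : between a b x -> between a b y -> between x y m -> between a b m.
Proof.
unfold between. intros H1 H2 H3. split.
- apply Rle_trans with (Rmin x y); [apply Rmin_glb|]; lra.
- apply Rle_trans with (Rmax x y); [|apply Rmax_lub]; lra.
Qed.

Lemma cont_rect_sub f a b c d a' b' c' d' : cont_rect f a b c d ->
  between a b a' -> between a b b' -> between c d c' -> between c d d' ->
  cont_rect f a' b' c' d'.
Proof.
intros H Ha Hb Hc Hd z [Hz1 Hz2]. apply H; split.
- exact (between_sub _ _ _ _ _ Ha Hb Hz1).
- exact (between_sub _ _ _ _ _ Hc Hd Hz2).
Qed.

Lemma rect_int_split_x f a m b c d :
  cont_rect f a b c d -> between a b m ->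
  (rect_int f a m c d + rect_int f m b c d)%C = rect_int f a b c d.
Proof.
intros H Hm. assert (Ha := between_l a b). assert (Hb := between_r a b).
assert (Hc := between_l c d). assert (Hd := between_r c d).
assert (H1 : cont_rect f a m c d) by (apply (cont_rect_sub f a b c d); auto).
assert (H2 : cont_rect f m b c d) by (apply (cont_rect_sub f a b c d); auto).
unfold rect_int.
rewrite <- (CInt_Chasles (fun x => f (x, c)) a m b); try (eapply cont_h; eauto).
rewrite <- (CInt_Chasles (fun x => f (x, d)) a m b); try (eapply cont_h; eauto).
ring.
Qed.

Lemma rect_int_split_y f a b c m d :
  cont_rect f a b c d -> between c d m ->
  (rect_int f a b c m + rect_int f a b m d)%C = rect_int f a b c d.
Proof.
intros H Hm. assert (Ha := between_l a b). assert (Hb := between_r a b).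
assert (Hc := between_l c d). assert (Hd := between_r c d).
assert (H1 : cont_rect f a b c m) by (apply (cont_rect_sub f a b c d); auto).
assert (H2 : cont_rect f a b m d) by (apply (cont_rect_sub f a b c d); auto).
unfold rect_int.
rewrite <- (CInt_Chasles (fun y => f (a, y)) c m d); try (eapply cont_v; eauto).
rewrite <- (CInt_Chasles (fun y => f (b, y)) c m d); try (eapply cont_v; eauto).
ring.
Qed.

Definition on_boundary (a b c d : R) (z : C) :=
  in_rect a b c d z /\ (fst z = a \/ fst z = b \/ snd z = c \/ snd z = d).

Definition cont_bdry (f : C -> C) (a b c d : R) :=
  forall z, on_boundary a b c d z -> ccont f z.

Lemma cont_rect_bdry f a b c d : cont_rect f a b c d -> cont_bdry f a b c d.
Proof. intros H z [Hz _]. now apply H. Qed.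

Lemma cont_edges f a b c d : cont_bdry f a b c d ->
  cont_on (fun x => f (x, c)) a b /\ cont_on (fun x => f (x, d)) a b /\
  cont_on (fun y => f (b, y)) c d /\ cont_on (fun y => f (a, y)) c d.
Proof.
intros H. assert (Ha := between_l a b). assert (Hb := between_r a b).
assert (Hc := between_l c d). assert (Hd := between_r c d).
repeat split; intros t Ht; (apply ccont_horizontal || apply ccont_vertical);
  apply H; (split; [split; assumption | simpl; tauto]).
Qed.

Lemma rect_int_swap_x f a b c d : cont_bdry f a b c d ->
  rect_int f b a c d = (- rect_int f a b c d)%C.
Proof.
intros (?&?&?&?)%cont_edges. unfold rect_int.
rewrite !(CInt_swap _ a b) by assumption.
ring.
Qed.

Lemma rect_int_swap_y f a b c d : cont_bdry f a b c d ->
  rect_int f a b d c = (- rect_int f a b c d)%C.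
Proof.
intros (?&?&?&?)%cont_edges. unfold rect_int.
rewrite !(CInt_swap _ c d) by assumption.
ring.
Qed.

Lemma rect_int_bound f a b c d M : cont_bdry f a b c d ->
  (forall z, on_boundary a b c d z -> Cmod (f z) <= M) ->
  Cmod (rect_int f a b c d) <= 2 * (Rabs (b - a) + Rabs (d - c)) * M.
Proof.
intros H HM. assert (Ha := between_l a b). assert (Hb := between_r a b).
assert (Hc := between_l c d). assert (Hd := between_r c d).
destruct (cont_edges _ _ _ _ _ H) as (C1&C2&C3&C4).
assert (B1 := CInt_bound (fun x => f (x, c)) a b M C1
  ltac:(intros x Hx; apply HM; split; [split|]; simpl; auto)).
assert (B2 := CInt_bound (fun x => f (x, d)) a b M C2
  ltac:(intros x Hx; apply HM; split; [split|]; simpl; auto)).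
assert (B3 := CInt_bound (fun y => f (b, y)) c d M C3
  ltac:(intros x Hx; apply HM; split; [split|]; simpl; auto)).
assert (B4 := CInt_bound (fun y => f (a, y)) c d M C4
  ltac:(intros x Hx; apply HM; split; [split|]; simpl; auto)).
unfold rect_int.
eapply Rle_trans; [apply Cmod_triangle|].
rewrite Cmod_mult, Cmod_Ci, Rmult_1_l.
assert (T : forall u v : C, Cmod (u - v) <= Cmod u + Cmod v).
{ intros u v. unfold Cminus. eapply Rle_trans; [apply Cmod_triangle|]. rewrite Cmod_opp. lra. }
assert (T1 := T (CInt (fun x => f (x, c)) a b) (CInt (fun x => f (x, d)) a b)).
assert (T2 := T (CInt (fun y => f (b, y)) c d) (CInt (fun y => f (a, y)) c d)).
lra.
Qed.

Lemma rect_int_minus f g a b c d : cont_bdry f a b c d -> cont_bdry g a b c d ->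
  rect_int (fun z => f z - g z)%C a b c d = (rect_int f a b c d - rect_int g a b c d)%C.
Proof.
intros (?&?&?&?)%cont_edges (?&?&?&?)%cont_edges. unfold rect_int.
rewrite (CInt_minus (fun x => f (x, c)) (fun x => g (x, c))),
  (CInt_minus (fun x => f (x, d)) (fun x => g (x, d))),
  (CInt_minus (fun y => f (b, y)) (fun y => g (b, y))),
  (CInt_minus (fun y => f (a, y)) (fun y => g (a, y))) by assumption.
ring.
Qed.

Lemma rect_int_Cmult (k : C) f a b c d : cont_bdry f a b c d ->
  rect_int (fun z => k * f z)%C a b c d = (k * rect_int f a b c d)%C.
Proof.
intros (?&?&?&?)%cont_edges. unfold rect_int.
rewrite (CInt_Cmult k (fun x => f (x, c))), (CInt_Cmult k (fun x => f (x, d))),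
  (CInt_Cmult k (fun y => f (b, y))), (CInt_Cmult k (fun y => f (a, y))) by assumption.
ring.
Qed.

Lemma rect_int_ext f g a b c d : (forall z, on_boundary a b c d z -> f z = g z) ->
  rect_int f a b c d = rect_int g a b c d.
Proof.
intros H. unfold rect_int.
assert (Ha := between_l a b). assert (Hb := between_r a b).
assert (Hc := between_l c d). assert (Hd := between_r c d).
rewrite (CInt_ext (fun x => f (x, c)) (fun x => g (x, c))),
  (CInt_ext (fun x => f (x, d)) (fun x => g (x, d))),
  (CInt_ext (fun y => f (a, y)) (fun y => g (a, y))),
  (CInt_ext (fun y => f (b, y)) (fun y => g (b, y))); auto;
  intros x Hx; apply H; (split; [split|]); simpl; auto.
Qed.

(** The four edges telescope around the corners. *)
Lemma rect_int_primitive (F f : C -> C) a b c d :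
  (forall z, on_boundary a b c d z -> is_cderive F z (f z)) ->
  cont_bdry f a b c d -> rect_int f a b c d = 0%C.
Proof.
intros HF H. assert (Ha := between_l a b). assert (Hb := between_r a b).
assert (Hc := between_l c d). assert (Hd := between_r c d).
destruct (cont_edges _ _ _ _ _ H) as (C1&C2&C3&C4).
assert (Hh : forall y, y = c \/ y = d -> CInt (fun x => f (x, y)) a b = (F (b, y) - F (a,
  y))%C).
{ intros y Hy. assert (Hy' : between c d y) by (destruct Hy as [->| ->]; assumption).
  apply (CInt_FTC (fun x => F (x, y))).
  - intros x Hx. apply is_cderive_horizontal, HF. split; [split; assumption|]. simpl; tauto.
  - destruct Hy as [-> | ->]; assumption. }
assert (Hv : forall x, x = a \/ x = b -> (Ci * CInt (fun y => f (x, y)) c d)%C = (F (x, d) - F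
  (x, c))%C).
{ intros x Hx. assert (Hx' : between a b x) by (destruct Hx as [->| ->]; assumption).
  rewrite <- CInt_Cmult by (destruct Hx as [-> | ->]; assumption).
  apply (CInt_FTC (fun y => F (x, y))).
  - intros y Hy. apply is_cderive_vertical, HF. split; [split; assumption|]. simpl; tauto.
  - intros y Hy. apply rcont_Cmult. destruct Hx as [-> | ->]; [now apply C4 | now apply C3]. }
unfold rect_int.
replace (Ci * (CInt (fun y => f (b, y)) c d - CInt (fun y => f (a, y)) c d))%C with
  (Ci * CInt (fun y => f (b, y)) c d - Ci * CInt (fun y => f (a, y)) c d)%C by ring.
rewrite (Hh c), (Hh d), (Hv a), (Hv b) by tauto. ring.
Qed.

(** * Goursat's theorem *)

Definition differentiable_at (f : C -> C) (z : C) := exists l, is_cderive f z l.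

Lemma Cmod_le_abs (z : C) : Cmod z <= Rabs (fst z) + Rabs (snd z).
Proof.
replace z with ((fst z, 0) + (0, snd z))%C at 1
  by (apply injective_projections; simpl; ring).
eapply Rle_trans; [apply Cmod_triangle|]. apply Rplus_le_compat; right.
- replace (fst z, 0) with ((fst z, 0) - (0, 0))%C by (apply injective_projections; simpl; ring).
  rewrite Cmod_horizontal. f_equal; ring.
- replace (0, snd z) with ((0, snd z) - (0, 0))%C by (apply injective_projections; simpl; ring).
  rewrite Cmod_vertical. f_equal; ring.
Qed.

Lemma fst_le_Cmod (z : C) : Rabs (fst z) <= Cmod z.
Proof. eapply Rle_trans; [|apply Rmax_Cmod]. apply Rmax_l. Qed.
Lemma snd_le_Cmod (z : C) : Rabs (snd z) <= Cmod z.
Proof. eapply Rle_trans; [|apply Rmax_Cmod]. apply Rmax_r. Qed.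

Lemma rect_int_affine (u l z0 : C) a b c d :
  rect_int (fun w => u + l * (w - z0))%C a b c d = 0%C /\
  cont_rect (fun w => u + l * (w - z0))%C a b c d.
Proof.
assert (D : forall z, is_cderive (fun w => u + l * (w - z0))%C z l).
{ intros z. eapply is_cderive_eq; [cderive | ring]. }
assert (K : cont_rect (fun w => u + l * (w - z0))%C a b c d).
{ intros z _. eapply is_cderive_ccont, D. }
split; auto.
apply rect_int_primitive with (F := fun w => (u * w + l / 2 * ((w - z0) * (w - z0)))%C);
  [|now apply cont_rect_bdry].
intros z _. eapply is_cderive_eq; [cderive | field; injection; lra].
Qed.

Lemma between_le a b x : a <= b -> between a b x <-> a <= x <= b.
Proof. intros H. unfold between. rewrite Rmin_left, Rmax_right; auto. tauto. Qed.

Lemma rect_int_degenerate f a b c d : a = b \/ c = d -> rect_int f a b c d = 0%C.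
Proof.
intros [-> | ->]; unfold rect_int; rewrite !CInt_point; ring.
Qed.

(** Goursat's bisection, with [|integral| >= const * area] as the inherited
    property. Near the limit point [f] is affine up to [eps |w - z|], and affine
    functions have primitives, so the integral over a small rectangle is at most
    [eps] times its area. *)
Lemma goursat_ordered f a b c d : a <= b -> c <= d ->
  (forall z, in_rect a b c d z -> differentiable_at f z) ->
  rect_int f a b c d = 0%C.
Proof.
intros Hab Hcd Hf.
assert (Hcont : cont_rect f a b c d).
{ intros z Hz. destruct (Hf z Hz) as [l Hl]. eapply is_cderive_ccont, Hl. }
destruct (Req_dec a b) as [E|Eab]; [apply rect_int_degenerate; auto|].
destruct (Req_dec c d) as [E|Ecd]; [apply rect_int_degenerate; auto|].
destruct (Ceq_dec (rect_int f a b c d) 0%C) as [E|E]; auto. exfalso.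
set (N := Cmod (rect_int f a b c d)).
assert (HN : 0 < N) by now apply Cmod_gt_0.
set (ar := (b - a) * (d - c)). assert (Har : 0 < ar) by (apply Rmult_lt_0_compat; lra).
set (Bad := fun a' b' c' d' => a <= a' /\ a' <= b' /\ b' <= b /\ c <= c' /\ c' <= d' /\ d' <= d
  /\
   N * ((b' - a') * (d' - c')) <= Cmod (rect_int f a' b' c' d') * ar).
assert (Hsub : forall a' b' c' d', a <= a' -> a' <= b' -> b' <= b -> c <= c' -> c' <= d' -> d'
  <= d ->
  cont_rect f a' b' c' d').
{ intros. apply (cont_rect_sub f a b c d); auto; apply between_le; lra. }
destruct (nested_rectangles Bad a b c d) as (x & y & Hxy); auto.
{ unfold Bad, N, ar. repeat split; lra. }
{ intros a1 b1 c1 d1 h1 h2 (B1 & B2 & B3 & B4 & B5 & B6 & B7).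
  set (m := (a1 + b1) / 2). set (n := (c1 + d1) / 2).
  assert (Hm : a1 <= m <= b1) by (unfold m; lra).
  assert (Hn : c1 <= n <= d1) by (unfold n; lra).
  assert (S0 := rect_int_split_x f a1 m b1 c1 d1 ltac:(apply Hsub; lra) ltac:(apply between_le;
    lra)).
  assert (S1 := rect_int_split_y f a1 m c1 n d1 ltac:(apply Hsub; lra) ltac:(apply between_le;
    lra)).
  assert (S2 := rect_int_split_y f m b1 c1 n d1 ltac:(apply Hsub; lra) ltac:(apply between_le;
    lra)).
  assert (T1 := Cmod_triangle (rect_int f a1 m c1 d1) (rect_int f m b1 c1 d1)).
  assert (T2 := Cmod_triangle (rect_int f a1 m c1 n) (rect_int f a1 m n d1)).
  assert (T3 := Cmod_triangle (rect_int f m b1 c1 n) (rect_int f m b1 n d1)).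
  rewrite S0 in T1. rewrite S1 in T2. rewrite S2 in T3.
  assert (Hmx : m - a1 = (b1 - a1) / 2 /\ b1 - m = (b1 - a1) / 2) by (unfold m; lra).
  assert (Hnx : n - c1 = (d1 - c1) / 2 /\ d1 - n = (d1 - c1) / 2) by (unfold n; lra).
  set (q := (b1 - a1) / 2 * ((d1 - c1) / 2)).
  assert (Hq : (b1 - a1) * (d1 - c1) = 4 * q) by (unfold q; lra).
  rewrite Hq in B7.
  destruct (Rle_dec (N * q) (Cmod (rect_int f a1 m c1 n) * ar)) as [Q|Q1];
  [|destruct (Rle_dec (N * q) (Cmod (rect_int f a1 m n d1) * ar)) as [Q|Q2];
  [|destruct (Rle_dec (N * q) (Cmod (rect_int f m b1 c1 n) * ar)) as [Q|Q3];
  [|destruct (Rle_dec (N * q) (Cmod (rect_int f m b1 n d1) * ar)) as [Q|Q4]]]].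
  - exists a1, m, c1, n. split; [left; auto|split; [left; auto|]].
    unfold Bad. rewrite (proj1 Hmx), (proj1 Hnx). repeat split; auto; lra.
  - exists a1, m, n, d1. split; [left; auto|split; [right; auto|]].
    unfold Bad. rewrite (proj1 Hmx), (proj2 Hnx). repeat split; auto; lra.
  - exists m, b1, c1, n. split; [right; auto|split; [left; auto|]].
    unfold Bad. rewrite (proj2 Hmx), (proj1 Hnx). repeat split; auto; lra.
  - exists m, b1, n, d1. split; [right; auto|split; [right; auto|]].
    unfold Bad. rewrite (proj2 Hmx), (proj2 Hnx). repeat split; auto; lra.
  - exfalso. assert (Cmod (rect_int f a1 b1 c1 d1) * ar <=
      (Cmod (rect_int f a1 m c1 n) + Cmod (rect_int f a1 m n d1) +
       (Cmod (rect_int f m b1 c1 n) + Cmod (rect_int f m b1 n d1))) * ar).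
    { apply Rmult_le_compat_r; lra. }
    lra. }
set (L := b - a + (d - c)). assert (HL : 0 < L) by (unfold L; lra).
assert (Hin : in_rect a b c d (x, y)).
{ destruct (Hxy 0%nat) as (a' & b' & c' & d' & H1 & H2 & H3 & H4 & _).
  split; apply between_le; simpl; lra. }
destruct (Hf _ Hin) as [l Hl].
(* Half of the slope at which the estimate on small rectangles would be sharp. *)
assert (Heps : 0 < N / (4 * (L * L))).
{ apply Rdiv_lt_0_compat; auto. repeat apply Rmult_lt_0_compat; lra. }
destruct (proj1 (is_cderive_eps _ _ _) Hl _ Heps) as [dl [Hdl H]].
destruct (half_pow_small L dl Hdl) as [n Hn].
destruct (Hxy n) as (a' & b' & c' & d' & H1 & H2 & H3 & H4 & H5 & H6 & HB).
destruct HB as (_ & _ & _ & _ & _ & _ & HB).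
set (p := 2 ^ n) in *. assert (Hp : 0 < p) by (apply pow_lt; lra).
set (aff := fun w => (f (x, y) + l * (w - (x, y)))%C).
destruct (rect_int_affine (f (x, y)) l (x, y) a' b' c' d') as [A0 A1].
assert (HJ : Cmod (rect_int f a' b' c' d') <= 2 * (L / p) * (N / (4 * (L * L)) * (L / p))).
{ assert (Hc' : cont_rect f a' b' c' d') by (apply Hsub; lra).
  replace (rect_int f a' b' c' d') with (rect_int (fun w => f w - aff w)%C a' b' c' d')
    by (rewrite rect_int_minus by (now apply cont_rect_bdry); unfold aff; rewrite A0; ring).
  replace (2 * (L / p)) with (2 * (Rabs (b' - a') + Rabs (d' - c'))).
  2:{ rewrite !Rabs_right by lra. rewrite H5, H6. unfold L. field. lra. }
  apply rect_int_bound.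
  - apply cont_rect_bdry. intros z Hz eps He.
    destruct (Hc' z Hz (eps / 2)) as [e1 [E1 F1]]; [lra|].
    destruct (A1 z Hz (eps / 2)) as [e2 [E2 F2]]; [lra|].
    exists (Rmin e1 e2); split; [now apply Rmin_case|]. intros w Hw.
    specialize (F1 w (Rlt_le_trans _ _ _ Hw (Rmin_l _ _))).
    specialize (F2 w (Rlt_le_trans _ _ _ Hw (Rmin_r _ _))).
    replace (f w - aff w - (f z - aff z))%C with ((f w - f z) + - (aff w - aff z))%C by ring.
    eapply Rle_lt_trans; [apply Cmod_triangle|]. rewrite Cmod_opp.
    unfold aff. cbv beta in F2. lra.
  - intros z [[Hz1 Hz2] _]. rewrite between_le in Hz1 by lra. rewrite between_le in Hz2 by lra.
    assert (Hz : Cmod (z - (x, y)) <= L / p).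
    { eapply Rle_trans; [apply Cmod_le_abs|]. simpl.
      replace (L / p) with (b' - a' + (d' - c')) by (rewrite H5, H6; unfold L; field; lra).
      apply Rplus_le_compat; apply Rabs_le; lra. }
    replace (f z - aff z)%C with (f z - f (x, y) - l * (z - (x, y)))%C by (unfold aff; ring).
    eapply Rle_trans; [apply H; lra|]. apply Rmult_le_compat_l; lra. }
rewrite H5, H6 in HB.
assert (HX : Cmod (rect_int f a' b' c' d') * ar <= N / (2 * p * p) * ar).
{ apply Rmult_le_compat_r; [lra|]. eapply Rle_trans; [exact HJ|]. right. field. lra. }
assert (HY : N * ((b - a) / p * ((d - c) / p)) = 2 * (N / (2 * p * p) * ar)).
{ unfold ar. field. lra. }
assert (0 < N / (2 * p * p) * ar).
{ apply Rmult_lt_0_compat; auto. apply Rdiv_lt_0_compat; auto.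
  repeat apply Rmult_lt_0_compat; lra. }
lra.
Qed.

Lemma in_rect_swap_x a b c d z : in_rect a b c d z -> in_rect b a c d z.
Proof. unfold in_rect, between. now rewrite Rmin_comm, Rmax_comm. Qed.
Lemma in_rect_swap_y a b c d z : in_rect a b c d z -> in_rect a b d c z.
Proof. unfold in_rect, between. now rewrite (Rmin_comm c), (Rmax_comm c). Qed.

Lemma goursat f a b c d :
  (forall z, in_rect a b c d z -> differentiable_at f z) ->
  rect_int f a b c d = 0%C.
Proof.
assert (Hx : forall a b c d, c <= d -> (forall z, in_rect a b c d z -> differentiable_at f z) ->
  rect_int f a b c d = 0%C).
{ clear. intros a b c d Hcd H. destruct (Rle_dec a b) as [L|L]; [now apply goursat_ordered|].
  assert (H' : forall z, in_rect b a c d z -> differentiable_at f z)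
    by (intros z Hz; now apply H, in_rect_swap_x).
  rewrite rect_int_swap_x.
  - rewrite goursat_ordered; auto; [ring | lra].
  - intros z [Hz _]. destruct (H' z Hz) as [l Hl]. eapply is_cderive_ccont, Hl. }
intros H. destruct (Rle_dec c d) as [L|L]; [now apply Hx|].
assert (H' : forall z, in_rect a b d c z -> differentiable_at f z)
  by (intros z Hz; now apply H, in_rect_swap_y).
rewrite rect_int_swap_y.
- rewrite Hx; auto; [ring | lra].
- intros z [Hz _]. destruct (H' z Hz) as [l Hl]. eapply is_cderive_ccont, Hl.
Qed.

Lemma between_scaled p X t : 0 <= t <= 1 -> between p X (p + t * (X - p)).
Proof.
intros Ht. unfold between, Rmin, Rmax. destruct (Rle_dec p X); nra.
Qed.

Lemma not_between_scaled p X t : p <> X -> 0 < t <= 1 -> ~ between (p + t * (X - p)) X p.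
Proof.
intros Hne Ht. unfold between, Rmin, Rmax.
destruct (Rle_dec _ _); nra.
Qed.

(** The two parts cut off away from the corner avoid [p]; what remains has
    arbitrarily small perimeter, and [f] is bounded near [p]. *)
Lemma goursat_corner f (p : C) X Y :
  cont_rect f (fst p) X (snd p) Y ->
  (forall z, in_rect (fst p) X (snd p) Y z -> z <> p -> differentiable_at f z) ->
  rect_int f (fst p) X (snd p) Y = 0%C.
Proof.
destruct p as [x y]; simpl. intros Hc Hd.
destruct (Req_dec x X) as [E|Ex]; [apply rect_int_degenerate; auto|].
destruct (Req_dec y Y) as [E|Ey]; [apply rect_int_degenerate; auto|].
set (L := Rabs (X - x) + Rabs (Y - y)).
assert (HL : 0 < L).
{ unfold L. assert (H1 := Rabs_pos (Y - y)).
  assert (H2 : 0 < Rabs (X - x)) by (apply Rabs_pos_lt; lra). lra. }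
set (M := Cmod (f (x, y)) + 1). assert (HM : 0 < M) by (assert (H := Cmod_ge_0 (f (x, y)));
  unfold M; lra).
assert (Hsmall : exists d, 0 < d <= 1 /\ forall t, 0 < t < d ->
   Cmod (rect_int f x X y Y) <= 2 * (t * L) * M).
{ destruct (Hc (x, y)) with (eps := 1) as [d [Hd1 Hd2]];
    [split; apply between_l | lra |].
  assert (HdL : 0 < d / L) by now apply Rdiv_lt_0_compat.
  exists (Rmin 1 (d / L)). split. { split; [apply Rmin_case; lra | apply Rmin_l]. }
  intros t [Ht0 Ht1]. destruct (lt_Rmin _ _ _ Ht1) as [Ht2 Ht3]. apply Rlt_div_r in Ht3; auto.
  set (X' := x + t * (X - x)). set (Y' := y + t * (Y - y)).
  assert (HX' : between x X X') by (apply between_scaled; lra).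
  assert (HY' : between y Y Y') by (apply between_scaled; lra).
  assert (B1 := between_l x X). assert (B2 := between_r x X).
  assert (B3 := between_l y Y). assert (B4 := between_r y Y).
  rewrite <- (rect_int_split_x f x X' X y Y); auto.
  rewrite <- (rect_int_split_y f x X' y Y' Y); auto.
  2:{ apply (cont_rect_sub f x X y Y); auto. }
  rewrite (goursat f X' X y Y), (goursat f x X' Y' Y).
  - replace (rect_int f x X' y Y' + 0 + 0)%C with (rect_int f x X' y Y') by ring.
    replace (t * L) with (Rabs (X' - x) + Rabs (Y' - y)).
    2:{ unfold X', Y', L. replace (x + t * (X - x) - x) with (t * (X - x)) by ring.
        replace (y + t * (Y - y) - y) with (t * (Y - y)) by ring.
        rewrite !Rabs_mult, (Rabs_right t) by lra. ring. }
    apply rect_int_bound; [apply cont_rect_bdry, (cont_rect_sub f x X y Y); auto|].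
    intros z [[Hz1 Hz2] _].
    assert (Hz : Cmod (z - (x, y)) <= t * L).
    { eapply Rle_trans; [apply Cmod_le_abs|]. simpl. unfold L. rewrite Rmult_plus_distr_l.
      assert (Q : forall p P q, between p (p + t * (P - p)) q -> Rabs (q - p) <= t * Rabs (P -
        p)).
      { clear - Ht0. intros p P q H. replace (t * Rabs (P - p)) with (Rabs (t * (P - p))).
        2:{ rewrite Rabs_mult, (Rabs_right t); lra. }
        unfold between, Rmin, Rmax in H. unfold Rabs.
        destruct (Rle_dec p (p + t * (P - p))), (Rcase_abs (q - p)), (Rcase_abs (t * (P - p)));
          lra. }
      apply Rplus_le_compat; apply Q; assumption. }
    replace (f z) with ((f z - f (x, y)) + f (x, y))%C by ring.
    eapply Rle_trans; [apply Cmod_triangle|]. unfold M.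
    assert (Cmod (f z - f (x, y)) < 1) by (apply Hd2; lra). lra.
  - intros z [Hz1 Hz2]. apply Hd.
    + split; [apply (between_sub x X (fst z) x X'); auto | apply (between_sub y Y (snd z) Y' Y);
        auto].
    + intros ->. apply (not_between_scaled y Y t); auto. lra.
  - intros z [Hz1 Hz2]. apply Hd.
    + split; [apply (between_sub x X (fst z) X' X); auto | apply (between_sub y Y (snd z) y Y);
        auto].
    + intros ->. apply (not_between_scaled x X t); auto. lra. }
destruct Hsmall as [d [[Hd0 Hd1] H]].
destruct (Ceq_dec (rect_int f x X y Y) 0%C) as [E|E]; auto. exfalso.
apply Cmod_gt_0 in E. set (J := Cmod (rect_int f x X y Y)) in *.
assert (HLM : 0 < L * M) by now apply Rmult_lt_0_compat.
assert (HJ : 0 < J / (4 * (L * M))) by (apply Rdiv_lt_0_compat; lra).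
set (t := Rmin (d / 2) (J / (4 * (L * M)))).
assert (Ht : 0 < t < d).
{ unfold t. split; [apply Rmin_case; lra|]. eapply Rle_lt_trans; [apply Rmin_l|]. lra. }
specialize (H t Ht).
assert (t * (4 * (L * M)) <= J).
{ apply Rle_div_r; [lra|]. apply Rmin_r. }
lra.
Qed.

(** Goursat's theorem also holds for a function that is merely continuous at
    one point: four rectangles have this point as a corner, and the part of
    them near the corner can be made arbitrarily small. *)
Lemma goursat_except f (p : C) a b c d :
  cont_rect f a b c d ->
  (forall z, in_rect a b c d z -> z <> p -> differentiable_at f z) ->
  rect_int f a b c d = 0%C.
Proof.
intros Hc Hd.
destruct (classic (in_rect a b c d p)) as [[P1 P2]|HP].
2:{ apply goursat. intros z Hz. apply Hd; auto. intros ->; auto. }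
assert (B1 := between_l a b). assert (B2 := between_r a b).
assert (B3 := between_l c d). assert (B4 := between_r c d).
assert (Q : forall X Y, between a b X -> between c d Y -> rect_int f (fst p) X (snd p) Y = 0%C).
{ intros X Y HX HY. apply goursat_corner.
  - apply (cont_rect_sub f a b c d); auto.
  - intros z [Hz1 Hz2]. apply Hd. split.
    + apply (between_sub a b _ (fst p) X); auto.
    + apply (between_sub c d _ (snd p) Y); auto. }
assert (K : forall X Y, between a b X -> between c d Y -> cont_rect f (fst p) X (snd p) Y).
{ intros X Y HX HY. apply (cont_rect_sub f a b c d); auto. }
assert (K' : forall X Y, between a b X -> between c d Y -> cont_rect f (fst p) X Y (snd p)).
{ intros X Y HX HY. apply (cont_rect_sub f a b c d); auto. }
rewrite <- (rect_int_split_x f a (fst p) b c d); auto.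
rewrite <- (rect_int_split_y f a (fst p) c (snd p) d); auto.
2: apply (cont_rect_sub f a b c d); auto.
rewrite <- (rect_int_split_y f (fst p) b c (snd p) d); auto.
2: apply (cont_rect_sub f a b c d); auto.
rewrite (rect_int_swap_x f (fst p) a c (snd p)), (rect_int_swap_x f (fst p) a (snd p) d)
  by (apply cont_rect_bdry; auto).
rewrite (rect_int_swap_y f (fst p) a (snd p) c), (rect_int_swap_y f (fst p) b (snd p) c)
  by (apply cont_rect_bdry; auto).
rewrite !Q; auto. ring.
Qed.

(** * Differentiable functions and integrals over squares *)

Lemma diff_ccont f z : differentiable_at f z -> ccont f z.
Proof. intros [l Hl]. eapply is_cderive_ccont, Hl. Qed.
Lemma diff_const c z : differentiable_at (fun _ => c) z.
Proof. eexists; apply is_cderive_const. Qed.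
Lemma diff_id z : differentiable_at (fun w => w) z.
Proof. eexists; apply is_cderive_id. Qed.
Lemma diff_plus f g z : differentiable_at f z -> differentiable_at g z ->
  differentiable_at (fun w => f w + g w)%C z.
Proof. intros [l Hl] [m Hm]; eexists; now apply is_cderive_plus; eauto. Qed.
Lemma diff_minus f g z : differentiable_at f z -> differentiable_at g z ->
  differentiable_at (fun w => f w - g w)%C z.
Proof. intros [l Hl] [m Hm]; eexists; now apply is_cderive_minus; eauto. Qed.
Lemma diff_mult f g z : differentiable_at f z -> differentiable_at g z ->
  differentiable_at (fun w => f w * g w)%C z.
Proof. intros [l Hl] [m Hm]; eexists; now apply is_cderive_mult; eauto. Qed.
Lemma diff_comp f g z : differentiable_at f (g z) -> differentiable_at g z ->
  differentiable_at (fun w => f (g w))%C z.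
Proof. intros [l Hl] [m Hm]; eexists; now apply is_cderive_comp; eauto. Qed.
Lemma diff_inv f z : differentiable_at f z -> f z <> 0%C ->
  differentiable_at (fun w => / f w)%C z.
Proof.
intros H H0. apply (diff_comp Cinv); auto. eexists. now apply is_cderive_inv.
Qed.
Lemma diff_div f g z : differentiable_at f z -> differentiable_at g z -> g z <> 0%C ->
  differentiable_at (fun w => f w / g w)%C z.
Proof. intros Hf Hg H0. apply diff_mult; auto. now apply diff_inv. Qed.
Lemma diff_pow n z : differentiable_at (fun w => w ^ n)%C z.
Proof.
induction n as [|n IH]; [exact (diff_const (RtoC 1) z)|].
exact (diff_mult (fun w => w) (fun w => w ^ n)%C z (diff_id z) IH).
Qed.

Lemma is_cderive_ext_loc (f g : C -> C) z l d : 0 < d ->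
  (forall w, Cmod (w - z) < d -> f w = g w) -> is_cderive f z l -> is_cderive g z l.
Proof.
intros Hd H. apply is_derive_ext_loc. apply locally_C_eps. exists d; auto.
Qed.

Lemma diff_ext_loc (f g : C -> C) z d : 0 < d ->
  (forall w, Cmod (w - z) < d -> f w = g w) -> differentiable_at f z -> differentiable_at g z.
Proof.
intros Hd H [l Hl]. exists l. now apply (is_cderive_ext_loc f g z l d).
Qed.

Lemma is_cderive_pow n z : is_cderive (fun w => w ^ S n)%C z (RtoC (INR (S n)) * z ^ n)%C.
Proof.
induction n as [|n IH].
- apply (is_cderive_eq _ _ (1 * 1 + z * 0)%C); [|simpl; ring].
  exact (is_cderive_mult (fun w => w) (fun _ => RtoC 1) z _ _ (is_cderive_id z)
    (is_cderive_const 1 z)).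
- apply (is_cderive_eq _ _ (1 * z ^ S n + z * (RtoC (INR (S n)) * z ^ n))%C).
  + exact (is_cderive_mult (fun w => w) (fun w => w ^ S n)%C z _ _ (is_cderive_id z) IH).
  + rewrite (S_INR (S n)), RtoC_plus. simpl Cpow. ring.
Qed.

Lemma Cmod_triangle_rev (u v : C) : Cmod u - Cmod v <= Cmod (u - v).
Proof.
assert (H := Cmod_triangle (u - v) v). replace (u - v + v)%C with u in H by ring. lra.
Qed.

Lemma Cmod_minus_le (u v : C) : Cmod (u - v) <= Cmod u + Cmod v.
Proof.
unfold Cminus. eapply Rle_trans; [apply Cmod_triangle|]. rewrite Cmod_opp. lra.
Qed.

Definition square_int (f : C -> C) (r : R) : C := rect_int f (-r) r (-r) r.

Lemma square_bdry r z : 0 < r -> on_boundary (-r) r (-r) r z -> r <= Cmod z <= 2 * r.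
Proof.
intros Hr [[H1 H2] H3]. rewrite between_le in H1 by lra. rewrite between_le in H2 by lra.
split.
- assert (A := fst_le_Cmod z). assert (B := snd_le_Cmod z).
  destruct H3 as [H|[H|[H|H]]]; rewrite H in *;
    [|rewrite (Rabs_right r) in * by lra|..|rewrite (Rabs_right r) in * by lra];
    try (rewrite Rabs_Ropp, (Rabs_right r) in * by lra); lra.
- eapply Rle_trans; [apply Cmod_le_abs|].
  assert (Rabs (fst z) <= r) by (apply Rabs_le; lra).
  assert (Rabs (snd z) <= r) by (apply Rabs_le; lra). lra.
Qed.

Lemma square_rect r z : 0 < r -> in_rect (-r) r (-r) r z -> Cmod z <= 2 * r.
Proof.
intros Hr [H1 H2]. rewrite between_le in H1 by lra. rewrite between_le in H2 by lra.
eapply Rle_trans; [apply Cmod_le_abs|].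
assert (Rabs (fst z) <= r) by (apply Rabs_le; lra).
assert (Rabs (snd z) <= r) by (apply Rabs_le; lra). lra.
Qed.

Lemma square_int_bound f r M : 0 < r ->
  (forall z, on_boundary (-r) r (-r) r z -> differentiable_at f z) ->
  (forall z, r <= Cmod z <= 2 * r -> Cmod (f z) <= M) ->
  Cmod (square_int f r) <= 8 * r * M.
Proof.
intros Hr Hd HM. unfold square_int.
replace (8 * r) with (2 * (Rabs (r - - r) + Rabs (r - - r))).
- apply rect_int_bound.
  + intros z Hz. now apply diff_ccont, Hd.
  + intros z Hz. apply HM. now apply square_bdry.
- rewrite Rabs_right; lra.
Qed.

(** The value is [2 PI i]; only a lower bound matters here, and it follows from
    comparing the integrand with a constant on pairs of opposite edges. *)
Lemma square_int_inv r : 0 < r -> 4 <= Cmod (square_int Cinv r).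
Proof.
intros Hr. unfold square_int.
assert (HC : cont_bdry Cinv (-r) r (-r) r).
{ intros z Hz. apply diff_ccont. eexists. apply is_cderive_inv.
  intros ->. apply square_bdry in Hz; auto. rewrite Cmod_0 in Hz. lra. }
destruct (cont_edges _ _ _ _ _ HC) as (C1&C2&C3&C4).
unfold rect_int.
set (h := fun x => (Ci * RtoC (2 * r / (x * x + r * r)))%C).
assert (Hsum : forall x, 0 < x * x + r * r) by (intros; nra).
assert (K : forall g : R -> C, cont_on g (-r) r -> (forall x, -r <= x <= r -> g x = h x) ->
   exists t, CInt g (-r) r = (Ci * RtoC 3 + t)%C /\ Cmod t <= 1).
{ intros g Hg Hgh. exists (CInt (fun x => g x - Ci * RtoC (3 / (2 * r)))%C (-r) r). split.
  - rewrite CInt_minus; auto. 2: intros x _; apply rcont_const.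
    rewrite (CInt_FTC (fun x => (Ci * RtoC (3 / (2 * r) * x))%C) (fun _ => (Ci * RtoC (3 / (2 *
      r)))%C)).
    3: intros x _; apply rcont_const.
    + replace (3 / (2 * r) * - r) with (-3/2) by (field; lra).
      replace (3 / (2 * r) * r) with (3/2) by (field; lra).
      apply injective_projections; simpl; field.
    + intros x _. apply is_rderive_eps. intros eps He. exists 1; split; [lra|]. intros t Ht.
      match goal with |- Cmod ?u <= _ => replace u with (RtoC 0) end.
      * rewrite Cmod_0. apply Rmult_le_pos; [lra | apply Rabs_pos].
      * apply injective_projections; simpl; ring.
  - replace 1 with (Rabs (r - - r) * (1 / (2 * r))).
    2:{ rewrite Rabs_right by lra. field; lra. }
    apply CInt_bound.
    + intros x Hx. apply rcont_minus; [now apply Hg | apply rcont_const].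
    + intros x Hx. rewrite Rmin_left, Rmax_right in Hx by lra. rewrite Hgh by lra. unfold h.
      replace (Ci * RtoC (2 * r / (x * x + r * r)) - Ci * RtoC (3 / (2 * r)))%C with
        (Ci * RtoC (2 * r / (x * x + r * r) - 3 / (2 * r)))%C
        by (rewrite RtoC_minus; ring).
      rewrite Cmod_mult, Cmod_Ci, Rmult_1_l, Cmod_R.
      assert (x * x <= r * r) by nra. specialize (Hsum x).
      assert (1 / r <= 2 * r / (x * x + r * r)).
      { apply (Rle_div_r (1 / r) (2 * r) (x * x + r * r)); auto.
        apply Rle_trans with (1 / r * (2 * (r * r))).
        - apply Rmult_le_compat_l; [|lra]. left; apply Rdiv_lt_0_compat; lra.
        - right; field; lra. }
      assert (2 * r / (x * x + r * r) <= 2 / r).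
      { apply (Rle_div_l (2 * r) (2 / r) (x * x + r * r)); auto.
        apply Rle_trans with (2 / r * (r * r)).
        - right; field; lra.
        - apply Rmult_le_compat_l; [|nra]. left; apply Rdiv_lt_0_compat; lra. }
      replace (3 / (2 * r)) with (3 / 2 * (1 / r)) by (field; lra).
      replace (1 / (2 * r)) with (1 / 2 * (1 / r)) by (field; lra).
      replace (2 / r) with (2 * (1 / r)) in * by (field; lra).
      apply Rabs_le. lra. }
rewrite <- CInt_minus, <- CInt_minus, <- CInt_Cmult; auto.
- destruct (K (fun t => / (t, (-r)%R) - / (t, r))%C) as [t1 [E1 B1]].
  { intros x Hx. apply rcont_minus; auto. }
  { intros x Hx. specialize (Hsum x). unfold h. apply injective_projections; simpl; field; nra.
    }
  destruct (K (fun t => Ci * (/ (r, t) - / ((-r)%R, t)))%C) as [t2 [E2 B2]].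
  { intros x Hx. apply rcont_Cmult, rcont_minus; auto. }
  { intros x Hx. specialize (Hsum x). unfold h. apply injective_projections; simpl; field; nra.
    }
  simpl in *. rewrite E1, E2.
  replace (Ci * 3 + t1 + (Ci * 3 + t2))%C with (Ci * RtoC 6 - (- (t1 + t2)))%C.
  2:{ apply injective_projections; simpl; ring. }
  eapply Rle_trans; [|apply Cmod_triangle_rev].
  rewrite Cmod_mult, Cmod_Ci, Cmod_R, Rabs_right, Cmod_opp by lra.
  assert (T := Cmod_triangle t1 t2). lra.
- intros x Hx. apply rcont_minus; auto.
Qed.

(** * Taylor expansion *)

Definition holo_bounded (f : C -> C) (R0 M : R) :=
  0 < R0 /\ forall z, Cmod z < R0 -> differentiable_at f z /\ Cmod (f z) <= M.

Fixpoint csum (c : nat -> C) (w : C) (n : nat) : C :=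
  match n with O => RtoC 0 | S n => (csum c w n + c n * w ^ n)%C end.

(** Its integral over a square around [0], times [w ^ n], is the remainder of the
    Taylor expansion of [f w] up to the winding number. *)
Definition tail_kernel (f : C -> C) (w : C) (n : nat) (z : C) : C := (f z * / (z ^ n * (z -
  w)))%C.

Section Square.
Variables (f : C -> C) (r : R) (w : C).
Hypotheses (Hr : 0 < r) (Hw : Cmod w <= r / 2)
  (Hf : forall z, Cmod z <= 2 * r -> differentiable_at f z).

Lemma boundary_ne z : r <= Cmod z -> z <> 0%C /\ (z - w)%C <> 0%C.
Proof.
intros H. split.
- intros ->. rewrite Cmod_0 in H. lra.
- intros E. assert (A := Cmod_triangle_rev z w). rewrite E, Cmod_0 in A. lra.
Qed.

Lemma diff_tail_kernel n z : r <= Cmod z <= 2 * r -> differentiable_at (tail_kernel f w n) z.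
Proof.
intros [H1 H2]. destruct (boundary_ne z H1) as [N1 N2].
apply diff_mult; [now apply Hf|].
apply (diff_inv (fun z => z ^ n * (z - w))%C).
- apply diff_mult; [apply diff_pow|]. apply diff_minus; [apply diff_id | apply diff_const].
- apply Cmult_neq_0; auto. now apply Cpow_nz.
Qed.

Lemma diff_coef_kernel n z : r <= Cmod z <= 2 * r ->
  differentiable_at (fun z => f z * / z ^ S n)%C z.
Proof.
intros [H1 H2]. destruct (boundary_ne z H1) as [N1 N2].
apply diff_mult; [now apply Hf|]. apply (diff_inv (fun z => z ^ S n)%C).
- apply diff_pow.
- now apply Cpow_nz.
Qed.

(** One step of the geometric series of [1 / (z - w)]. *)
Lemma tail_kernel_step n :
  square_int (tail_kernel f w n) r =
  (square_int (fun z => f z * / z ^ S n)%C r + w * square_int (tail_kernel f w (S n)) r)%C.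
Proof.
unfold square_int. rewrite <- rect_int_Cmult.
2:{ intros z Hz. apply diff_ccont, diff_tail_kernel, square_bdry; auto. }
rewrite (rect_int_ext (tail_kernel f w n)
  (fun z => f z * / z ^ S n - - RtoC 1 * (w * tail_kernel f w (S n) z))%C).
- rewrite (rect_int_minus (fun z => f z * / z ^ S n)%C (fun z => - RtoC 1 * (w * tail_kernel f w
    (S n) z))%C).
  + rewrite rect_int_Cmult; [ring|]. intros z Hz.
    apply diff_ccont, diff_mult; [apply diff_const|].
    apply diff_tail_kernel, square_bdry; auto.
  + intros z Hz. apply diff_ccont, diff_coef_kernel, square_bdry; auto.
  + intros z Hz. apply diff_ccont, diff_mult; [apply diff_const|].
    apply diff_mult; [apply diff_const|].
    apply diff_tail_kernel, square_bdry; auto.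
- intros z Hz. apply square_bdry in Hz; auto. destruct (boundary_ne z (proj1 Hz)) as [N1 N2].
  unfold tail_kernel. rewrite Cpow_S. field. repeat split; auto. now apply Cpow_nz.
Qed.

Lemma tail_kernel_expand n :
  square_int (tail_kernel f w 0) r =
  (csum (fun k => square_int (fun z => f z * / z ^ S k)%C r) w n
   + w ^ n * square_int (tail_kernel f w n) r)%C.
Proof.
induction n as [|n IH].
- cbn [csum]. change (w ^ 0)%C with (RtoC 1). ring.
- rewrite IH, (tail_kernel_step n). cbn [csum]. rewrite Cpow_S. ring.
Qed.

Lemma tail_kernel_bound n M :
  (forall z, Cmod z <= 2 * r -> Cmod (f z) <= M) ->
  Cmod (square_int (tail_kernel f w n) r) <= 16 * M / r ^ n.
Proof.
intros HM. assert (Hp : 0 < r ^ n) by now apply pow_lt.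
replace (16 * M / r ^ n) with (8 * r * (M * / (r ^ n * (r / 2)))) by (field; lra).
apply square_int_bound; auto.
- intros z Hz. apply diff_tail_kernel, square_bdry; auto.
- intros z Hz. unfold tail_kernel. destruct (boundary_ne z (proj1 Hz)) as [N1 N2].
  rewrite Cmod_mult, Cmod_inv, Cmod_mult, Cmod_pow by (apply Cmult_neq_0; auto; now apply
    Cpow_nz).
  assert (Hm : r ^ n <= Cmod z ^ n) by (apply pow_incr; lra).
  assert (A := Cmod_triangle_rev z w).
  apply Rmult_le_compat; [apply Cmod_ge_0 | | apply HM; lra |].
  + left. apply Rinv_0_lt_compat. apply Rmult_lt_0_compat; lra.
  + apply Rinv_le_contravar. { apply Rmult_lt_0_compat; lra. }
    apply Rmult_le_compat; lra.
Qed.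

(** Cauchy's formula before the winding number is evaluated: the difference
    quotient of [f] at [w] extends continuously to [w], so its integral vanishes
    although it may fail to be differentiable there. *)
Lemma cauchy_square :
  square_int (tail_kernel f w 0) r = (f w * square_int (tail_kernel (fun _ => RtoC 1) w 0) r)%C.
Proof.
destruct (Hf w) as [l Hl]; [lra|].
set (q := fun z => if Ceq_dec z w then l else ((f z - f w) / (z - w))%C).
assert (Hq : forall z, Cmod z <= 2 * r -> z <> w -> differentiable_at q z).
{ intros z Hz Hne.
  assert (Hd : 0 < Cmod (z - w)) by (apply Cmod_gt_0, Cminus_eq_contra; auto).
  apply (diff_ext_loc (fun z => (f z - f w) / (z - w))%C q z (Cmod (z - w))); auto.
  - intros u Hu. unfold q. destruct (Ceq_dec u w) as [->|]; auto.
    replace (w - z)%C with (- (z - w))%C in Hu by ring. rewrite Cmod_opp in Hu. lra.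
  - apply diff_div.
    + apply diff_minus; [now apply Hf | apply diff_const].
    + apply diff_minus; [apply diff_id | apply diff_const].
    + apply Cminus_eq_contra; auto. }
assert (Hqc : ccont q w).
{ intros eps He. destruct (proj1 (is_cderive_eps _ _ _) Hl (eps / 2)) as [d [Hd H]]; [lra|].
  exists d; split; auto. intros u Hu. unfold q at 2. destruct (Ceq_dec w w) as [_|]; [|tauto].
  unfold q. destruct (Ceq_dec u w) as [->|Hne].
  - replace (l - l)%C with (RtoC 0) by ring. rewrite Cmod_0. lra.
  - assert (Hne' : (u - w)%C <> 0%C) by (apply Cminus_eq_contra; auto).
    replace ((f u - f w) / (u - w) - l)%C with ((f u - f w - l * (u - w)) / (u - w))%C by
      (field; auto).
    rewrite Cmod_div by auto. assert (0 < Cmod (u - w)) by now apply Cmod_gt_0.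
    apply Rle_lt_trans with (eps / 2); [|lra].
    apply (Rle_div_l _ (eps / 2)); auto. }
assert (Q0 : square_int q r = 0%C).
{ unfold square_int. apply goursat_except with (p := w).
  - intros z Hz. destruct (Ceq_dec z w) as [->|]; auto. apply diff_ccont, Hq; auto.
    now apply square_rect.
  - intros z Hz. apply Hq. now apply square_rect. }
assert (D1 : forall z, on_boundary (-r) r (-r) r z -> differentiable_at (tail_kernel (fun _ =>
  RtoC 1) w 0) z).
{ intros z Hz. apply square_bdry in Hz; auto. destruct (boundary_ne z (proj1 Hz)) as [N1 N2].
  apply diff_mult; [apply diff_const|]. apply (diff_inv (fun z => z ^ 0 * (z - w))%C).
  - apply diff_mult; [apply diff_pow|]. apply diff_minus; [apply diff_id | apply diff_const].
  - apply Cmult_neq_0; auto. now apply Cpow_nz. }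
assert (E : square_int q r = (square_int (tail_kernel f w 0) r - f w * square_int (tail_kernel
  (fun _ => RtoC 1) w 0) r)%C).
{ unfold square_int. rewrite <- rect_int_Cmult by (intros z Hz; now apply diff_ccont, D1).
  rewrite <- rect_int_minus.
  - apply rect_int_ext. intros z Hz. apply square_bdry in Hz; auto.
    destruct (boundary_ne z (proj1 Hz)) as [N1 N2]. unfold q, tail_kernel.
    destruct (Ceq_dec z w) as [->|]; [exfalso; apply N2; ring|]. simpl Cpow. field. auto.
  - intros z Hz. apply diff_ccont, diff_tail_kernel, square_bdry; auto.
  - intros z Hz. apply diff_ccont, diff_mult; [apply diff_const|]. now apply D1. }
rewrite Q0 in E. symmetry in E. apply Ceq_minus in E. exact E.
Qed.

End Square.

Lemma square_int_inv_pow r n : 0 < r -> square_int (fun z => RtoC 1 * / z ^ S (S n))%C r = 0%C.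
Proof.
intros Hr. set (k := RtoC (- / INR (S n))).
assert (N : forall z, on_boundary (-r) r (-r) r z -> z <> 0%C).
{ intros z Hz ->. apply square_bdry in Hz; auto. rewrite Cmod_0 in Hz. lra. }
unfold square_int. apply rect_int_primitive with (F := fun z => (k * (Cinv z) ^ S n)%C).
- intros z Hz. specialize (N z Hz).
  eapply is_cderive_eq.
  + apply (is_cderive_mult (fun _ => k) (fun z => (Cinv z) ^ S n)%C z); [apply
      is_cderive_const|].
    apply (is_cderive_comp (fun z => z ^ S n)%C Cinv z).
    * apply is_cderive_pow.
    * now apply is_cderive_inv.
  + unfold k. rewrite RtoC_opp, RtoC_inv by (apply not_0_INR; lia).
    rewrite (Cpow_inv z n) by auto. rewrite !Cpow_S. field. repeat split; auto.
    * now apply Cpow_nz.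
    * intros E. apply (not_0_INR (S n)); [lia|]. now apply RtoC_inj.
- intros z Hz. apply diff_ccont. apply diff_mult; [apply diff_const|].
  apply (diff_inv (fun z => z ^ S (S n))%C); [apply diff_pow|]. apply Cpow_nz; auto.
Qed.

(** The winding number does not depend on [w]: all terms of the geometric series
    but the first have primitives, and the remainder tends to [0]. *)
Lemma square_winding r w : 0 < r -> Cmod w <= r / 2 ->
  square_int (tail_kernel (fun _ => RtoC 1) w 0) r = square_int Cinv r.
Proof.
intros Hr Hw.
assert (H1 : forall z, Cmod z <= 2 * r -> differentiable_at (fun _ => RtoC 1) z) by (intros;
  apply diff_const).
set (A := fun n => square_int (tail_kernel (fun _ => RtoC 1) w n) r).
assert (E : forall n, csum (fun k => square_int (fun z => RtoC 1 * / z ^ S k)%C r) w (S n) =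
  square_int Cinv r).
{ induction n as [|n IH].
  - simpl. assert (Z : square_int (fun z : C => RtoC 1 * / (z * 1))%C r = square_int Cinv r).
    { unfold square_int. apply rect_int_ext. intros z Hz. rewrite Cmult_1_r. ring. }
    rewrite Z. ring.
  - change (csum (fun k => square_int (fun z => RtoC 1 * / z ^ S k)%C r) w (S n) +
      square_int (fun z => RtoC 1 * / z ^ S (S n))%C r * w ^ S n = square_int Cinv r)%C.
    rewrite IH, square_int_inv_pow by auto. ring. }
apply Ceq_minus. set (D := (_ - _)%C).
destruct (Ceq_dec D 0%C) as [|Hne]; auto. exfalso. apply Cmod_gt_0 in Hne.
destruct (half_pow_small 16 (Cmod D) Hne) as [n Hn].
assert (HD : D = (w ^ S n * A (S n))%C).
{ unfold D. rewrite (tail_kernel_expand (fun _ => RtoC 1) r w Hr Hw H1 (S n)), E. unfold A.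
  ring. }
assert (B : Cmod (A (S n)) <= 16 * 1 / r ^ S n).
{ unfold A. apply (tail_kernel_bound (fun _ => RtoC 1) r w Hr Hw H1 (S n) 1). intros.
  rewrite Cmod_1. lra. }
assert (Hp : 0 < r ^ S n) by now apply pow_lt.
assert (H2 : 0 < 2 ^ n) by (apply pow_lt; lra).
assert (C1 : Cmod D <= (r / 2) ^ S n * (16 * 1 / r ^ S n)).
{ rewrite HD, Cmod_mult, Cmod_pow. apply Rmult_le_compat; auto using Cmod_ge_0.
  - apply pow_le, Cmod_ge_0.
  - apply pow_incr. split; auto using Cmod_ge_0. }
replace ((r / 2) ^ S n * (16 * 1 / r ^ S n)) with (16 / 2 ^ n / 2) in C1.
- lra.
- unfold Rdiv at 3. rewrite Rpow_mult_distr, pow_inv. simpl (2 ^ S n). field. lra.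
Qed.

(** Taylor expansion with Cauchy's estimate of the remainder. The radius on
    which it holds depends only on [R0], so that vanishing near the centre
    propagates to a disc of fixed size. *)
Theorem taylor (f : C -> C) (R0 M : R) : holo_bounded f R0 M ->
  exists c : nat -> C, forall n w, Cmod w <= R0 / 8 ->
    Cmod (f w - csum c w n) <= 4 * M * (4 / R0 * Cmod w) ^ n.
Proof.
intros [HR Hf]. set (r := R0 / 4). assert (Hr : 0 < r) by (unfold r; lra).
set (N := square_int Cinv r). assert (HN : 4 <= Cmod N) by now apply square_int_inv.
assert (HN0 : N <> 0%C) by (apply Cmod_gt_0; lra).
exists (fun k => (square_int (fun z => f z * / z ^ S k)%C r / N)%C).
intros n w Hw.
assert (Hw' : Cmod w <= r / 2) by (unfold r; lra).
assert (Hf' : forall z, Cmod z <= 2 * r -> differentiable_at f z).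
{ intros z Hz. apply Hf. unfold r in Hz. lra. }
assert (E1 := cauchy_square f r w Hr Hw' Hf').
rewrite square_winding in E1 by auto. fold N in E1.
rewrite (tail_kernel_expand f r w Hr Hw' Hf' n) in E1.
assert (E2 : csum (fun k => (square_int (fun z => f z * / z ^ S k)%C r / N)%C) w n =
  (csum (fun k => square_int (fun z => f z * / z ^ S k)%C r) w n / N)%C).
{ clear - HN0. induction n as [|n IH]; simpl; [field; auto|]. simpl in IH. rewrite IH. field.
  auto. }
rewrite E2.
set (T := square_int (tail_kernel f w n) r) in *.
replace (f w - _)%C with (w ^ n * T / N)%C.
2:{ apply (f_equal (fun u => u / N)%C) in E1.
    replace (f w) with (f w * N / N)%C by (field; auto). rewrite <- E1. field. auto. }
assert (B : Cmod T <= 16 * M / r ^ n).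
{ apply (tail_kernel_bound f r w Hr Hw' Hf'). intros z Hz. apply Hf. unfold r in Hz. lra. }
rewrite Cmod_div, Cmod_mult, Cmod_pow by auto.
assert (Hp : 0 < r ^ n) by now apply pow_lt.
assert (Hwn : 0 <= Cmod w ^ n) by apply pow_le, Cmod_ge_0.
apply (Rle_div_l _ _ (Cmod N)); [lra|].
apply Rle_trans with (Cmod w ^ n * (16 * M / r ^ n)); [now apply Rmult_le_compat_l|].
replace (4 * M * (4 / R0 * Cmod w) ^ n * Cmod N) with (4 * (Cmod w ^ n * M / r ^ n) * Cmod N).
2:{ rewrite Rpow_mult_distr. replace (4 / R0) with (/ r) by (unfold r; field; lra).
    rewrite pow_inv. field. lra. }
replace (Cmod w ^ n * (16 * M / r ^ n)) with (4 * (Cmod w ^ n * M / r ^ n) * 4) by (field; lra).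
apply Rmult_le_compat_l; auto. apply Rmult_le_pos; [lra|].
assert (0 <= M). { apply Rle_trans with (Cmod (f 0)); [apply Cmod_ge_0|]. apply Hf.
rewrite Cmod_0; auto. }
apply Rmult_le_pos; [now apply Rmult_le_pos|]. left; now apply Rinv_0_lt_compat.
Qed.

(** * Zeros of holomorphic functions *)

Lemma holo_order f R0 M : holo_bounded f R0 M ->
  (forall w, Cmod w <= R0 / 8 -> f w = 0%C) \/
  exists (m : nat) (b : C) (K : R), b <> RtoC 0 /\ 0 <= K /\
    forall w, Cmod w <= R0 / 8 -> Cmod (f w - b * w ^ m) <= K * Cmod w ^ S m.
Proof.
intros Hf. destruct (taylor f R0 M Hf) as [c Hc]. destruct Hf as [HR Hf].
assert (HM : 0 <= M).
{ apply Rle_trans with (Cmod (f 0)); [apply Cmod_ge_0|]. apply Hf. now rewrite Cmod_0. }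
assert (Hz : forall n w, (forall k, (k < n)%nat -> c k = 0%C) -> csum c w n = 0%C).
{ induction n as [|n IH]; intros w H; simpl; auto.
  rewrite IH, H by (auto with arith). ring. }
destruct (classic (exists n, c n <> 0%C)) as [Hex|Hall].
- right. assert (Hmin : exists m, c m <> 0%C /\ forall k, (k < m)%nat -> c k = 0%C).
  { destruct Hex as [n Hn]. induction n as [n IH] using Wf_nat.lt_wf_ind.
    destruct (classic (exists k, (k < n)%nat /\ c k <> 0%C)) as [[k [K1 K2]]|Hno]; [eauto|].
    exists n; split; auto. intros k Hk. destruct (Ceq_dec (c k) 0%C); auto.
    exfalso; eauto. }
  destruct Hmin as [m [Hm1 Hm2]].
  assert (0 < 4 / R0) by (apply Rdiv_lt_0_compat; lra).
  exists m, (c m), (4 * M * (4 / R0) ^ S m). split; auto. split.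
  { apply Rmult_le_pos; [lra|]. apply pow_le. lra. }
  intros w Hw. specialize (Hc (S m) w Hw). simpl csum in Hc. rewrite (Hz m w Hm2) in Hc.
  rewrite Rpow_mult_distr in Hc. replace (f w - c m * w ^ m)%C with (f w - (0 + c m * w ^ m))%C
    by ring.
  lra.
- left. intros w Hw. destruct (Ceq_dec (f w) 0%C) as [|Hne]; auto. exfalso.
  apply Cmod_gt_0 in Hne. destruct (half_pow_small (4 * M) _ Hne) as [n Hn].
  specialize (Hc n w Hw). rewrite Hz in Hc.
  2:{ intros k _. destruct (Ceq_dec (c k) 0%C); auto. exfalso; eauto. }
  replace (f w - 0)%C with (f w) in Hc by ring.
  assert ((4 / R0 * Cmod w) ^ n <= (/ 2) ^ n).
  { apply pow_incr. split.
    - apply Rmult_le_pos; [left; apply Rdiv_lt_0_compat; lra | apply Cmod_ge_0].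
    - apply Rle_trans with (4 / R0 * (R0 / 8)).
      + apply Rmult_le_compat_l; auto. left; apply Rdiv_lt_0_compat; lra.
      + right; field; lra. }
  rewrite pow_inv in H.
  assert (4 * M * (4 / R0 * Cmod w) ^ n <= 4 * M * / 2 ^ n) by (apply Rmult_le_compat_l; lra).
  unfold Rdiv in Hn. lra.
Qed.

(** * Polar coordinates *)

Definition cis (t : R) : C := (cos t, sin t).

Lemma Cmod_cis t : Cmod (cis t) = 1.
Proof.
unfold Cmod, cis; simpl. replace (_ + _) with 1; [apply sqrt_1|].
generalize (sin2_cos2 t). unfold Rsqr. lra.
Qed.

Lemma cis_plus s t : cis (s + t) = (cis s * cis t)%C.
Proof.
unfold cis, Cmult; simpl. rewrite cos_plus, sin_plus. f_equal; ring.
Qed.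

Lemma cis_pow t n : (cis t ^ n)%C = cis (INR n * t).
Proof.
induction n as [|n IH].
- simpl. unfold cis. rewrite Rmult_0_l, cos_0, sin_0. reflexivity.
- rewrite Cpow_S, IH, <- cis_plus, S_INR. f_equal. ring.
Qed.

Lemma polar (z : C) : exists t, z = (RtoC (Cmod z) * cis t)%C.
Proof.
destruct (Ceq_dec z 0%C) as [->|Hz].
{ exists 0. rewrite Cmod_0. ring. }
apply Cmod_gt_0 in Hz. destruct z as [x y].
set (r := Cmod (x, y)) in *.
assert (Hr2 : r ^ 2 = x ^ 2 + y ^ 2) by exact (Cmod2_alt (x, y)).
assert (Hx : -1 <= x / r <= 1).
{ assert (A := fst_le_Cmod (x, y)). simpl in A. fold r in A.
  apply Rabs_le_between in A. split.
  - apply (Rle_div_r (-1) x r); lra.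
  - apply (Rle_div_l x 1 r); lra. }
assert (Hs : sin (acos (x / r)) = Rabs y / r).
{ rewrite sin_acos by lra.
  replace (1 - (x / r)²) with ((Rabs y / r)²).
  - apply sqrt_Rsqr. apply Rdiv_le_0_compat; auto using Rabs_pos.
  - unfold Rsqr. unfold Rdiv. replace (Rabs y * / r * (Rabs y * / r)) with (Rabs y ^ 2 / r ^ 2)
      by (field; lra).
    rewrite pow2_abs. replace (y ^ 2) with (r ^ 2 - x ^ 2) by lra. field. lra. }
assert (Hc : cos (acos (x / r)) = x / r) by now apply cos_acos.
destruct (Rle_dec 0 y) as [Hy|Hy].
- exists (acos (x / r)). unfold cis. rewrite Hc, Hs, Rabs_right by lra.
  apply injective_projections; simpl; field; lra.
- exists (- acos (x / r)). unfold cis. rewrite cos_neg, sin_neg, Hc, Hs, Rabs_left by lra.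
  apply injective_projections; simpl; field; lra.
Qed.

Lemma direction (b : C) (m : nat) : (0 < m)%nat ->
  exists v, Cmod v = 1 /\ (b * v ^ m)%C = RtoC (Cmod b).
Proof.
intros Hm. destruct (polar b) as [t Ht].
assert (INR m <> 0) by (apply not_0_INR; lia).
exists (cis (- t / INR m)). split; [apply Cmod_cis|].
rewrite cis_pow. replace (INR m * (- t / INR m)) with (- t) by (field; auto).
rewrite Ht at 1. rewrite <- Cmult_assoc, <- cis_plus.
replace (t + - t) with 0 by ring. unfold cis. rewrite cos_0, sin_0.
apply injective_projections; simpl; ring.
Qed.

(** Identity theorem, in the form used to pass from the imaginary axis, where
    tangency gives information, to a full neighbourhood. *)
Lemma im_axis_zero f R0 M d : holo_bounded f R0 M -> 0 < d ->
  (forall t, Rabs t < d -> f (0, t) = 0%C) -> forall w, Cmod w <= R0 / 8 -> f w = 0%C.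
Proof.
intros Hf Hd H. destruct (holo_order f R0 M Hf) as [|(m & b & K & Hb & HK & Hbd)]; auto.
exfalso. apply Cmod_gt_0 in Hb. destruct Hf as [HR _].
set (t := Rmin (d / 2) (Rmin (R0 / 8) (Cmod b / (2 * (K + 1))))).
assert (Ht : 0 < t).
{ unfold t. repeat apply Rmin_case; try lra. apply Rdiv_lt_0_compat; lra. }
destruct (le_Rmin t _ _ (Rle_refl _)) as [T1 [T2 T3]%le_Rmin].
assert (Hmod : Cmod (0, t) = t).
{ replace (0, t) with ((0, t) - (0, 0))%C by (apply injective_projections; simpl; ring).
  rewrite Cmod_vertical, Rabs_right; lra. }
specialize (Hbd (0, t)). rewrite Hmod, H in Hbd by (rewrite Rabs_right; lra).
specialize (Hbd T2). replace (0 - b * (0, t) ^ m)%C with (- (b * (0, t) ^ m))%C in Hbd by ring.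
rewrite Cmod_opp, Cmod_mult, Cmod_pow, Hmod in Hbd. simpl in Hbd.
assert (Hp : 0 < t ^ m) by now apply pow_lt.
apply (Rle_div_r t (Cmod b)) in T3; [|lra].
assert (K * t < Cmod b) by nra.
assert (K * (t * t ^ m) < Cmod b * t ^ m) by nra. lra.
Qed.

(** A holomorphic function cannot have a flat real part: its leading term is
    real and positive in some direction. *)
Lemma flat_real_part f R0 M : holo_bounded f R0 M -> f 0%C = 0%C ->
  (forall n, exists K d, 0 < d /\ forall w, Cmod w < d -> Rabs (Re (f w)) <= K * Cmod w ^ n) ->
  forall w, Cmod w <= R0 / 8 -> f w = 0%C.
Proof.
intros Hf H0 Hflat. destruct (holo_order f R0 M Hf) as [|(m & b & K & Hb & HK & Hbd)]; auto.
exfalso. apply Cmod_gt_0 in Hb. destruct Hf as [HR _].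
destruct m as [|m].
{ specialize (Hbd 0%C). rewrite Cmod_0, H0 in Hbd. simpl in Hbd.
  replace (0 - b * 1)%C with (- b)%C in Hbd by ring. rewrite Cmod_opp in Hbd. lra. }
destruct (direction b (S m)) as (v & Hv1 & Hv2); [lia|].
destruct (Hflat (S (S m))) as (K' & d & Hd & HK').
set (L := K + Rabs K' + 1). assert (HL : 0 < L) by (assert (A := Rabs_pos K'); unfold L; lra).
set (t := Rmin (d / 2) (Rmin (R0 / 8) (Cmod b / (2 * L)))).
assert (Ht : 0 < t).
{ unfold t. repeat apply Rmin_case; try lra. apply Rdiv_lt_0_compat; lra. }
destruct (le_Rmin t _ _ (Rle_refl _)) as [T1 [T2 T3]%le_Rmin].
set (w := (RtoC t * v)%C).
assert (Hmod : Cmod w = t).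
{ unfold w. rewrite Cmod_mult, Hv1, Cmod_R, Rabs_right; lra. }
specialize (HK' w). specialize (Hbd w). rewrite Hmod in *.
specialize (HK' ltac:(lra)). specialize (Hbd T2).
assert (E : (b * w ^ S m)%C = RtoC (Cmod b * t ^ S m)).
{ unfold w. rewrite Cpow_mult_l. rewrite RtoC_mult, RtoC_pow, <- Hv2. ring. }
rewrite E in Hbd.
assert (Hre := re_le_Cmod (f w - RtoC (Cmod b * t ^ S m))%C).
replace (Re (f w - RtoC (Cmod b * t ^ S m))%C) with (Re (f w) - Cmod b * t ^ S m) in Hre
  by (unfold Re; simpl; ring).
assert (Hp : 0 < t ^ S m) by now apply pow_lt.
replace (t ^ S (S m)) with (t * t ^ S m) in * by (simpl; ring).
apply (Rle_div_r t (Cmod b)) in T3; [|lra].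
assert (K' <= Rabs K') by apply Rle_abs.
apply Rabs_le_between in HK'. assert (HH := Rle_trans _ _ _ Hre Hbd).
apply Rabs_le_between in HH.
assert (HtT : 0 < t * t ^ S m) by now apply Rmult_lt_0_compat.
assert (K' * (t * t ^ S m) <= Rabs K' * (t * t ^ S m)) by (apply Rmult_le_compat_r; lra).
assert (Cmod b * t ^ S m <= (K + Rabs K') * t * t ^ S m) by lra.
assert ((K + Rabs K') * t < Cmod b) by (unfold L in T3; nra).
nra.
Qed.

(** * Maxima of upper semicontinuous functions on rectangles *)

(** The inherited property is that the supremum over the rectangle is the global
    one; at the limit point upper semicontinuity makes it a maximum. *)
Lemma rect_max (Q : C -> R) (a b c d : R) : a <= b -> c <= d ->
  (forall z, in_rect a b c d z -> forall e, Q z < e ->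
     exists r, 0 < r /\ forall w, Cmod (w - z) < r -> Q w < e) ->
  exists z, in_rect a b c d z /\ forall w, in_rect a b c d w -> Q w <= Q z.
Proof.
intros Hab Hcd Husc.
set (Bad := fun a' b' c' d' => forall w, in_rect a b c d w ->
  exists z, in_rect a' b' c' d' z /\ Q w <= Q z).
destruct (nested_rectangles Bad a b c d) as (x & y & Hxy); auto.
{ intros w Hw. exists w; split; auto; lra. }
{ intros a1 b1 c1 d1 h1 h2 HB.
  destruct (classic (exists a' b' c' d', half a1 b1 a' b' /\ half c1 d1 c' d' /\ Bad a' b' c'
    d'))
    as [|Hno]; auto. exfalso.
  assert (HW : forall a' b' c' d', half a1 b1 a' b' -> half c1 d1 c' d' ->
    exists w, in_rect a b c d w /\ forall z, in_rect a' b' c' d' z -> Q z < Q w).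
  { intros a' b' c' d' G1 G2. apply NNPP. intros N. apply Hno. exists a', b', c', d'.
    repeat split; auto. intros w Hw. apply NNPP. intros N2. apply N. exists w; split; auto.
    intros z Hz. apply Rnot_le_lt. intros N3. apply N2; eauto. }
  set (m := (a1 + b1) / 2). set (n := (c1 + d1) / 2).
  destruct (HW a1 m c1 n) as (w1 & W1 & V1); [left; auto | left; auto|].
  destruct (HW a1 m n d1) as (w2 & W2 & V2); [left; auto | right; auto|].
  destruct (HW m b1 c1 n) as (w3 & W3 & V3); [right; auto | left; auto|].
  destruct (HW m b1 n d1) as (w4 & W4 & V4); [right; auto | right; auto|].
  assert (Hmax : exists w, in_rect a b c d w /\ Q w1 <= Q w /\ Q w2 <= Q w /\ Q w3 <= Q w /\ Q
    w4 <= Q w).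
  { assert (Hm2 : forall u v, in_rect a b c d u -> in_rect a b c d v ->
      exists w, in_rect a b c d w /\ Q u <= Q w /\ Q v <= Q w).
    { intros u v Hu Hv. destruct (Rle_dec (Q u) (Q v)); [exists v | exists u]; repeat split; try
        apply Hu; try apply Hv; lra. }
    destruct (Hm2 w1 w2 W1 W2) as (u & U1 & U2 & U3).
    destruct (Hm2 w3 w4 W3 W4) as (v & X1 & X2 & X3).
    destruct (Hm2 u v U1 X1) as (w & Y1 & Y2 & Y3). exists w. repeat split; try apply Y1; lra. }
  destruct Hmax as (w & Hw & Q1 & Q2 & Q3 & Q4). destruct (HB w Hw) as (z & [Z1 Z2] & Hz).
  rewrite between_le in Z1, Z2 by auto.
  assert (HQ : Q z < Q w); [|lra].
  assert (a1 <= m <= b1 /\ c1 <= n <= d1) by (unfold m, n; lra).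
  destruct (Rle_dec (fst z) m); destruct (Rle_dec (snd z) n).
  - apply Rlt_le_trans with (Q w1); auto. apply V1. split; apply between_le; lra.
  - apply Rlt_le_trans with (Q w2); auto. apply V2. split; apply between_le; lra.
  - apply Rlt_le_trans with (Q w3); auto. apply V3. split; apply between_le; lra.
  - apply Rlt_le_trans with (Q w4); auto. apply V4. split; apply between_le; lra. }
assert (Hin : in_rect a b c d (x, y)).
{ destruct (Hxy 0%nat) as (a' & b' & c' & d' & H1 & H2 & H3 & H4 & _).
  split; apply between_le; simpl; lra. }
exists (x, y). split; auto. intros w Hw. apply Rnot_lt_le. intros Hlt.
destruct (Husc _ Hin _ Hlt) as [r [Hr H]].
destruct (half_pow_small (b - a + (d - c)) r Hr) as [n Hn].
destruct (Hxy n) as (a' & b' & c' & d' & H1 & H2 & H3 & H4 & H5 & H6 & HB).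
destruct (HB w Hw) as (z & [Z1 Z2] & Hz).
rewrite between_le in Z1 by lra. rewrite between_le in Z2 by lra.
assert (Q z < Q w); [|lra]. apply H.
eapply Rle_lt_trans; [apply Cmod_le_abs|]. simpl.
assert (Rabs (fst z + - x) <= b' - a') by (apply Rabs_le; lra).
assert (Rabs (snd z + - y) <= d' - c') by (apply Rabs_le; lra).
eapply Rle_lt_trans; [|exact Hn]. unfold Rdiv in *. lra.
Qed.

(** * Primitives *)

Lemma CInt_const (u : C) a b : CInt (fun _ => u) a b = (RtoC (b - a) * u)%C.
Proof.
unfold CInt. rewrite (@RInt_const C_R_CompleteNormedModule). apply scal_R_Cmult.
Qed.

Lemma between_abs x y t r : Rabs x < r -> Rabs y < r -> between x y t -> Rabs t < r.
Proof.
unfold between, Rmin, Rmax, Rabs.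
destruct (Rle_dec x y), (Rcase_abs x), (Rcase_abs y), (Rcase_abs t); lra.
Qed.

Lemma between_dist x y t : between x y t -> Rabs (t - x) <= Rabs (y - x).
Proof.
unfold between, Rmin, Rmax, Rabs.
destruct (Rle_dec x y), (Rcase_abs (t - x)), (Rcase_abs (y - x)); lra.
Qed.

(** The exceptional point [p] allows integrands that are holomorphic up to a
    removable singularity. *)
Lemma holo_primitive (f : C -> C) (p : C) (r : R) :
  (forall z, Cmod z < r -> ccont f z) ->
  (forall z, Cmod z < r -> z <> p -> differentiable_at f z) ->
  exists F : C -> C, F (RtoC 0) = RtoC 0 /\ forall z, Cmod z < r / 4 -> is_cderive F z (f z).
Proof.
intros Hc Hd.
set (F := fun z : C => (CInt (fun t => f (t, 0)) 0 (fst z) + Ci * CInt (fun t => f (fst z, t)) 0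
  (snd z))%C).
exists F. split.
{ unfold F; simpl. rewrite !CInt_point. ring. }
assert (Hin : forall x y, Rabs x < r / 2 -> Rabs y < r / 2 -> Cmod (x, y) < r).
{ intros x y Hx Hy. eapply Rle_lt_trans; [apply Cmod_le_abs|]. simpl. lra. }
assert (Hrc : forall a b c d, Rabs a < r / 2 -> Rabs b < r / 2 -> Rabs c < r / 2 -> Rabs d < r /
  2 ->
  forall z, in_rect a b c d z -> Cmod z < r).
{ intros a b c d Ha Hb Hc' Hd' [x y] [Hx Hy]. simpl in *. apply Hin.
  - exact (between_abs a b x _ Ha Hb Hx).
  - exact (between_abs c d y _ Hc' Hd' Hy). }
intros [x0 y0] Hz. apply is_cderive_eps. intros eps He.
assert (Hx0 := fst_le_Cmod (x0, y0)). assert (Hy0 := snd_le_Cmod (x0, y0)). simpl in Hx0, Hy0.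
assert (Hr : 0 < r) by (assert (A := Cmod_ge_0 (x0, y0)); lra).
destruct (Hc (x0, y0)) with (eps := eps / 2) as [d [Hd1 H]]; [lra | lra |].
exists (Rmin (d / 2) (r / 4)). split; [apply Rmin_case; lra|].
intros [x y] Hw. destruct (lt_Rmin _ _ _ Hw) as [Hw1 Hw2].
assert (Hdx := fst_le_Cmod ((x, y) - (x0, y0))%C).
assert (Hdy := snd_le_Cmod ((x, y) - (x0, y0))%C).
simpl in Hdx, Hdy. set (dist := Cmod ((x, y) - (x0, y0))%C) in *.
assert (Hx : Rabs x < r / 2).
{ replace x with (x + - x0 + x0) by ring. eapply Rle_lt_trans; [apply Rabs_triang|]. lra. }
assert (Hy : Rabs y < r / 2).
{ replace y with (y + - y0 + y0) by ring. eapply Rle_lt_trans; [apply Rabs_triang|]. lra. }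
assert (H0 : Rabs 0 < r / 2) by (rewrite Rabs_R0; lra).
assert (Hx0' : Rabs x0 < r / 2) by lra. assert (Hy0' : Rabs y0 < r / 2) by lra.
assert (Ch : forall a b y', Rabs a < r / 2 -> Rabs b < r / 2 -> Rabs y' < r / 2 ->
   cont_on (fun t => f (t, y')) a b).
{ intros a b y' G1 G2 G3 t Ht. apply ccont_horizontal, Hc, Hin; auto.
  exact (between_abs a b t _ G1 G2 Ht). }
assert (Cv : forall a b x', Rabs a < r / 2 -> Rabs b < r / 2 -> Rabs x' < r / 2 ->
   cont_on (fun t => f (x', t)) a b).
{ intros a b y' G1 G2 G3 t Ht. apply ccont_vertical, Hc, Hin; auto.
  exact (between_abs a b t _ G1 G2 Ht). }
assert (G : rect_int f x0 x 0 y0 = 0%C).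
{ apply goursat_except with (p := p).
  - intros z Hz'. apply Hc. revert Hz'. apply Hrc; auto.
  - intros z Hz'. apply Hd. revert Hz'. apply Hrc; auto. }
unfold rect_int in G.
replace (F (x, y) - F (x0, y0) - f (x0, y0) * ((x, y) - (x0, y0)))%C with
  ((CInt (fun t => f (t, y0)) x0 x - RtoC (x - x0) * f (x0, y0)) +
   Ci * (CInt (fun t => f (x, t)) y0 y - RtoC (y - y0) * f (x0, y0)))%C.
2:{ unfold F. simpl fst; simpl snd.
  rewrite <- (CInt_Chasles (fun t => f (t, 0)) 0 x0 x) by auto.
  rewrite <- (CInt_Chasles (fun t => f (x, t)) 0 y0 y) by auto.
  replace (CInt (fun t => f (t, y0)) x0 x) with
    (CInt (fun t => f (t, 0)) x0 x +
       Ci * (CInt (fun y => f (x, y)) 0 y0 - CInt (fun y => f (x0, y)) 0 y0))%C.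
  2:{ apply Ceq_minus. rewrite <- G. ring. }
  replace ((x, y) - (x0, y0))%C with (RtoC (x - x0) + Ci * RtoC (y - y0))%C
    by (apply injective_projections; simpl; ring). ring. }
rewrite <- (CInt_const (f (x0, y0)) x0 x), <- (CInt_const (f (x0, y0)) y0 y).
rewrite <- !CInt_minus by (auto; intros t _; apply rcont_const).
eapply Rle_trans; [apply Cmod_triangle|]. rewrite Cmod_mult, Cmod_Ci, Rmult_1_l.
assert (B1 : Cmod (CInt (fun t => f (t, y0) - f (x0, y0))%C x0 x) <= Rabs (x - x0) * (eps / 2)).
{ apply CInt_bound.
  - intros t Ht. apply rcont_minus; [now apply (Ch x0 x y0) | apply rcont_const].
  - intros t Ht. left. apply H. rewrite Cmod_horizontal. apply between_dist in Ht.
    unfold Rminus in *; lra. }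
assert (B2 : Cmod (CInt (fun t => f (x, t) - f (x0, y0))%C y0 y) <= Rabs (y - y0) * (eps / 2)).
{ apply CInt_bound.
  - intros t Ht. apply rcont_minus; [now apply (Cv y0 y x) | apply rcont_const].
  - intros t Ht. left. apply H. eapply Rle_lt_trans; [apply Cmod_le_abs|]. simpl.
    apply between_dist in Ht. unfold Rminus in *; lra. }
assert (Rabs (x - x0) * (eps / 2) <= dist * (eps / 2)) by (apply Rmult_le_compat_r; unfold
  Rminus; lra).
assert (Rabs (y - y0) * (eps / 2) <= dist * (eps / 2)) by (apply Rmult_le_compat_r; unfold
  Rminus; lra).
lra.
Qed.

(** * The exponential *)

Definition cexp (z : C) : C := (RtoC (exp (fst z)) * cis (snd z))%C.

Lemma cexp_plus z w : cexp (z + w) = (cexp z * cexp w)%C.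
Proof.
unfold cexp. simpl. rewrite exp_plus, cis_plus, RtoC_mult. ring.
Qed.

Lemma cexp_0 : cexp 0 = 1%C.
Proof.
unfold cexp, cis; simpl. rewrite exp_0, cos_0, sin_0. apply injective_projections; simpl; ring.
Qed.

Lemma cexp_ne z : cexp z <> 0%C.
Proof.
apply Cmod_gt_0. unfold cexp. rewrite Cmod_mult, Cmod_cis, Cmod_R, Rmult_1_r.
apply Rabs_pos_lt. assert (H := exp_pos (fst z)). lra.
Qed.

Lemma real_derive_eps (f : R -> R) l : is_derive f 0 l -> forall eps, 0 < eps ->
  exists d, 0 < d /\ forall t, Rabs t < d -> Rabs (f t - f 0 - l * t) <= eps * Rabs t.
Proof.
intros [_ H] eps He.
destruct (H 0 (fun P HP => HP) (mkposreal eps He)) as [d Hd].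
exists d; split; [apply cond_pos|]. intros t Ht.
assert (Ht' : ball (0:R) d t).
{ unfold ball; simpl. unfold AbsRing_ball, abs, minus, plus, opp; simpl.
  replace (t + - 0) with t by ring. exact Ht. }
specialize (Hd t Ht'). unfold norm, minus, plus, opp, scal, abs, mult in Hd; simpl in Hd.
unfold abs, mult in Hd; simpl in Hd.
replace (f t - f 0 - l * t) with (f t + - f 0 + - ((t + - 0) * l)) by ring.
replace (Rabs t) with (Rabs (t + - 0)) by (f_equal; ring). exact Hd.
Qed.

Lemma is_cderive_cexp z : is_cderive cexp z (cexp z).
Proof.
assert (H0 : forall eps, 0 < eps -> exists d, 0 < d /\ forall h, Cmod h < d ->
  Cmod (cexp h - 1 - h) <= eps * Cmod h).
{ intros eps He.
  destruct (real_derive_eps exp 1) with (eps := Rmin (eps / 4) 1) as [d1 [D1 E1]].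
  { replace 1 with (exp 0) by apply exp_0. apply is_derive_Reals, derivable_pt_lim_exp. }
  { apply Rmin_case; lra. }
  destruct (real_derive_eps cos 0) with (eps := eps / 16) as [d2 [D2 E2]].
  { replace 0 with (- sin 0) at 2 by (rewrite sin_0; ring).
    apply is_derive_Reals, derivable_pt_lim_cos. }
  { lra. }
  destruct (real_derive_eps sin 1) with (eps := eps / 16) as [d3 [D3 E3]].
  { replace 1 with (cos 0) by apply cos_0. apply is_derive_Reals, derivable_pt_lim_sin. }
  { lra. }
  rewrite exp_0 in E1. rewrite cos_0 in E2. rewrite sin_0 in E3.
  exists (Rmin (Rmin d1 d2) (Rmin d3 (Rmin (1/2) (eps / 8)))). split.
  { repeat apply Rmin_case; lra. }
  intros [x y] Hh.
  assert (Hx := fst_le_Cmod (x, y)). assert (Hy := snd_le_Cmod (x, y)). simpl in Hx, Hy.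
  set (m := Cmod (x, y)) in *.
  destruct (lt_Rmin _ _ _ Hh) as [[M1 M2]%lt_Rmin [M3 [M4 M5]%lt_Rmin]%lt_Rmin].
  specialize (E1 x ltac:(lra)). specialize (E2 y ltac:(lra)). specialize (E3 y ltac:(lra)).
  set (ex := exp x - 1 - 1 * x) in *. set (cy := cos y - 1 - 0 * y) in *.
  set (sy := sin y - 0 - 1 * y) in *.
  assert (A1 := Rabs_pos x). assert (A2 := Rabs_pos y).
  assert (F1 : Rabs ex <= eps / 4 * m).
  { eapply Rle_trans; [exact E1|]. apply Rmult_le_compat; auto; [apply Rmin_case; lra | apply
      Rmin_l]. }
  assert (F1' : Rabs ex <= m).
  { eapply Rle_trans; [exact E1|]. apply Rle_trans with (1 * m); [|lra].
    apply Rmult_le_compat; auto; [apply Rmin_case; lra | apply Rmin_r]. }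
  assert (F2 : Rabs cy <= eps / 16 * m).
  { eapply Rle_trans; [exact E2|]. apply Rmult_le_compat_l; lra. }
  assert (F3 : Rabs sy <= eps / 16 * m).
  { eapply Rle_trans; [exact E3|]. apply Rmult_le_compat_l; lra. }
  replace (cexp (x, y) - 1 - (x, y))%C with
    (RtoC (exp x) * (cy, sy) + RtoC ex + RtoC (x + ex) * (0, y))%C
    by (unfold cexp, cis, ex, cy, sy; apply injective_projections; simpl; ring).
  eapply Rle_trans; [apply Cmod_triangle|].
  eapply Rle_trans; [apply Rplus_le_compat_r, Cmod_triangle|].
  rewrite !Cmod_mult, !Cmod_R.
  assert (G1 : Rabs (exp x) <= 2).
  { replace (exp x) with (ex + 1 + x) by (unfold ex; ring).
    eapply Rle_trans; [apply Rabs_triang|].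
    eapply Rle_trans; [apply Rplus_le_compat_r, Rabs_triang|]. rewrite Rabs_R1. lra. }
  assert (G2 : Cmod (cy, sy) <= eps / 8 * m).
  { eapply Rle_trans; [apply Cmod_le_abs|]. simpl. lra. }
  assert (G3 : Rabs (x + ex) <= eps / 4).
  { eapply Rle_trans; [apply Rabs_triang|]. lra. }
  assert (G4 : Cmod (0, y) <= m).
  { eapply Rle_trans; [apply Cmod_le_abs|]. simpl. rewrite Rabs_R0. lra. }
  assert (P1 : Rabs (exp x) * Cmod (cy, sy) <= 2 * (eps / 8 * m))
    by (apply Rmult_le_compat; auto using Rabs_pos, Cmod_ge_0).
  assert (P2 : Rabs (x + ex) * Cmod (0, y) <= eps / 4 * m)
    by (apply Rmult_le_compat; auto using Rabs_pos, Cmod_ge_0).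
  assert (0 <= eps * m) by (apply Rmult_le_pos; [lra | apply Cmod_ge_0]).
  lra. }
apply is_cderive_eps. intros eps He.
assert (Hz : 0 < Cmod (cexp z)) by apply Cmod_gt_0, cexp_ne.
destruct (H0 (eps / Cmod (cexp z))) as [d [Hd H1]]; [now apply Rdiv_lt_0_compat|].
exists d; split; auto. intros w Hw. specialize (H1 _ Hw).
replace (cexp w - cexp z - cexp z * (w - z))%C with (cexp z * (cexp (w - z) - 1 - (w - z)))%C.
2:{ replace w with (z + (w - z))%C at 3 by ring. rewrite cexp_plus. ring. }
rewrite Cmod_mult.
apply Rle_trans with (Cmod (cexp z) * (eps / Cmod (cexp z) * Cmod (w - z))).
- apply Rmult_le_compat_l; lra.
- right; field; lra.
Qed.

(** * Holomorphic functions along curves *)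

Lemma is_rderive_elim (f : R -> C) x l : is_rderive f x l ->
  forall eps, 0 < eps -> exists d, 0 < d /\ forall t, Rabs (t - x) < d ->
    Cmod (f t - f x - RtoC (t - x) * l) <= eps * Rabs (t - x).
Proof.
intros [_ H] eps He. destruct (H x (fun P HP => HP) (mkposreal eps He)) as [d Hd].
exists d; split; [apply cond_pos|]. intros t Ht. specialize (Hd t Ht).
rewrite norm_C_R, scal_R_Cmult in Hd. exact Hd.
Qed.

Lemma is_derive_Re (f : R -> C) x l : is_rderive f x l ->
  is_derive (fun t => Re (f t)) x (Re l).
Proof.
intros H. split; [apply is_linear_scal_l|].
intros y Hy eps.
assert (y = x) as ->.
{ symmetry; exact (is_filter_lim_locally_unique (V := R_NormedModule) x y Hy). }
destruct (is_rderive_elim f x l H eps (cond_pos eps)) as [d [Hd H1]].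
exists (mkposreal d Hd). intros t Ht. specialize (H1 t Ht).
change (Rabs (Re (f t) - Re (f x) - (t - x) * Re l) <= eps * Rabs (t - x)).
eapply Rle_trans; [|exact H1]. eapply Rle_trans; [|apply re_le_Cmod].
right. f_equal. unfold Re; simpl. ring.
Qed.

Lemma is_rderive_comp (f : C -> C) (g : R -> C) t l v :
  is_cderive f (g t) l -> is_rderive g t v -> is_rderive (fun s => f (g s)) t (l * v)%C.
Proof.
intros Hf Hg. apply is_rderive_eps. intros eps He.
assert (Hv := Cmod_ge_0 v). assert (Hl := Cmod_ge_0 l).
set (e1 := eps / (2 * (Cmod v + 1))). set (e2 := eps / (2 * (Cmod l + 1))).
assert (He1 : 0 < e1) by (apply Rdiv_lt_0_compat; lra).
assert (He2 : 0 < e2) by (apply Rdiv_lt_0_compat; lra).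
destruct (proj1 (is_cderive_eps _ _ _) Hf e1 He1) as [d1 [D1 H1]].
destruct (is_rderive_elim _ _ _ Hg 1) as [d2 [D2 H2]]; [lra|].
destruct (is_rderive_elim _ _ _ Hg e2 He2) as [d3 [D3 H3]].
assert (D1' : 0 < d1 / (Cmod v + 1)) by (apply Rdiv_lt_0_compat; lra).
exists (Rmin (d1 / (Cmod v + 1)) (Rmin d2 d3)). split; [repeat apply Rmin_case; lra|].
intros s Hs.
destruct (lt_Rmin _ _ _ Hs) as [S1 [S2 S3]%lt_Rmin].
specialize (H2 s S2). specialize (H3 s S3). assert (Hst := Rabs_pos (s - t)).
assert (Hg1 : Cmod (g s - g t) <= (Cmod v + 1) * Rabs (s - t)).
{ replace (g s - g t)%C with ((g s - g t - RtoC (s - t) * v) + RtoC (s - t) * v)%C by ring.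
  eapply Rle_trans; [apply Cmod_triangle|]. rewrite Cmod_mult, Cmod_R. lra. }
apply (Rlt_div_r (Rabs (s - t)) d1) in S1; [|lra].
specialize (H1 (g s) ltac:(lra)).
replace (f (g s) - f (g t) - RtoC (s - t) * (l * v))%C with
  ((f (g s) - f (g t) - l * (g s - g t)) + l * (g s - g t - RtoC (s - t) * v))%C by ring.
eapply Rle_trans; [apply Cmod_triangle|]. rewrite Cmod_mult.
assert (P1 : e1 * Cmod (g s - g t) <= eps / 2 * Rabs (s - t)).
{ apply Rle_trans with (e1 * ((Cmod v + 1) * Rabs (s - t))); [apply Rmult_le_compat_l; lra|].
  right. unfold e1. field. lra. }
assert (P2 : Cmod l * Cmod (g s - g t - RtoC (s - t) * v) <= eps / 2 * Rabs (s - t)).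
{ apply Rle_trans with ((Cmod l + 1) * (e2 * Rabs (s - t))).
  - apply Rmult_le_compat; auto using Cmod_ge_0. lra.
  - right. unfold e2. field. lra. }
lra.
Qed.

Lemma is_derive_Im (f : R -> C) x l : is_rderive f x l ->
  is_derive (fun t => Im (f t)) x (Im l).
Proof.
intros H. assert (D := is_derive_Re _ _ _ (is_rderive_comp (fun w => - Ci * w)%C f x _ l
  (is_cderive_mult (fun _ => - Ci)%C (fun w => w) (f x) _ _ (is_cderive_const _ _)
    (is_cderive_id _)) H)).
replace (Im l) with (Re ((0 * f x + - Ci * 1) * l)%C) by (unfold Re, Im; simpl; ring).
revert D. apply is_derive_ext. intros t. unfold Re, Im; simpl. ring.
Qed.

Lemma is_rderive_line (z v : C) t : is_rderive (fun t => z + RtoC t * v)%C t v.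
Proof.
apply is_rderive_eps. intros eps He. exists 1. split; [lra|]. intros s _.
replace (z + s * v - (z + t * v) - RtoC (s - t) * v)%C with (RtoC 0) by (rewrite RtoC_minus;
  ring).
rewrite Cmod_0. apply Rmult_le_pos; [lra | apply Rabs_pos].
Qed.

Lemma Cmod_segment z w t r : 0 <= t <= 1 -> Cmod z < r -> Cmod w < r ->
  Cmod (z + RtoC t * (w - z)) < r.
Proof.
intros Ht Hz Hw.
replace (z + RtoC t * (w - z))%C with (RtoC (1 - t) * z + RtoC t * w)%C by (rewrite RtoC_minus;
  ring).
eapply Rle_lt_trans; [apply Cmod_triangle|]. rewrite !Cmod_mult, !Cmod_R, !Rabs_right by lra.
destruct (Req_dec t 0) as [->|Ht0]; [lra|]. nra.
Qed.

(** The real mean value theorem is applied to the component of [f] in the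
    direction of the increment [f w - f z]. *)
Lemma complex_mean_value (f d : C -> C) r M z w :
  Cmod z < r -> Cmod w < r ->
  (forall u, Cmod u < r -> is_cderive f u (d u) /\ Cmod (d u) <= M) ->
  Cmod (f w - f z) <= M * Cmod (w - z).
Proof.
intros Hz Hw H. set (D := (f w - f z)%C).
destruct (Ceq_dec D 0%C) as [E|E].
{ rewrite E, Cmod_0. apply Rmult_le_pos; [|apply Cmod_ge_0].
  eapply Rle_trans; [apply Cmod_ge_0|]. apply (H z Hz). }
apply Cmod_gt_0 in E.
set (gam := fun t => (z + RtoC t * (w - z))%C).
assert (Hd : forall t, 0 <= t <= 1 -> is_derive (fun t => Re (Cconj D * f (gam t)))%C t
   (Re (Cconj D * d (gam t) * (w - z)))).
{ intros t Ht. apply is_derive_Re.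
  apply (is_rderive_comp (fun u => Cconj D * f u)%C gam t _ (w - z)%C).
  - apply (is_cderive_eq _ _ (0 * f (gam t) + Cconj D * d (gam t))%C); [|ring].
    apply (is_cderive_mult (fun _ => Cconj D) f); [apply is_cderive_const|].
    apply H. now apply Cmod_segment.
  - apply is_rderive_line. }
destruct (MVT_gen (fun t => Re (Cconj D * f (gam t)))%C 0 1
  (fun t => Re (Cconj D * d (gam t) * (w - z)))) as (c & Hc & Heq).
- intros t. rewrite Rmin_left, Rmax_right by lra. intros Ht. apply Hd; lra.
- intros t. rewrite Rmin_left, Rmax_right by lra. intros Ht.
  apply continuity_pt_filterlim. apply (ex_derive_continuous (V := R_NormedModule)).
  eexists; apply Hd; lra.
- rewrite Rmin_left, Rmax_right in Hc by lra.
  assert (E1 : Re (Cconj D * f (gam 1)) - Re (Cconj D * f (gam 0)) = Cmod D ^ 2).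
  { rewrite Cmod2_alt. unfold gam.
    replace (z + RtoC 1 * (w - z))%C with w by ring.
    replace (z + RtoC 0 * (w - z))%C with z by ring.
    unfold D, Re, Im, Cconj; simpl. ring. }
  rewrite E1 in Heq.
  assert (B := re_le_Cmod (Cconj D * d (gam c) * (w - z))).
  rewrite !Cmod_mult, Cmod_conj in B. apply Rabs_le_between in B.
  assert (Cmod (d (gam c)) <= M) by (apply H; now apply Cmod_segment).
  assert (Cmod D * Cmod (d (gam c)) * Cmod (w - z) <= Cmod D * (M * Cmod (w - z))).
  { rewrite Rmult_assoc. apply Rmult_le_compat_l; [lra|].
    apply Rmult_le_compat_r; auto using Cmod_ge_0. }
  apply Rmult_le_reg_l with (Cmod D); auto. lra.
Qed.

(** * Local inverses *)

Section Inverse.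
Variables (phi d : C -> C) (a : C) (R0 : R).
Hypotheses (HR : 0 < R0) (Ha : 0 < Cmod a) (H0 : phi (RtoC 0) = RtoC 0)
  (Hd : forall z, Cmod z < R0 -> is_cderive phi z (d z) /\ Cmod (d z - a) <= Cmod a / 4).

Lemma near_linear z w : Cmod z < R0 -> Cmod w < R0 ->
  3 / 4 * Cmod a * Cmod (w - z) <= Cmod (phi w - phi z).
Proof.
intros Hz Hw.
assert (B : Cmod ((phi w - a * w) - (phi z - a * z)) <= Cmod a / 4 * Cmod (w - z)).
{ apply (complex_mean_value (fun u => phi u - a * u)%C (fun u => d u - a)%C R0 _ z w); auto.
  intros u Hu. split; [|now apply Hd].
  eapply is_cderive_eq.
  - apply (is_cderive_minus phi (fun u => a * u)%C); [now apply Hd|].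
    apply (is_cderive_mult (fun _ => a) (fun u => u)); [apply is_cderive_const | apply
      is_cderive_id].
  - ring. }
assert (T := Cmod_triangle_rev (a * (w - z)) (- ((phi w - a * w) - (phi z - a * z)))%C).
rewrite Cmod_opp, Cmod_mult in T.
replace (a * (w - z) - - ((phi w - a * w) - (phi z - a * z)))%C with (phi w - phi z)%C in T by
  ring.
lra.
Qed.

Lemma deriv_ne z : Cmod z < R0 -> 3 / 4 * Cmod a <= Cmod (d z).
Proof.
intros Hz. destruct (Hd z Hz) as [_ B]. assert (T := Cmod_triangle_rev a (- (d z - a))%C).
rewrite Cmod_opp in T. replace (a - - (d z - a))%C with (d z) in T by ring. lra.
Qed.

(** A minimum of [|phi - w|] over a square is interior because [phi] expands
    distances, and it is zero because [phi] is open at points with [phi' <> 0]. *)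
Lemma phi_onto w : Cmod w < Cmod a * R0 / 16 -> exists z, Cmod z < R0 /\ phi z = w.
Proof.
intros Hw. set (s := R0 / 4). assert (Hs : 0 < s) by (unfold s; lra).
destruct (rect_max (fun z => - Cmod (phi z - w)) (-s) s (-s) s) as (z & Hz & Hmax); try lra.
{ intros z Hz e He. apply square_rect in Hz; auto.
  destruct (is_cderive_ccont _ _ _ (proj1 (Hd z ltac:(unfold s in Hz; lra))) (e + Cmod (phi z -
    w))) as [r [Hr H]]; [lra|].
  exists r; split; auto. intros u Hu. specialize (H u Hu).
  assert (T := Cmod_triangle (phi u - w) (- (phi u - phi z))). rewrite Cmod_opp in T.
  replace (phi u - w + - (phi u - phi z))%C with (phi z - w)%C in T by ring. lra. }
assert (Hz2 : Cmod z <= 2 * s) by now apply square_rect.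
exists z. split; [unfold s in Hz2; lra|].
assert (HzR : Cmod z < R0) by (unfold s in Hz2; lra).
apply Ceq_minus. destruct (Ceq_dec (phi z - w) 0%C) as [|E]; auto. exfalso.
set (u := (phi z - w)%C) in *. assert (Hu : 0 < Cmod u) by now apply Cmod_gt_0.
assert (Hz0 : Cmod u <= Cmod w).
{ assert (Q := Hmax (RtoC 0)). simpl in Q. rewrite H0 in Q.
  replace (0 - w)%C with (- w)%C in Q by ring. rewrite Cmod_opp in Q.
  assert (in_rect (-s) s (-s) s (RtoC 0)) by (split; apply between_le; simpl; lra).
  specialize (Q H). lra. }
assert (Hzs : Cmod z < s).
{ assert (L := near_linear 0 z). rewrite Cmod_0, H0 in L. specialize (L ltac:(lra) HzR).
  replace (z - 0)%C with z in L by ring. replace (phi z - 0)%C with (u + w)%C in L by (unfold u;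
    ring).
  assert (T := Cmod_triangle u w). unfold s. nra. }
assert (Hdz := deriv_ne z HzR).
assert (Hdz0 : d z <> 0%C) by (apply Cmod_gt_0; lra).
(* The Newton step: to first order, moving by [t * h] divides [u] by [1 / (1 - t)]. *)
set (h := (- (u / d z))%C).
assert (Hh : Cmod h = Cmod u / Cmod (d z)) by (unfold h; rewrite Cmod_opp, Cmod_div; auto).
assert (Hh0 : 0 < Cmod h) by (rewrite Hh; apply Rdiv_lt_0_compat; lra).
destruct (proj1 (is_cderive_eps _ _ _) (proj1 (Hd z HzR)) (Cmod (d z) / 2)) as [r [Hr H]];
  [lra|].
set (t := Rmin (1 / 2) (Rmin (r / (2 * Cmod h)) ((s - Cmod z) / (2 * Cmod h)))).
assert (Ht : 0 < t).
{ unfold t. repeat apply Rmin_case; try lra; apply Rdiv_lt_0_compat; lra. }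
assert (Ht1 : t <= 1 / 2) by apply Rmin_l.
assert (Ht2 : t * (2 * Cmod h) <= r).
{ apply (Rle_div_r t r); [lra|]. eapply Rle_trans; [apply Rmin_r | apply Rmin_l]. }
assert (Ht3 : t * (2 * Cmod h) <= s - Cmod z).
{ apply (Rle_div_r t (s - Cmod z)); [lra|]. eapply Rle_trans; [apply Rmin_r | apply Rmin_r]. }
assert (Hth : Cmod (RtoC t * h) = t * Cmod h) by (rewrite Cmod_mult, Cmod_R, Rabs_right; lra).
set (z' := (z + RtoC t * h)%C).
assert (Hz' : Cmod (z' - z) = t * Cmod h).
{ unfold z'. replace (z + t * h - z)%C with (RtoC t * h)%C by ring. exact Hth. }
assert (Hin : in_rect (-s) s (-s) s z').
{ assert (Hm : Cmod z' < s).
  { unfold z'. eapply Rle_lt_trans; [apply Cmod_triangle|]. nra. }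
  assert (A1 := fst_le_Cmod z'). assert (A2 := snd_le_Cmod z').
  apply Rabs_le_between in A1. apply Rabs_le_between in A2. split; apply between_le; lra. }
specialize (Hmax z' Hin). specialize (H z'). rewrite Hz' in H. specialize (H ltac:(nra)).
assert (K : (d z * (z' - z))%C = (- (RtoC t * u))%C).
{ unfold z', h. field. auto. }
rewrite K in H.
replace (phi z' - w)%C with ((phi z' - phi z - - (RtoC t * u)) + RtoC (1 - t) * u)%C in Hmax
  by (unfold u; rewrite RtoC_minus; ring).
assert (T := Cmod_triangle (phi z' - phi z - - (RtoC t * u)) (RtoC (1 - t) * u)).
rewrite Cmod_mult, Cmod_R, (Rabs_right (1 - t)) in T by lra.
assert (Cmod (d z) / 2 * (t * Cmod h) = t * Cmod u / 2) by (rewrite Hh; field; lra).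
assert (0 < t * Cmod u) by now apply Rmult_lt_0_compat.
lra.
Qed.

Lemma local_inverse : exists (psi : C -> C) (rho : R), 0 < rho /\ psi (RtoC 0) = RtoC 0 /\
  (forall w, Cmod w < rho -> Cmod (psi w) < R0 /\ phi (psi w) = w /\
     3 / 4 * Cmod a * Cmod (psi w) <= Cmod w /\ is_cderive psi w (/ d (psi w))%C) /\
  (forall z, Cmod z < R0 -> Cmod (phi z) < rho -> psi (phi z) = z).
Proof.
set (rho := Cmod a * R0 / 16).
assert (Hrho : 0 < rho) by (unfold rho; apply Rdiv_lt_0_compat; [apply Rmult_lt_0_compat|];
  lra).
set (psi := fun w => match excluded_middle_informative (Cmod w < rho) with
  | left h => proj1_sig (constructive_indefinite_description _ (phi_onto w h))
  | right _ => RtoC 0 end).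
assert (Hpsi : forall w, Cmod w < rho -> Cmod (psi w) < R0 /\ phi (psi w) = w).
{ intros w Hw. unfold psi. destruct (excluded_middle_informative _) as [h|]; [|tauto].
  exact (proj2_sig (constructive_indefinite_description _ (phi_onto w h))). }
assert (Hinj : forall z w, Cmod z < R0 -> Cmod w < R0 -> phi z = phi w -> z = w).
{ intros z w Hz Hw E. assert (L := near_linear z w Hz Hw). rewrite E in L.
  replace (phi w - phi w)%C with (RtoC 0) in L by ring. rewrite Cmod_0 in L.
  assert (Cmod (w - z) = 0) by (assert (G := Cmod_ge_0 (w - z)); nra).
  apply Cmod_eq_0, Ceq_minus in H. auto. }
exists psi, rho. split; auto.
assert (Hinv : forall z, Cmod z < R0 -> Cmod (phi z) < rho -> psi (phi z) = z).
{ intros z Hz Hz'. destruct (Hpsi _ Hz'). now apply Hinj. }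
assert (P0 : psi (RtoC 0) = RtoC 0).
{ rewrite <- H0 at 1. apply Hinv; rewrite ?H0, Cmod_0; auto. }
split; auto. split; auto.
assert (Hlip : forall w w', Cmod w < rho -> Cmod w' < rho ->
  3 / 4 * Cmod a * Cmod (psi w - psi w') <= Cmod (w - w')).
{ intros w w' Hw Hw'. destruct (Hpsi w Hw) as [A1 A2]. destruct (Hpsi w' Hw') as [A3 A4].
  rewrite <- A2 at 2. rewrite <- A4 at 2. now apply near_linear. }
intros w Hw. destruct (Hpsi w Hw) as [A1 A2]. split; [exact A1 | split; [exact A2 | split]].
{ assert (L := Hlip w (RtoC 0) Hw). rewrite P0, Cmod_0 in L. specialize (L Hrho).
  replace (psi w - 0)%C with (psi w) in L by ring. replace (w - 0)%C with w in L by ring.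
  exact L. }
assert (Hdz := deriv_ne _ A1). assert (Hdz0 : d (psi w) <> 0%C) by (apply Cmod_gt_0; lra).
apply is_cderive_eps. intros eps He.
set (k := 3 / 4 * Cmod a). assert (Hk : 0 < k) by (unfold k; lra).
destruct (proj1 (is_cderive_eps _ _ _) (proj1 (Hd _ A1)) (eps * (k * k))) as [r [Hr H]].
{ apply Rmult_lt_0_compat; [|apply Rmult_lt_0_compat]; assumption. }
exists (Rmin (rho - Cmod w) (r * k)). split.
{ apply Rmin_case; [lra | now apply Rmult_lt_0_compat]. }
intros w' Hw'. destruct (lt_Rmin _ _ _ Hw') as [W1 W2].
assert (Hw'r : Cmod w' < rho).
{ replace w' with ((w' - w) + w)%C by ring. eapply Rle_lt_trans; [apply Cmod_triangle|]. lra. }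
destruct (Hpsi w' Hw'r) as [A3 A4]. assert (L := Hlip w' w Hw'r Hw). fold k in L, Hdz.
assert (G := Cmod_ge_0 (psi w' - psi w)).
specialize (H (psi w') ltac:(nra)). rewrite A2, A4 in H.
replace (psi w' - psi w - / d (psi w) * (w' - w))%C with
  (- ((w' - w - d (psi w) * (psi w' - psi w)) / d (psi w)))%C by (field; auto).
rewrite Cmod_opp, Cmod_div by auto.
apply (Rle_div_l _ _ (Cmod (d (psi w)))); [lra|].
apply Rle_trans with (eps * k * Cmod (w' - w)).
{ eapply Rle_trans; [exact H|]. replace (eps * (k * k) * Cmod (psi w' - psi w)) with (eps * k *
    (k * Cmod (psi w' - psi w))) by ring.
  apply Rmult_le_compat_l; auto. left; now apply Rmult_lt_0_compat. }
replace (eps * Cmod (w' - w) * Cmod (d (psi w))) with (eps * Cmod (d (psi w)) * Cmod (w' - w))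
  by ring.
apply Rmult_le_compat_r; [apply Cmod_ge_0|]. apply Rmult_le_compat_l; lra.
Qed.

End Inverse.

(** * Linearization at a simple zero *)

Lemma small_linear (u : C) K r : 0 < r ->
  (forall t, 0 < t <= r -> Cmod u <= K * t) -> u = 0%C.
Proof.
intros Hr H. destruct (Ceq_dec u 0%C) as [|E]; auto. exfalso. apply Cmod_gt_0 in E.
assert (HK : 0 < K). { specialize (H r ltac:(lra)). nra. }
set (t := Rmin r (Cmod u / (2 * K))).
assert (Ht : 0 < t) by (apply Rmin_case; [lra | apply Rdiv_lt_0_compat; lra]).
assert (T1 : t <= r) by apply Rmin_l.
assert (T2 : t * (2 * K) <= Cmod u) by (apply (Rle_div_r t (Cmod u)); [lra | apply Rmin_r]).
specialize (H t ltac:(lra)). lra.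
Qed.

Lemma Cmod_RtoC_pos t : 0 <= t -> Cmod (RtoC t) = t.
Proof. intros H. rewrite Cmod_R, Rabs_right; lra. Qed.

(** The coefficient [c2] is the value at [0] needed to make [b / g - 1 / z]
    continuous. *)
Lemma simple_zero_expansion g R0 M (b : C) K : holo_bounded g R0 M ->
  (forall w, Cmod w <= R0 / 8 -> Cmod (g w - b * w) <= K * Cmod w ^ 2) ->
  exists (c2 : C) (K3 : R), forall w, Cmod w <= R0 / 8 ->
    Cmod (g w - b * w - c2 * w ^ 2) <= K3 * Cmod w ^ 3.
Proof.
intros Hg HK. destruct (taylor g R0 M Hg) as [c Hc]. destruct Hg as [HR _].
assert (c0 : c 0%nat = 0%C).
{ assert (G0 := HK 0%C). rewrite Cmod_0 in G0. specialize (G0 ltac:(lra)).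
  replace (g 0 - b * 0)%C with (g 0%C) in G0 by ring.
  assert (G1 := Hc 1%nat 0%C). rewrite Cmod_0 in G1. specialize (G1 ltac:(lra)).
  simpl in G0, G1. apply Cmod_eq_0. apply Rle_antisym; [|apply Cmod_ge_0].
  replace (c 0%nat) with (g 0 - (g 0 - (0 + c 0%nat * 1)))%C by ring.
  eapply Rle_trans; [apply Cmod_minus_le|]. lra. }
assert (c1 : c 1%nat = b).
{ apply Ceq_minus. apply small_linear with (K := K + 4 * M * (4 / R0) ^ 2) (r := R0 / 8);
    [lra|].
  intros t Ht. assert (Hm : Cmod (RtoC t) = t) by (apply Cmod_RtoC_pos; lra).
  assert (G1 := Hc 2%nat (RtoC t)). assert (G0 := HK (RtoC t)). rewrite Hm in *.
  specialize (G0 ltac:(lra)). specialize (G1 ltac:(lra)).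
  rewrite Rpow_mult_distr in G1. cbn [csum] in G1. rewrite c0, Cpow_1_r in G1.
  apply Rmult_le_reg_r with t; [lra|].
  replace (Cmod (c 1%nat - b) * t) with (Cmod ((c 1%nat - b) * RtoC t)) by (rewrite Cmod_mult,
    Hm; ring).
  replace ((c 1%nat - b) * RtoC t)%C with
   ((g (RtoC t) - b * RtoC t) - (g (RtoC t) - (0 + 0 * RtoC t ^ 0 + c 1%nat * RtoC t)))%C by
     ring.
  eapply Rle_trans; [apply Cmod_minus_le|]. simpl (t ^ 2) in *. lra. }
exists (c 2%nat), (4 * M * (4 / R0) ^ 3). intros w Hw.
assert (G := Hc 3%nat w Hw). rewrite Rpow_mult_distr in G. cbn [csum] in G.
rewrite c0, c1, Cpow_1_r in G.
replace (g w - b * w - c 2%nat * w ^ 2)%C with (g w - (0 + 0 * w ^ 0 + b * w + c 2%nat * w ^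
  2))%C by ring.
lra.
Qed.

(** The coordinate [phi = z exp (F z)], where [F' = b / g - 1 / z], turns the
    field [g] into the linear field [b w]. *)
Lemma linearization g R0 M (b : C) K : holo_bounded g R0 M -> b <> 0%C ->
  (forall w, Cmod w <= R0 / 8 -> Cmod (g w - b * w) <= K * Cmod w ^ 2) ->
  exists (phi d : C -> C) (R1 : R), 0 < R1 /\ phi (RtoC 0) = RtoC 0 /\
    forall z, Cmod z < R1 -> is_cderive phi z (d z) /\ (d z * g z)%C = (b * phi z)%C /\
      Cmod (d z - 1) <= 1 / 4.
Proof.
intros Hg Hb0 HK0. destruct (simple_zero_expansion g R0 M b K Hg HK0) as (c2 & K3' & HK3').
assert (Hb : 0 < Cmod b) by now apply Cmod_gt_0.
set (K1 := Rabs K). set (K3 := Rabs K3').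
assert (HK1p : 0 <= K1) by apply Rabs_pos. assert (HK3p : 0 <= K3) by apply Rabs_pos.
assert (HK : forall w, Cmod w <= R0 / 8 -> Cmod (g w - b * w) <= K1 * Cmod w ^ 2).
{ intros w Hw. eapply Rle_trans; [now apply HK0|]. apply Rmult_le_compat_r; [|apply Rle_abs].
  apply pow_le, Cmod_ge_0. }
assert (HK3 : forall w, Cmod w <= R0 / 8 -> Cmod (g w - b * w - c2 * w ^ 2) <= K3 * Cmod w ^ 3).
{ intros w Hw. eapply Rle_trans; [now apply HK3'|]. apply Rmult_le_compat_r; [|apply Rle_abs].
  apply pow_le, Cmod_ge_0. }
destruct Hg as [HR Hg].
(* On this disc [|g z| >= |b| * |z| / 2], so [0] is the only zero of [g]. *)
set (r := Rmin (R0 / 8) (Cmod b / (2 * (K1 + 1)))).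
assert (Hr : 0 < r) by (apply Rmin_case; [lra | apply Rdiv_lt_0_compat; lra]).
assert (Hr1 : r <= R0 / 8) by apply Rmin_l.
assert (Hr2 : r * (2 * (K1 + 1)) <= Cmod b) by (apply (Rle_div_r r (Cmod b)); [lra | apply
  Rmin_r]).
assert (Hlow : forall z, Cmod z < r -> Cmod b / 2 * Cmod z <= Cmod (g z)).
{ intros z Hz. assert (T := Cmod_triangle_rev (b * z) (- (g z - b * z))%C).
  rewrite Cmod_opp, Cmod_mult in T.
  replace (b * z - - (g z - b * z))%C with (g z) in T by ring.
  assert (Q := HK z ltac:(lra)). assert (Z := Cmod_ge_0 z). simpl in Q.
  assert (K1 * Cmod z <= Cmod b / 2) by nra.
  assert (K1 * (Cmod z * (Cmod z * 1)) <= Cmod b / 2 * Cmod z) by nra. lra. }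
assert (Hgne : forall z, Cmod z < r -> z <> 0%C -> g z <> 0%C).
{ intros z Hz Hne. apply Cmod_gt_0 in Hne. apply Cmod_gt_0. specialize (Hlow z Hz). nra. }
set (e0 := (- (c2 / b))%C).
set (e := fun z => if Ceq_dec z 0%C then e0 else (b / g z - / z)%C).
assert (He0 : e 0%C = e0) by (unfold e; destruct (Ceq_dec 0 0); tauto).
set (K4 := (Cmod b * K3 + Cmod c2 * K1) * (2 / (Cmod b * Cmod b))).
assert (HK4 : 0 <= K4).
{ assert (C2 := Cmod_ge_0 c2). unfold K4. apply Rmult_le_pos.
  - apply Rplus_le_le_0_compat; apply Rmult_le_pos; lra.
  - left. apply Rdiv_lt_0_compat; [lra|]. repeat apply Rmult_lt_0_compat; auto. }
assert (Hlip : forall z, Cmod z < r -> Cmod (e z - e0) <= K4 * Cmod z).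
{ intros z Hz. unfold e. destruct (Ceq_dec z 0%C) as [->|Hne].
  - replace (e0 - e0)%C with (RtoC 0) by ring. rewrite Cmod_0. lra.
  - assert (Hgz := Hgne z Hz Hne). assert (L := Hlow z Hz).
    assert (Hzp : 0 < Cmod z) by now apply Cmod_gt_0.
    replace (b / g z - / z - e0)%C with
      ((c2 * z * (g z - b * z) - b * (g z - b * z - c2 * z ^ 2)) / (b * z * g z))%C
      by (unfold e0; simpl Cpow; field; auto).
    assert (Hden : (b * z * g z)%C <> 0%C) by (repeat apply Cmult_neq_0; auto).
    rewrite Cmod_div by auto.
    assert (Hdp : 0 < Cmod (b * z * g z)) by now apply Cmod_gt_0.
    apply (Rle_div_l _ (K4 * Cmod z) _ Hdp).
    apply Rle_trans with ((Cmod b * K3 + Cmod c2 * K1) * Cmod z ^ 3).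
    + eapply Rle_trans; [apply Cmod_minus_le|]. rewrite !Cmod_mult.
      assert (Q2 := HK z ltac:(lra)). assert (Q3 := HK3 z ltac:(lra)).
      assert (Cmod b * Cmod (g z - b * z - c2 * z ^ 2) <= Cmod b * (K3 * Cmod z ^ 3))
        by (apply Rmult_le_compat_l; lra).
      assert (Cmod c2 * Cmod z * Cmod (g z - b * z) <= Cmod c2 * Cmod z * (K1 * Cmod z ^ 2)).
      { apply Rmult_le_compat_l; auto. apply Rmult_le_pos; auto using Cmod_ge_0. }
      simpl in *. lra.
    + rewrite !Cmod_mult. unfold K4.
      set (S := Cmod b * K3 + Cmod c2 * K1). assert (HS : 0 <= S).
      { unfold S. apply Rplus_le_le_0_compat; apply Rmult_le_pos; auto using Cmod_ge_0. }
      apply Rle_trans with (S * (2 / (Cmod b * Cmod b)) * Cmod z * (Cmod b * Cmod z * (Cmod b /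
        2 * Cmod z))).
      * right. field. lra.
      * apply Rmult_le_compat_l.
        -- repeat apply Rmult_le_pos; auto; try lra. left. apply Rinv_0_lt_compat.
          repeat apply Rmult_lt_0_compat; auto.
        -- apply Rmult_le_compat_l; auto. apply Rmult_le_pos; lra. }
assert (Hdiff : forall z, Cmod z < r -> z <> RtoC 0 -> differentiable_at e z).
{ intros z Hz Hne. assert (Hzp : 0 < Cmod z) by now apply Cmod_gt_0.
  apply (diff_ext_loc (fun z => b / g z - / z)%C e z (Cmod z)); auto.
  - intros w Hw. unfold e. destruct (Ceq_dec w 0%C) as [->|]; auto.
    replace (0 - z)%C with (- z)%C in Hw by ring. rewrite Cmod_opp in Hw. lra.
  - apply diff_minus.
    + apply diff_div; [apply diff_const | apply Hg; lra | now apply Hgne].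
    + apply (diff_inv (fun w => w)); [apply diff_id | auto]. }
destruct (holo_primitive e (RtoC 0) r) as (F & HF0 & HF).
{ intros z Hz. destruct (Ceq_dec z 0%C) as [->|Hne]; [|now apply diff_ccont, Hdiff].
  intros eps He. exists (Rmin r (eps / (K4 + 1))). split.
  { apply Rmin_case; auto. apply Rdiv_lt_0_compat; lra. }
  intros w Hw. destruct (lt_Rmin _ _ _ Hw) as [W1 W2].
  replace (w - 0)%C with w in * by ring. apply (Rlt_div_r (Cmod w) eps) in W2; [|lra].
  rewrite He0. eapply Rle_lt_trans; [now apply Hlip|]. assert (Z := Cmod_ge_0 w). lra. }
{ exact Hdiff. }
set (phi := fun z => (z * cexp (F z))%C).
set (d := fun z => (cexp (F z) * (1 + z * e z))%C).
destruct (is_cderive_ccont _ _ _ (is_cderive_comp cexp F (RtoC 0) _ _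
   (is_cderive_cexp _) (HF (RtoC 0) ltac:(rewrite Cmod_0; lra))) (1 / 16)) as [r1 [Hr1p Hr1c]];
     [lra|].
rewrite HF0, cexp_0 in Hr1c.
set (B0 := Cmod e0 + K4 * r + 1).
assert (HB0 : 0 < B0).
{ assert (A1 := Cmod_ge_0 e0). assert (0 <= K4 * r) by (apply Rmult_le_pos; lra). unfold B0.
  lra. }
exists phi, d, (Rmin (r / 4) (Rmin r1 (1 / (16 * B0)))). split.
{ apply Rmin_case; [lra | apply Rmin_case; [lra | apply Rdiv_lt_0_compat; lra]]. }
split. { unfold phi. ring. }
intros z Hz. destruct (lt_Rmin _ _ _ Hz) as [Z1 [Z2 Z3]%lt_Rmin].
apply (Rlt_div_r (Cmod z) 1) in Z3; [|lra].
split; [|split].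
- eapply is_cderive_eq.
  + apply (is_cderive_mult (fun w => w) (fun z => cexp (F z))); [apply is_cderive_id|].
    apply (is_cderive_comp cexp F z); [apply is_cderive_cexp | now apply HF].
  + unfold d. ring.
- unfold d, phi. destruct (Ceq_dec z 0%C) as [->|Hne].
  + assert (g0 : g 0%C = 0%C).
    { apply Cmod_eq_0. apply Rle_antisym; [|apply Cmod_ge_0].
      assert (G0 := HK 0%C). rewrite Cmod_0 in G0. specialize (G0 ltac:(lra)).
      replace (g 0 - b * 0)%C with (g 0%C) in G0 by ring. simpl in G0. lra. }
    rewrite g0. ring.
  + unfold e. destruct (Ceq_dec z 0%C) as [|_]; [tauto|].
    assert (Hgz := Hgne z ltac:(lra) Hne). field. auto.
- unfold d. specialize (Hr1c z). replace (z - 0)%C with z in Hr1c by ring. specialize (Hr1c Z2).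
  set (u := (cexp (F z) - 1)%C) in *. set (v := (z * e z)%C).
  replace (cexp (F z) * (1 + v) - 1)%C with (u + v + u * v)%C by (unfold u; ring).
  assert (Hv : Cmod v <= 1 / 16).
  { unfold v. rewrite Cmod_mult.
    assert (Cmod (e z) <= B0).
    { replace (e z) with ((e z - e0) + e0)%C by ring. eapply Rle_trans; [apply Cmod_triangle|].
      assert (Q := Hlip z ltac:(lra)). assert (K4 * Cmod z <= K4 * r) by (apply
        Rmult_le_compat_l; lra).
      unfold B0. lra. }
    assert (Cmod z * Cmod (e z) <= Cmod z * B0) by (apply Rmult_le_compat_l; auto using
      Cmod_ge_0). lra. }
  eapply Rle_trans; [apply Cmod_triangle|].
  eapply Rle_trans; [apply Rplus_le_compat_r, Cmod_triangle|]. rewrite Cmod_mult.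
  assert (Cmod u * Cmod v <= 1 / 16 * (1 / 16)).
  { apply Rmult_le_compat; auto using Cmod_ge_0. lra. }
  lra.
Qed.

(** * Flat functions with an isolated zero *)

(** What is used of [P] near the origin. The last field says that the zero [0]
    cannot be left along a curve of zeros. *)
Record flat_isolated (P Px Py : C -> R) (r0 : R) : Prop := {
  fi_pos : 0 < r0;
  fi_diff : forall z, Cmod z < r0 ->
    differentiable_pt_lim (fun x y => P (x, y)) (Re z) (Im z) (Px z) (Py z);
  fi_flat : forall n, exists K d, 0 < d /\ forall z, Cmod z < d ->
    Rabs (P z) + Rabs (Px z) + Rabs (Py z) <= K * Cmod z ^ n;
  fi_isolated : forall (gam : R -> C) a, 0 < a -> gam 0 = RtoC 0 ->
    (forall t, 0 <= t <= a -> rcont gam t /\ Cmod (gam t) < r0 /\ P (gam t) = 0) ->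
    forall t, 0 <= t <= a -> gam t = RtoC 0 }.

Lemma im_le_Cmod (z : C) : Rabs (Im z) <= Cmod z.
Proof. exact (snd_le_Cmod z). Qed.

Lemma is_derive_local_max (f : R -> R) l r : 0 < r -> is_derive f 0 l ->
  (forall t, Rabs t < r -> f t <= f 0) -> l = 0.
Proof.
intros Hr Hl Hmax. apply is_derive_Reals in Hl.
assert (pr : derivable_pt f 0) by (exists l; exact Hl).
rewrite <- (derive_pt_eq_0 f 0 l pr Hl).
apply (deriv_maximum f (-r) r); try lra.
intros x H1 H2. apply Hmax. apply Rabs_def1; lra.
Qed.

(** * A maximum principle with weights *)

Definition real_cont (Y : C -> R) (z : C) := forall eps, 0 < eps -> exists d, 0 < d /\
  forall w, Cmod (w - z) < d -> Rabs (Y w - Y z) < eps.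

Lemma real_cont_Re k c z : ccont k z -> real_cont (fun w => Re (k w) - c) z.
Proof.
intros H eps He. destruct (H eps He) as [d [Hd H1]]. exists d; split; auto. intros w Hw.
eapply Rle_lt_trans; [|exact (H1 w Hw)]. eapply Rle_trans; [|apply re_le_Cmod].
right. f_equal. unfold Re; simpl. ring.
Qed.

Lemma real_cont_Cmod2 k s c z : Rabs s = 1 -> ccont k z ->
  real_cont (fun w => s * Cmod (k w) ^ 2 + c) z.
Proof.
intros Hs H eps He. set (a := Cmod (k z)). assert (Ha : 0 <= a) by apply Cmod_ge_0.
assert (Hmin : 0 < Rmin 1 (eps / (2 * a + 2))) by (apply Rmin_case; [lra | apply
  Rdiv_lt_0_compat; lra]).
destruct (H _ Hmin) as [d [Hd H1]]. exists d; split; auto. intros w Hw. specialize (H1 w Hw).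
destruct (lt_Rmin _ _ _ H1) as [H2 H3]. apply (Rlt_div_r (Cmod (k w - k z)) eps) in H3; [|lra].
assert (T1 := Cmod_triangle_rev (k w) (k z)). assert (T2 := Cmod_triangle_rev (k z) (k w)).
replace (k z - k w)%C with (- (k w - k z))%C in T2 by ring. rewrite Cmod_opp in T2.
fold a in T1, T2.
set (h := Cmod (k w - k z)) in *. set (a' := Cmod (k w)) in *.
assert (0 <= a') by apply Cmod_ge_0.
assert (0 <= h) by apply Cmod_ge_0. fold a.
replace (s * a' ^ 2 + c - (s * a ^ 2 + c)) with (s * ((a' - a) * (a' + a))) by ring.
rewrite Rabs_mult, Hs, Rmult_1_l. apply Rabs_def1; nra.
Qed.

Section Flat.
Variables (P Px Py : C -> R) (r0 : R) (HP : flat_isolated P Px Py r0).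

Definition dir_deriv (z v : C) : R := Px z * Re v + Py z * Im v.
(** The error terms of the tangency equation are bounded by [|P| * jet_size]. *)
Definition jet_size (z : C) : R := Rabs (P z) + Rabs (Px z) + Rabs (Py z).
Notation dP := dir_deriv.
Notation jet := jet_size.

Lemma jet_ge0 z : 0 <= jet z.
Proof.
assert (A1 := Rabs_pos (P z)). assert (A2 := Rabs_pos (Px z)). assert (A3 := Rabs_pos (Py z)).
unfold jet. lra.
Qed.

Lemma jet_flat n : exists K d, 0 <= K /\ 0 < d <= r0 /\ forall z, Cmod z < d -> jet z <= K *
  Cmod z ^ n.
Proof.
destruct (fi_flat _ _ _ _ HP n) as (K & d & Hd & H). assert (Hr := fi_pos _ _ _ _ HP).
exists (Rabs K), (Rmin d r0). split; [apply Rabs_pos|split].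
- split; [now apply Rmin_case | apply Rmin_r].
- intros z Hz. eapply Rle_trans; [apply H; eapply Rlt_le_trans; [exact Hz | apply Rmin_l]|].
  apply Rmult_le_compat_r; [apply pow_le, Cmod_ge_0 | apply Rle_abs].
Qed.

Lemma jet_small eps : 0 < eps -> exists d, 0 < d <= r0 /\ forall z, Cmod z < d -> jet z < eps.
Proof.
intros He. destruct (jet_flat 1) as (K & d & HK & Hd & H).
exists (Rmin d (eps / (K + 1))). split.
- split; [apply Rmin_case; [lra | apply Rdiv_lt_0_compat; lra]|].
  eapply Rle_trans; [apply Rmin_l | lra].
- intros z Hz. destruct (lt_Rmin _ _ _ Hz) as [Z1 Z2].
  apply (Rlt_div_r (Cmod z) eps) in Z2; [|lra].
  specialize (H z Z1). rewrite pow_1 in H. assert (Z := Cmod_ge_0 z). lra.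
Qed.

Lemma P_le_jet z : Rabs (P z) <= jet z.
Proof.
assert (A2 := Rabs_pos (Px z)). assert (A3 := Rabs_pos (Py z)). unfold jet. lra.
Qed.

Lemma P_0 : P (RtoC 0) = 0.
Proof.
destruct (jet_flat 1) as (K & d & HK & Hd & H). specialize (H (RtoC 0)).
rewrite Cmod_0 in H. specialize (H ltac:(lra)). rewrite pow_1, Rmult_0_r in H.
assert (A := P_le_jet (RtoC 0)). assert (B := Rabs_pos (P (RtoC 0))).
apply Rabs_eq_0. lra.
Qed.

Lemma dP_bound z v : Rabs (dP z v) <= jet z * Cmod v.
Proof.
unfold dP. eapply Rle_trans; [apply Rabs_triang|]. rewrite !Rabs_mult.
assert (A1 := re_le_Cmod v). assert (A2 := im_le_Cmod v).
assert (B1 := Rabs_pos (P z)). assert (B2 := Rabs_pos (Px z)). assert (B3 := Rabs_pos (Py z)).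
assert (Rabs (Px z) * Rabs (Re v) <= Rabs (Px z) * Cmod v) by (apply Rmult_le_compat_l; auto).
assert (Rabs (Py z) * Rabs (Im v) <= Rabs (Py z) * Cmod v) by (apply Rmult_le_compat_l; auto).
assert (0 <= Rabs (P z) * Cmod v) by (apply Rmult_le_pos; auto using Cmod_ge_0).
unfold jet. lra.
Qed.

Lemma dP_scal z (s : R) v : dP z (RtoC s * v)%C = s * dP z v.
Proof. unfold dP, Re, Im; simpl. ring. Qed.

Lemma dP_plus z u v : dP z (u + v)%C = dP z u + dP z v.
Proof. unfold dP, Re, Im; simpl. ring. Qed.

Lemma P_cont z : Cmod z < r0 -> forall eps, 0 < eps -> exists d, 0 < d /\
  forall w, Cmod (w - z) < d -> Rabs (P w - P z) < eps.
Proof.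
intros Hz eps He.
destruct (differentiable_continuity_pt _ _ _ (ex_intro _ _ (ex_intro _ _ (fi_diff _ _ _ _ HP z
  Hz)))
  (mkposreal eps He)) as [d Hd].
exists d. split; [apply cond_pos|]. intros [u v] Hw. destruct z as [x y].
apply Hd; (eapply Rle_lt_trans; [|exact Hw]); [apply (fst_le_Cmod ((u, v) - (x, y))%C) |
  apply (snd_le_Cmod ((u, v) - (x, y))%C)].
Qed.

Lemma P_chain (gam : R -> C) t v : Cmod (gam t) < r0 -> is_rderive gam t v ->
  is_derive (fun s => P (gam s)) t (dP (gam t) v).
Proof.
intros Hz Hg.
apply (is_derive_ext (fun s => P (Re (gam s), Im (gam s)))).
{ intros s. now destruct (gam s). }
apply is_derive_Reals.
apply (derivable_pt_lim_comp_2d (fun x y => P (x, y)) (fun s => Re (gam s)) (fun s => Im (gam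
  s))).
- exact (fi_diff _ _ _ _ HP _ Hz).
- apply is_derive_Reals. now apply is_derive_Re.
- apply is_derive_Reals. now apply is_derive_Im.
Qed.

Lemma nonzero_on_ray v rho : Cmod v = 1 -> 0 < rho -> exists t, 0 < t < rho /\ P (RtoC t * v)%C
  <> 0.
Proof.
intros Hv Hrho. assert (Hr := fi_pos _ _ _ _ HP).
apply NNPP. intros N.
set (a := Rmin (rho / 2) (r0 / 2)). assert (Ha : 0 < a) by (apply Rmin_case; lra).
assert (Ha1 : a <= rho / 2) by apply Rmin_l. assert (Ha2 : a <= r0 / 2) by apply Rmin_r.
assert (Z : (RtoC a * v)%C = RtoC 0).
{ apply (fi_isolated _ _ _ _ HP (fun t => RtoC t * v)%C a); try lra.
  - ring.
  - intros t Ht. split; [|split].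
    + apply rcont_eps. intros eps He. exists eps. split; auto. intros s Hs.
      replace (s * v - t * v)%C with (RtoC (s - t) * v)%C by (rewrite RtoC_minus; ring).
      now rewrite Cmod_mult, Hv, Rmult_1_r, Cmod_R.
    + rewrite Cmod_mult, Hv, Rmult_1_r, Cmod_R, Rabs_right; lra.
    + destruct (Req_dec t 0) as [->|Ht0].
      * replace (0 * v)%C with (RtoC 0) by ring. apply P_0.
      * apply NNPP. intros Hne. apply N. exists t. split; auto; lra. }
apply (f_equal Cmod) in Z. rewrite Cmod_mult, Hv, Cmod_0, Cmod_R, Rabs_right in Z; lra.
Qed.

(** The maximum of [P ^ 2 * Y] over a square, where only [Y > 0] is considered:
    it is interior because [Y <= 0] away from the origin, and it is not at the
    origin because [P] is flat there. Applied with a weight [Y]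
    whose derivative along a field is known, it replaces following an integral
    curve of this field. *)
Lemma critical_point (Y : C -> R) rho A n : 0 < rho -> 2 * rho < r0 ->
  (forall z, 0 < Cmod z <= 2 * rho -> real_cont Y z) ->
  0 <= A -> (forall z, 0 < Cmod z -> Y z <= A / Cmod z ^ n) ->
  (forall z, rho <= Cmod z <= 2 * rho -> Y z <= 0) ->
  (exists z, Cmod z < rho /\ P z <> 0 /\ 0 < Y z) ->
  exists z, 0 < Cmod z < rho /\ P z <> 0 /\ 0 < Y z /\
    forall v l, is_derive (fun t => Y (z + RtoC t * v)%C) 0 l -> 2 * Y z * dP z v + P z * l = 0.
Proof.
intros Hrho Hr HYc HA HYA Hout (z1 & Hz1 & HPz1 & HYz1).
(* Near the origin the flatness of [P] beats the growth of the weight. *)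
assert (HY0 : forall eps, 0 < eps -> exists d, 0 < d /\ forall w, 0 < Cmod w < d -> P w ^ 2 * Y
  w < eps).
{ intros eps He. destruct (jet_flat (S n)) as (K & d & HK & Hd & Hj).
  assert (HKA : 0 <= K * K * A) by (repeat apply Rmult_le_pos; auto).
  exists (Rmin (Rmin 1 d) (eps / (K * K * A + 1))). split.
  { apply Rmin_case; [apply Rmin_case; lra | apply Rdiv_lt_0_compat; lra]. }
  intros w [Hw0 Hw]. destruct (lt_Rmin _ _ _ Hw) as [[W1 W2]%lt_Rmin W3].
  apply (Rlt_div_r (Cmod w)) in W3; [|lra]. specialize (Hj w W2). specialize (HYA w Hw0).
  change (Cmod w ^ S n) with (Cmod w * Cmod w ^ n) in Hj.
  set (p := Cmod w ^ n) in *. assert (Hp : 0 < p) by now apply pow_lt.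
  assert (Hp1 : p <= 1). { unfold p. rewrite <- (pow1 n). apply pow_incr. lra. }
  assert (HPw : P w ^ 2 <= (K * (Cmod w * p)) ^ 2).
  { rewrite <- (pow2_abs (P w)). apply pow_incr. split; [apply Rabs_pos|].
    eapply Rle_trans; [apply P_le_jet | exact Hj]. }
  assert (HAp : 0 <= A / p) by (apply Rdiv_le_0_compat; auto).
  apply Rle_lt_trans with (P w ^ 2 * (A / p)).
  { apply Rmult_le_compat_l; [apply pow2_ge_0 | lra]. }
  apply Rle_lt_trans with ((K * (Cmod w * p)) ^ 2 * (A / p)).
  { now apply Rmult_le_compat_r. }
  replace ((K * (Cmod w * p)) ^ 2 * (A / p)) with (K * K * A * (Cmod w * p) * Cmod w) by (field;
    lra).
  assert (K * K * A * (Cmod w * p) <= K * K * A * 1) by (apply Rmult_le_compat_l; nra).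
  assert (K * K * A * (Cmod w * p) * Cmod w <= K * K * A * 1 * Cmod w) by (apply
    Rmult_le_compat_r; lra).
  lra. }
set (Q := fun z => P z ^ 2 * Rmax (Y z) 0).
assert (HQ0 : forall z, 0 <= Q z).
{ intros z. apply Rmult_le_pos; [apply pow2_ge_0 | apply Rmax_r]. }
assert (Husc : forall z, in_rect (-rho) rho (-rho) rho z -> forall e, Q z < e ->
     exists r, 0 < r /\ forall w, Cmod (w - z) < r -> Q w < e).
{ intros z Hz e He. apply square_rect in Hz; auto.
  destruct (Ceq_dec z 0%C) as [->|Hne].
  - assert (He' : 0 < e) by (specialize (HQ0 (RtoC 0)); lra).
    destruct (HY0 e He') as [d [Hd H]]. exists d; split; auto. intros w Hw.
    replace (w - 0)%C with w in Hw by ring.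
    unfold Q. destruct (Ceq_dec w 0%C) as [->|Hw0].
    + rewrite P_0. lra.
    + apply Cmod_gt_0 in Hw0. unfold Rmax. destruct (Rle_dec (Y w) 0); [lra|]. apply H; lra.
  - apply Cmod_gt_0 in Hne.
    set (m := Rmax (Y z) 0). assert (Hm : 0 <= m) by apply Rmax_r.
    assert (HP2 : 0 <= P z ^ 2) by apply pow2_ge_0.
    set (k := Rmin 1 ((e - Q z) / (m + P z ^ 2 + 2 + (2 * Rabs (P z) + 1) * (m + 1)))).
    assert (Hap := Rabs_pos (P z)).
    assert (Hden : 0 < m + P z ^ 2 + 2 + (2 * Rabs (P z) + 1) * (m + 1)) by nra.
    assert (Hk : 0 < k) by (apply Rmin_case; [lra | apply Rdiv_lt_0_compat; lra]).
    assert (Hk1 : k <= 1) by apply Rmin_l.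
    assert (Hk2 : k * (m + P z ^ 2 + 2 + (2 * Rabs (P z) + 1) * (m + 1)) <= e - Q z).
    { apply (Rle_div_r k (e - Q z)); auto. apply Rmin_r. }
    destruct (HYc z ltac:(lra) k Hk) as [d1 [D1 H1]].
    destruct (P_cont z ltac:(lra) k Hk) as [d2 [D2 H2]].
    exists (Rmin d1 d2). split; [now apply Rmin_case|]. intros w Hw.
    specialize (H1 w (Rlt_le_trans _ _ _ Hw (Rmin_l _ _))).
    specialize (H2 w (Rlt_le_trans _ _ _ Hw (Rmin_r _ _))).
    unfold Q. apply Rabs_def2 in H1. apply Rabs_def2 in H2.
    assert (Hm' : Rmax (Y w) 0 <= m + k) by (unfold m, Rmax; destruct (Rle_dec (Y w) 0),
      (Rle_dec (Y z) 0); lra).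
    assert (Hm0 : 0 <= Rmax (Y w) 0) by apply Rmax_r.
    assert (HPw : P w ^ 2 <= P z ^ 2 + k * (2 * Rabs (P z) + 1)).
    { assert (- Rabs (P z) <= P z <= Rabs (P z)) by (apply Rabs_le_between; lra).
      set (h := P w - P z). replace (P w) with (P z + h) by (unfold h; ring).
      assert (- k < h < k) by (unfold h; lra). nra. }
    apply Rle_lt_trans with ((P z ^ 2 + k * (2 * Rabs (P z) + 1)) * (m + k)).
    + apply Rmult_le_compat; auto. apply pow2_ge_0.
    + assert (E : Q z = P z ^ 2 * m) by reflexivity.
      replace ((P z ^ 2 + k * (2 * Rabs (P z) + 1)) * (m + k)) with
       (Q z + k * (P z ^ 2) + k * ((2 * Rabs (P z) + 1) * (m + k))) by (rewrite E; ring).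
      assert (k * ((2 * Rabs (P z) + 1) * (m + k)) <= k * ((2 * Rabs (P z) + 1) * (m + 1))).
      { apply Rmult_le_compat_l; [lra|]. apply Rmult_le_compat_l; lra. }
      assert (0 < k * (m + 2)) by (apply Rmult_lt_0_compat; lra). lra. }
destruct (rect_max Q (-rho) rho (-rho) rho ltac:(lra) ltac:(lra) Husc) as (z & Hz & Hmax).
assert (Hin : forall w, Cmod w < rho -> in_rect (-rho) rho (-rho) rho w).
{ intros w Hw. assert (A1 := fst_le_Cmod w). assert (A2 := snd_le_Cmod w).
  apply Rabs_le_between in A1. apply Rabs_le_between in A2. split; apply between_le; lra. }
assert (HQz : 0 < Q z).
{ apply Rlt_le_trans with (Q z1); [|now apply Hmax, Hin].
  apply Rmult_lt_0_compat.
  - assert (0 <= P z1 ^ 2) by apply pow2_ge_0.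
    assert (P z1 ^ 2 <> 0) by (apply pow_nonzero; auto). lra.
  - unfold Rmax. destruct (Rle_dec (Y z1) 0); lra. }
apply square_rect in Hz; auto.
assert (HPz : P z <> 0). { intros E. unfold Q in HQz. rewrite E in HQz. simpl in HQz. lra. }
assert (HYz : 0 < Y z).
{ apply Rnot_le_lt. intros E. unfold Q in HQz. rewrite Rmax_right in HQz by auto. lra. }
assert (Hz0 : 0 < Cmod z).
{ apply Cmod_gt_0. intros ->. apply HPz, P_0. }
assert (Hzr : Cmod z < rho). { apply Rnot_le_lt. intros E. specialize (Hout z ltac:(lra)). lra.
}
exists z. repeat split; auto. intros v l Hl.
assert (HPd : is_derive (fun t => P (z + RtoC t * v)%C) 0 (dP z v)).
{ assert (E : (z + RtoC 0 * v)%C = z) by ring.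
  assert (D := P_chain (fun t => z + RtoC t * v)%C 0 v). cbv beta in D. rewrite E in D.
  apply D; [lra | apply is_rderive_line]. }
assert (Hq : is_derive (fun t => P (z + RtoC t * v)%C ^ 2 * Y (z + RtoC t * v)%C) 0
   (P z * (2 * Y z * dP z v + P z * l))).
{ assert (E : (z + RtoC 0 * v)%C = z) by ring.
  assert (D := is_derive_mult _ _ 0 _ _ (is_derive_pow _ 2 0 _ HPd) Hl Rmult_comm).
  unfold mult, plus in D; simpl in D. rewrite E in D.
  replace (P z * (2 * Y z * dP z v + P z * l)) with
    ((1 + 1) * dP z v * (P z * 1) * Y z + P z * (P z * 1) * l) by ring.
  exact D. }
assert (Hloc : P z * (2 * Y z * dP z v + P z * l) = 0).
{ assert (Hv := Cmod_ge_0 v).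
  apply (is_derive_local_max _ _ ((rho - Cmod z) / (Cmod v + 1)) ltac:(apply Rdiv_lt_0_compat;
    lra) Hq).
  intros t Ht. apply (Rlt_div_r (Rabs t)) in Ht; [|lra].
  assert (E : (z + RtoC 0 * v)%C = z) by ring. rewrite E.
  assert (Hw : Cmod (z + RtoC t * v) < rho).
  { eapply Rle_lt_trans; [apply Cmod_triangle|]. rewrite Cmod_mult, Cmod_R.
    assert (Ht0 := Rabs_pos t). nra. }
  specialize (Hmax _ (Hin _ Hw)).
  replace (P z ^ 2 * Y z) with (Q z) by (unfold Q; rewrite Rmax_left; lra).
  eapply Rle_trans; [|exact Hmax]. apply Rmult_le_compat_l; [apply pow2_ge_0 | apply Rmax_l]. }
apply Rmult_integral in Hloc. tauto.
Qed.

End Flat.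

(** * Fields along which a flat function is multiplied by a constant *)

Lemma Re_line_derive (k : C -> C) (c : R) (z l v : C) : is_cderive k z l ->
  is_derive (fun t => Re (k (z + RtoC t * v)%C) - c) 0 (Re (l * v)%C).
Proof.
intros Hk.
assert (D : is_derive (fun t => Re (k (z + RtoC t * v)%C)) 0 (Re (l * v)%C)).
{ apply is_derive_Re. apply (is_rderive_comp k (fun t => z + RtoC t * v)%C 0); [|apply
    is_rderive_line].
  replace (z + RtoC 0 * v)%C with z by ring. exact Hk. }
replace (Re (l * v)%C) with (minus (Re (l * v)%C) 0) by (unfold minus, plus, opp; simpl; ring).
exact (is_derive_minus _ _ 0 _ _ D (is_derive_const c 0)).
Qed.

Lemma Cmod2_line_derive (k : C -> C) (z l v : C) : is_cderive k z l ->
  is_derive (fun t => Cmod (k (z + RtoC t * v)%C) ^ 2) 0 (2 * Re (Cconj (k z) * l * v)%C).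
Proof.
intros Hk.
assert (E : (z + RtoC 0 * v)%C = z) by ring.
assert (D1 : is_derive (fun t => Re (k (z + RtoC t * v)%C)) 0 (Re (l * v)%C)).
{ apply is_derive_Re. apply (is_rderive_comp k (fun t => z + RtoC t * v)%C 0); [|apply
    is_rderive_line].
  rewrite E. exact Hk. }
assert (D2 : is_derive (fun t => Re (- Ci * k (z + RtoC t * v))%C) 0 (Re (- Ci * l * v)%C)).
{ apply is_derive_Re. apply (is_rderive_comp (fun w => - Ci * k w)%C (fun t => z + RtoC t * v)%C
    0); [|apply is_rderive_line].
  rewrite E. apply (is_cderive_eq _ _ (0 * k z + - Ci * l)%C); [|ring].
  apply (is_cderive_mult (fun _ => - Ci)%C k); [apply is_cderive_const | exact Hk]. }
apply (is_derive_ext (fun t => plus (Re (k (z + RtoC t * v)%C) ^ 2) (Re (- Ci * k (z + RtoC t *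
  v))%C ^ 2))).
{ intros t. rewrite Cmod2_alt. unfold plus, Re, Im; simpl. ring. }
assert (D := is_derive_plus _ _ 0 _ _ (is_derive_pow _ 2 0 _ D1) (is_derive_pow _ 2 0 _ D2)).
cbv beta in D. rewrite E in D.
match type of D with is_derive _ _ ?x => replace (2 * Re (Cconj (k z) * l * v)%C) with x; [exact
  D|] end.
unfold plus, Re, Cconj; simpl. ring.
Qed.

Lemma Cmod_inv_pow (z : C) n : z <> RtoC 0 -> Cmod ((/ z) ^ n)%C = / Cmod z ^ n.
Proof. intros Hz. now rewrite Cmod_pow, Cmod_inv, pow_inv. Qed.

Lemma is_cderive_inv_pow (z : C) n : z <> RtoC 0 ->
  is_cderive (fun w => (/ w) ^ S n)%C z (- RtoC (INR (S n)) * (/ z) ^ S n * / z)%C.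
Proof.
intros Hz. eapply is_cderive_eq.
- apply (is_cderive_comp (fun w => w ^ S n)%C Cinv z); [apply is_cderive_pow | now apply
    is_cderive_inv].
- rewrite Cpow_S. field. auto.
Qed.

Section Field.
Variables (P Px Py : C -> R) (r0 : R) (HP : flat_isolated P Px Py r0).
Variables (g : C -> C) (R0 M lam K0 dl : R).
Notation dP := (dir_deriv Px Py).
Notation jet := (jet_size P Px Py).
Hypotheses (Hg : holo_bounded g R0 M) (HK0 : 0 <= K0) (Hdl : 0 < dl)
  (Hfield : forall z, Cmod z < dl -> Rabs (dP z (g z) + lam * P z) <= K0 * Rabs (P z) * jet z).

(** At a critical point of [P ^ 2 * Y] the derivative of [P] along [g] is
    [- P l / (2 Y)], where [l] is that of [Y]. Comparing with [- lam * P] gives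
    a constraint on the weight alone. *)
Lemma critical_field z Y l : Cmod z < dl -> P z <> 0 -> 0 < Y ->
  2 * Y * dP z (g z) + P z * l = 0 -> Rabs (l - 2 * lam * Y) <= 2 * K0 * jet z * Y.
Proof.
intros Hz HPz HY H. specialize (Hfield z Hz).
assert (E : dP z (g z) + lam * P z = - P z * (l - 2 * lam * Y) / (2 * Y)).
{ apply (Rmult_eq_reg_l (2 * Y)); [|lra]. field_simplify; [|lra]. lra. }
rewrite E in Hfield. unfold Rdiv in Hfield. rewrite !Rabs_mult, Rabs_Ropp in Hfield.
rewrite (Rabs_right (/ (2 * Y))) in Hfield by (left; apply Rinv_0_lt_compat; lra).
assert (HPp : 0 < Rabs (P z)) by now apply Rabs_pos_lt.
apply (Rmult_le_reg_l (Rabs (P z) * / (2 * Y))).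
{ apply Rmult_lt_0_compat; auto. apply Rinv_0_lt_compat; lra. }
replace (Rabs (P z) * / (2 * Y) * (2 * K0 * jet z * Y)) with (K0 * Rabs (P z) * jet z) by
  (field; lra).
lra.
Qed.

(** The weight is the real part of [k = sg / (b z^(m+1))]. Along [g] its derivative
    is [- sg * (m + 1) * (1 + O(z))], while it should be [2 lam Y] up to a
    flat multiple of [Y]. Choosing the sign [sg] of [lam] makes this impossible:
    this amounts to using an attracting or a repelling petal of [g]. *)
Lemma order_ge2_impossible m b K : b <> RtoC 0 -> 0 <= K ->
  (forall w, Cmod w <= R0 / 8 -> Cmod (g w - b * w ^ S (S m)) <= K * Cmod w ^ S (S (S m))) ->
    False.
Proof.
intros Hb HK Hgb. assert (Hbp : 0 < Cmod b) by now apply Cmod_gt_0.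
destruct Hg as [HR _].
destruct (jet_flat P Px Py r0 HP (S (S m))) as (K' & d' & HK' & Hd' & Hjet).
(* The sign that makes [2 * lam * Y] and the derivative of the weight opposite. *)
set (sg := if Rle_dec 0 lam then 1 else -1).
assert (Hsg : 0 <= sg * lam /\ (sg = 1 \/ sg = -1)) by (unfold sg; destruct (Rle_dec 0 lam);
  lra).
assert (Hsg2 : sg * sg = 1) by (destruct Hsg as [_ [-> | ->]]; lra).
assert (Hsga : Rabs sg = 1).
{ destruct Hsg as [_ [-> | ->]]; [apply Rabs_R1 | rewrite Rabs_left; lra]. }
set (A := K + 2 * K0 * K' + 1). assert (HA : 0 < A) by (unfold A; assert (0 <= K0 * K') by
  (apply Rmult_le_pos; lra); lra).
set (rho := Rmin (Rmin (R0 / 16) (dl / 2)) (Rmin (d' / 4) (Cmod b / (4 * A)))).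
assert (Hrho : 0 < rho).
{ unfold rho. apply Rmin_case; apply Rmin_case; try lra. apply Rdiv_lt_0_compat; lra. }
destruct (le_Rmin rho _ _ (Rle_refl _)) as [[Hr1 Hr2]%le_Rmin [Hr3 Hr4]%le_Rmin].
apply (Rle_div_r rho (Cmod b)) in Hr4; [|lra].
set (k := fun z => (RtoC sg * / b * (/ z) ^ S m)%C).
assert (Hkm : forall z, z <> RtoC 0 -> Cmod (k z) = / (Cmod b * Cmod z ^ S m)).
{ intros z Hz. unfold k. rewrite !Cmod_mult, Cmod_inv_pow, Cmod_inv, Cmod_R, Hsga, Rinv_mult by
    auto. ring. }
assert (Hkd : forall z, z <> RtoC 0 -> is_cderive k z (- RtoC (INR (S m)) * k z * / z)%C).
{ intros z Hz. eapply is_cderive_eq.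
  - apply (is_cderive_mult (fun _ => RtoC sg * / b)%C (fun z => (/ z) ^ S m)%C); [apply
      is_cderive_const|].
    now apply is_cderive_inv_pow.
  - unfold k. field. auto. }
set (c := / (Cmod b * rho ^ S m)).
assert (Hc0 : 0 < c) by (apply Rinv_0_lt_compat, Rmult_lt_0_compat; [lra | now apply pow_lt]).
destruct (critical_point P Px Py r0 HP (fun z => Re (k z) - c) rho (/ Cmod b) (S m) Hrho
  ltac:(lra))
  as (z & Hz & HPz & HYz & Hcrit).
- intros z Hz. apply real_cont_Re. eapply is_cderive_ccont, Hkd. apply Cmod_gt_0; lra.
- left. now apply Rinv_0_lt_compat.
- intros z Hz. assert (Hzne : z <> RtoC 0) by now apply Cmod_gt_0.
  assert (Hk1 := re_le_Cmod (k z)). rewrite Hkm in Hk1 by auto. apply Rabs_le_between in Hk1.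
  rewrite Rinv_mult in Hk1. unfold Rdiv. lra.
- intros z Hz. assert (Hzne : z <> RtoC 0) by (apply Cmod_gt_0; lra).
  assert (Hk1 := re_le_Cmod (k z)). rewrite Hkm in Hk1 by auto. apply Rabs_le_between in Hk1.
  assert (/ (Cmod b * Cmod z ^ S m) <= c); [|lra].
  apply Rinv_le_contravar; [apply Rmult_lt_0_compat; [lra | now apply pow_lt]|].
  apply Rmult_le_compat_l; [lra|]. apply pow_incr. lra.
- destruct (direction (RtoC sg * b) (S m)) as (v & Hv1 & Hv2); [lia|].
  destruct (nonzero_on_ray P Px Py r0 HP v rho Hv1 Hrho) as (t & Ht & HPt).
  exists (RtoC t * v)%C.
  assert (Hm : Cmod (RtoC t * v) = t) by (rewrite Cmod_mult, Hv1, Cmod_R, Rabs_right; lra).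
  split; [lra|split; auto].
  assert (Hvne : v <> RtoC 0) by (apply Cmod_gt_0; lra).
  assert (Htne : RtoC t <> RtoC 0) by (intros E; apply RtoC_inj in E; lra).
  rewrite Cmod_mult, Cmod_R, Hsga, Rmult_1_l in Hv2.
  assert (Hkt : k (RtoC t * v)%C = RtoC (/ (Cmod b * t ^ S m))).
  { unfold k. rewrite Cpow_inv by now apply Cmult_neq_0. rewrite Cpow_mult_l.
    rewrite RtoC_inv, RtoC_mult, RtoC_pow by (apply Rgt_not_eq, Rmult_lt_0_compat; [lra | apply
      pow_lt; lra]).
    rewrite <- Hv2.
    assert (Hvm : (v ^ S m)%C <> RtoC 0) by now apply Cpow_nz.
    assert (Htm : (RtoC t ^ S m)%C <> RtoC 0) by now apply Cpow_nz.
    assert (Hs : (RtoC sg * RtoC sg)%C = RtoC 1) by (rewrite <- RtoC_mult, Hsg2; auto).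
    assert (Hsne : RtoC sg <> RtoC 0) by (intros E; rewrite E in Hs; apply C1_nz; rewrite <- Hs;
      ring).
    replace (RtoC sg * / b * / (RtoC t ^ S m * v ^ S m))%C with
      ((RtoC sg * RtoC sg) * / (RtoC sg * b * v ^ S m * RtoC t ^ S m))%C by (field; auto).
    rewrite Hs. ring. }
  rewrite Hkt. rewrite re_RtoC. assert (c < / (Cmod b * t ^ S m)); [|lra].
  apply Rinv_lt_contravar.
  + apply Rmult_lt_0_compat; apply Rmult_lt_0_compat; try lra; apply pow_lt; lra.
  + apply Rmult_lt_compat_l; auto.
    simpl. assert (t ^ m <= rho ^ m) by (apply pow_incr; lra).
    assert (0 < t ^ m) by (apply pow_lt; lra).
    nra.
- assert (Hzne : z <> RtoC 0) by (apply Cmod_gt_0; lra).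
  assert (Hzm : (z ^ S m)%C <> RtoC 0) by now apply Cpow_nz.
  assert (Hc := Hcrit (g z) _ (Re_line_derive k c z _ (g z) (Hkd z Hzne))).
  apply critical_field in Hc; auto; [|lra].
  set (Y := Re (k z) - c) in *.
  set (q := (g z / (b * z ^ S (S m)))%C).
  assert (E : (- RtoC (INR (S m)) * k z * / z * g z)%C = (RtoC (- (sg * INR (S m))) * q)%C).
  { unfold k, q. rewrite Cpow_inv by auto. rewrite RtoC_opp, RtoC_mult, !Cpow_S. field.
    repeat split; auto. now apply Cpow_nz. }
  rewrite E, re_scal_l in Hc.
  assert (Hq : Cmod (q - 1) <= 1 / 2).
  { assert (Hden : (b * z ^ S (S m))%C <> RtoC 0) by (apply Cmult_neq_0; auto; now apply
      Cpow_nz).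
    unfold q. replace (g z / (b * z ^ S (S m)) - 1)%C with ((g z - b * z ^ S (S m)) / (b * z ^ S
      (S m)))%C
      by (field; split; auto; now apply Cpow_nz).
    rewrite Cmod_div, Cmod_mult, Cmod_pow by auto.
    assert (Hpz : 0 < Cmod z ^ S (S m)) by (apply pow_lt; lra).
    apply (Rle_div_l _ (1 / 2)); [now apply Rmult_lt_0_compat|].
    eapply Rle_trans; [apply Hgb; lra|].
    change (Cmod z ^ S (S (S m))) with (Cmod z * Cmod z ^ S (S m)).
    assert (K * Cmod z <= Cmod b / 2).
    { assert (K <= A) by (unfold A; assert (0 <= K0 * K') by (apply Rmult_le_pos; lra); lra).
      nra. }
    rewrite <- !Rmult_assoc. apply Rmult_le_compat_r; lra. }
  assert (Hre : 1 / 2 <= Re q).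
  { assert (B := re_le_Cmod (q - 1)). replace (Re (q - 1)%C) with (Re q - 1) in B by (unfold Re;
      simpl; ring).
    apply Rabs_le_between in B. lra. }
  assert (HN : 1 <= INR (S m)) by (rewrite S_INR; assert (N := pos_INR m); lra).
  assert (Hlow : 1 / 2 <= Rabs (- (sg * INR (S m)) * Re q - 2 * lam * Y)).
  { replace (- (sg * INR (S m)) * Re q - 2 * lam * Y) with
      (- (sg * (INR (S m) * Re q + 2 * (sg * lam) * Y))).
    2:{ transitivity (- (sg * INR (S m)) * Re q - 2 * (sg * sg) * lam * Y); [ring | rewrite
      Hsg2; ring]. }
    rewrite Rabs_Ropp, Rabs_mult, Hsga, Rmult_1_l.
    assert (0 <= 2 * (sg * lam) * Y) by (apply Rmult_le_pos; lra).
    rewrite Rabs_right; nra. }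
  assert (Hup : 2 * K0 * jet z * Y < 1 / 2).
  { assert (Hk1 := re_le_Cmod (k z)). rewrite Hkm in Hk1 by auto. apply Rabs_le_between in Hk1.
    assert (Hj := Hjet z ltac:(lra)).
    set (p := Cmod z ^ S m) in *. assert (Hp : 0 < p) by (apply pow_lt; lra).
    change (Cmod z ^ S (S m)) with (Cmod z * p) in Hj.
    apply Rle_lt_trans with (2 * K0 * (K' * (Cmod z * p)) * / (Cmod b * p)).
    - apply Rmult_le_compat; try lra.
      + apply Rmult_le_pos; [lra | apply jet_ge0].
      + apply Rmult_le_compat_l; lra.
      + unfold Y. lra.
    - replace (2 * K0 * (K' * (Cmod z * p)) * / (Cmod b * p)) with (2 * K0 * K' * Cmod z / Cmod
        b) by (field; lra).
      apply (Rlt_div_l _ (1 / 2)); auto.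
      assert (2 * K0 * K' <= A - 1) by (unfold A; lra). nra. }
  lra.
Qed.

(** With the weight [|z|^(-2 (n+1))] the derivative along [g] is about
    [- 2 (n + 1) Re b] times the weight, which exceeds [2 |lam| Y] for large [n]
    when [Re b <> 0]. *)
Lemma order1_real_part b K : 0 <= K ->
  (forall w, Cmod w <= R0 / 8 -> Cmod (g w - b * w) <= K * Cmod w ^ 2) -> Re b = 0.
Proof.
intros HK Hgb. apply NNPP. intros Hre. assert (Hbp : 0 < Rabs (Re b)) by now apply Rabs_pos_lt.
destruct Hg as [HR _].
(* The exponent of the weight has to beat the rate [lam]. *)
destruct (INR_unbounded (2 * (Rabs lam + 1) / Rabs (Re b))) as [n0 Hn0].
assert (Hla := Rabs_pos lam).
destruct n0 as [|n].
{ simpl in Hn0. assert (0 < 2 * (Rabs lam + 1) / Rabs (Re b)) by (apply Rdiv_lt_0_compat; lra).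
  lra. }
apply (Rlt_div_l _ (INR (S n))) in Hn0; auto.
destruct (jet_flat P Px Py r0 HP (S (S n))) as (K' & d' & HK' & Hd' & Hjet).
destruct (jet_small P Px Py r0 HP (/ (K0 + 1)) ltac:(apply Rinv_0_lt_compat; lra)) as (d2 & Hd2
  & Hjs).
set (rho := Rmin (Rmin (R0 / 16) (dl / 2)) (Rmin (Rmin (d' / 4) d2) (Rabs (Re b) / (2 * (K +
  1))))).
assert (Hrho : 0 < rho).
{ unfold rho. apply Rmin_case; apply Rmin_case; try lra; [apply Rmin_case; lra | apply
    Rdiv_lt_0_compat; lra]. }
destruct (le_Rmin rho _ _ (Rle_refl _)) as [[Hr1 Hr2]%le_Rmin [[Hr3 Hr5]%le_Rmin Hr4]%le_Rmin].
apply (Rle_div_r rho (Rabs (Re b))) in Hr4; [|lra].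
set (k := fun z => ((/ z) ^ S n)%C).
assert (Hkm : forall z, z <> RtoC 0 -> Cmod (k z) = / Cmod z ^ S n) by (intros; now apply
  Cmod_inv_pow).
assert (Hkd : forall z, z <> RtoC 0 -> is_cderive k z (- RtoC (INR (S n)) * k z * / z)%C)
  by (intros; now apply is_cderive_inv_pow).
set (c := (/ rho ^ S n) ^ 2). assert (Hc0 : 0 <= c) by apply pow2_ge_0.
destruct (critical_point P Px Py r0 HP (fun z => 1 * Cmod (k z) ^ 2 + - c) rho 1 (S n * 2) Hrho
  ltac:(lra))
  as (z & Hz & HPz & HYz & Hcrit).
- intros z Hz. apply real_cont_Cmod2; [apply Rabs_R1|]. eapply is_cderive_ccont, Hkd.
  apply Cmod_gt_0; lra.
- lra.
- intros z Hz. rewrite Hkm, pow_mult, pow_inv by now apply Cmod_gt_0. unfold Rdiv. lra.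
- intros z Hz. assert (Hzne : z <> RtoC 0) by (apply Cmod_gt_0; lra).
  rewrite Hkm by auto. assert (Hp : 0 < rho ^ S n) by now apply pow_lt.
  assert (Hpi : rho ^ S n <= Cmod z ^ S n) by (apply pow_incr; lra).
  assert ((/ Cmod z ^ S n) ^ 2 <= c); [|lra].
  apply pow_incr. split; [left; apply Rinv_0_lt_compat; lra | now apply Rinv_le_contravar].
- destruct (nonzero_on_ray P Px Py r0 HP (RtoC 1) rho Cmod_1 Hrho) as (t & Ht & HPt).
  exists (RtoC t * 1)%C.
  assert (Hm : Cmod (RtoC t * 1) = t) by (rewrite Cmod_mult, Cmod_1, Cmod_R, Rabs_right; lra).
  split; [lra|split; auto].
  rewrite Hkm by (apply Cmod_gt_0; lra). rewrite Hm.
  assert (H1 : 0 < t ^ S n) by (apply pow_lt; lra).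
  assert (H2 : t ^ S n < rho ^ S n).
  { simpl. assert (t ^ n <= rho ^ n) by (apply pow_incr; lra).
    assert (0 < t ^ n) by (apply pow_lt; lra). nra. }
  assert (H3 : / rho ^ S n < / t ^ S n) by (apply Rinv_lt_contravar; auto; apply
    Rmult_lt_0_compat; lra).
  assert (H4 : 0 < / rho ^ S n) by (apply Rinv_0_lt_compat; lra).
  unfold c. nra.
- assert (Hzne : z <> RtoC 0) by (apply Cmod_gt_0; lra).
  assert (D : is_derive (fun t => 1 * Cmod (k (z + RtoC t * g z)%C) ^ 2 + - c) 0
    (2 * Re (Cconj (k z) * (- RtoC (INR (S n)) * k z * / z) * g z)%C)).
  { apply (is_derive_ext (fun t => plus (Cmod (k (z + RtoC t * g z)%C) ^ 2) (- c))).
    { intros t. unfold plus; simpl. ring. }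
    assert (D := is_derive_plus _ _ 0 _ _ (Cmod2_line_derive k z _ (g z) (Hkd z Hzne))
      (is_derive_const (- c) 0)).
    match type of D with is_derive _ _ ?x => match goal with |- is_derive _ _ ?y =>
      replace y with x; [exact D|] end end. unfold plus, zero; simpl. ring. }
  assert (Hc := Hcrit (g z) _ D).
  apply critical_field in Hc; auto; [|lra].
  set (q := (g z / z)%C). set (N := INR (S n)) in *. set (k2 := Cmod (k z) ^ 2) in *.
  assert (E : (Cconj (k z) * (- RtoC N * k z * / z) * g z)%C = (RtoC (- (N * k2)) * q)%C).
  { replace (Cconj (k z) * (- RtoC N * k z * / z) * g z)%C with
      (- RtoC N * (k z * Cconj (k z)) * q)%C by (unfold q; field; auto).
    rewrite <- Cmod2_conj. unfold k2. rewrite RtoC_opp, RtoC_mult, RtoC_pow. ring. }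
  rewrite E, re_scal_l in Hc.
  assert (Hk2 : 0 < k2).
  { unfold k2. rewrite Hkm by auto. apply pow_lt, Rinv_0_lt_compat, pow_lt. lra. }
  assert (Hq : Cmod (q - b) <= Rabs (Re b) / 2).
  { unfold q. replace (g z / z - b)%C with ((g z - b * z) / z)%C by (field; auto).
    rewrite Cmod_div by auto. apply (Rle_div_l _ (Rabs (Re b) / 2)); [lra|].
    eapply Rle_trans; [apply Hgb; lra|]. simpl.
    assert (K * Cmod z <= Rabs (Re b) / 2) by nra. nra. }
  assert (Hreq : Rabs (Re b) / 2 <= Rabs (Re q)).
  { assert (B := re_le_Cmod (q - b)). replace (Re (q - b)%C) with (Re q - Re b) in B by (unfold
      Re; simpl; ring).
    assert (T := Rabs_triang (Re q) (- (Re q - Re b))). rewrite Rabs_Ropp in T.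
    replace (Re q + - (Re q - Re b)) with (Re b) in T by ring. lra. }
  assert (Hj : K0 * jet z <= 1).
  { assert (J := Hjs z ltac:(lra)). assert (J0 := jet_ge0 P Px Py z).
    apply Rle_trans with (K0 * / (K0 + 1)); [apply Rmult_le_compat_l; lra|].
    apply (Rle_div_l K0 1); lra. }
  set (Y := 1 * k2 + - c) in *.
  assert (HU : Rabs (2 * (- (N * k2) * Re q)) <= 2 * k2 * (Rabs lam + 1)).
  { replace (2 * (- (N * k2) * Re q)) with ((2 * (- (N * k2) * Re q) - 2 * lam * Y) + 2 * lam *
      Y) by ring.
    eapply Rle_trans; [apply Rabs_triang|].
    assert (Rabs (2 * lam * Y) = 2 * Rabs lam * Y).
    { rewrite !Rabs_mult, (Rabs_right 2), (Rabs_right Y); lra. }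
    assert (2 * K0 * jet z * Y <= 2 * 1 * k2).
    { replace (2 * K0 * jet z * Y) with (2 * (K0 * jet z) * Y) by ring.
      apply Rmult_le_compat; try lra.
      - assert (0 <= K0 * jet z) by (apply Rmult_le_pos; auto using jet_ge0). lra.
      - unfold Y; lra. }
    assert (2 * Rabs lam * Y <= 2 * Rabs lam * k2) by (apply Rmult_le_compat_l; unfold Y; lra).
    lra. }
  assert (HL : 2 * k2 * (N * (Rabs (Re b) / 2)) <= Rabs (2 * (- (N * k2) * Re q))).
  { assert (HN : 0 <= N) by apply pos_INR.
    rewrite !Rabs_mult, Rabs_Ropp, !Rabs_mult, (Rabs_right 2), (Rabs_right N), (Rabs_right k2)
      by lra.
    replace (2 * k2 * (N * (Rabs (Re b) / 2))) with (2 * (N * k2 * (Rabs (Re b) / 2))) by ring.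
    apply Rmult_le_compat_l; [lra|]. apply Rmult_le_compat_l; auto. apply Rmult_le_pos; lra. }
  assert (k2 * (2 * (Rabs lam + 1)) < k2 * (N * Rabs (Re b))) by (apply Rmult_lt_compat_l; lra).
  lra.
Qed.

End Field.

(** * The dichotomy for such fields *)

Lemma is_rderive_RtoC s : is_rderive RtoC s (RtoC 1).
Proof.
apply is_rderive_eps. intros eps He. exists 1. split; [lra|]. intros t _.
replace (RtoC t - RtoC s - RtoC (t - s) * RtoC 1)%C with (RtoC 0) by (rewrite RtoC_minus; ring).
rewrite Cmod_0. apply Rmult_le_pos; [lra | apply Rabs_pos].
Qed.

Lemma is_rderive_rcont f t l : is_rderive f t l -> rcont f t.
Proof.
intros H. apply rcont_eps. intros eps He. assert (Hl := Cmod_ge_0 l).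
destruct (is_rderive_elim _ _ _ H 1) as [d [Hd H1]]; [lra|].
exists (Rmin d (eps / (Cmod l + 2))). split.
{ apply Rmin_case; auto. apply Rdiv_lt_0_compat; lra. }
intros s Hs. destruct (lt_Rmin _ _ _ Hs) as [S1 S2]. apply (Rlt_div_r _ eps) in S2; [|lra].
specialize (H1 s S1).
replace (f s - f t)%C with ((f s - f t - RtoC (s - t) * l) + RtoC (s - t) * l)%C by ring.
eapply Rle_lt_trans; [apply Cmod_triangle|]. rewrite Cmod_mult, Cmod_R.
assert (A := Rabs_pos (s - t)). nra.
Qed.

(** The function [u ^ 2 * exp (- 2 L t)] is nonincreasing and starts at [0]. *)
Lemma gronwall_zero (u du : R -> R) L a : 0 <= L -> u 0 = 0 ->
  (forall s, 0 <= s <= a -> is_derive u s (du s) /\ Rabs (du s) <= L * Rabs (u s)) ->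
  forall s, 0 <= s <= a -> u s = 0.
Proof.
intros HL H0 H s Hs.
set (v := fun t => u t ^ 2 * exp (- (2 * L) * t)).
set (dv := fun t => (2 * u t * du t - 2 * L * u t ^ 2) * exp (- (2 * L) * t)).
assert (Hv : forall t, 0 <= t <= a -> is_derive v t (dv t)).
{ intros t Ht. destruct (H t Ht) as [Hd _]. unfold v, dv.
  assert (E : is_derive (fun t => exp (- (2 * L) * t)) t (- (2 * L) * exp (- (2 * L) * t))).
  { auto_derive; auto. ring. }
  assert (D := is_derive_mult _ _ t _ _ (is_derive_pow _ 2 t _ Hd) E Rmult_comm).
  match type of D with is_derive _ _ ?x => match goal with |- is_derive _ _ ?y =>
    replace y with x; [exact D|] end end.
  unfold plus, mult; simpl. ring. }
destruct (MVT_gen v 0 s dv) as (c & Hc & Heq).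
- intros t. rewrite Rmin_left, Rmax_right by lra. intros Ht. apply Hv; lra.
- intros t. rewrite Rmin_left, Rmax_right by lra. intros Ht.
  apply continuity_pt_filterlim. apply (ex_derive_continuous (V := R_NormedModule)).
  eexists; apply Hv; lra.
- rewrite Rmin_left, Rmax_right in Hc by lra.
  destruct (H c ltac:(lra)) as [_ B]. assert (Hdv : dv c <= 0).
  { unfold dv. assert (0 < exp (- (2 * L) * c)) by apply exp_pos.
    assert (u c * du c <= L * u c ^ 2).
    { eapply Rle_trans; [apply Rle_abs|]. rewrite Rabs_mult.
      apply Rle_trans with (Rabs (u c) * (L * Rabs (u c))).
      - apply Rmult_le_compat_l; auto using Rabs_pos.
      - rewrite <- (pow2_abs (u c)). right. ring. }
    nra. }
  assert (Hv0 : v 0 = 0) by (unfold v; rewrite H0; ring).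
  assert (Hvs : v s <= 0) by nra. unfold v in Hvs.
  assert (0 < exp (- (2 * L) * s)) by apply exp_pos.
  assert (u s ^ 2 <= 0) by nra. nra.
Qed.

Section PropA.
Variables (P Px Py : C -> R) (r0 : R) (HP : flat_isolated P Px Py r0).
Notation dP := (dir_deriv Px Py).
Notation jet := (jet_size P Px Py).

(** With the weight [c - |phi| ^ 2] the differential of [P] becomes proportional to
    that of [|phi| ^ 2], so [P] is critical along the circle through the point. *)
Lemma circle_critical (phi d : C -> C) R1 rho : 0 < R1 -> phi (RtoC 0) = RtoC 0 ->
  (forall z, Cmod z < R1 -> is_cderive phi z (d z) /\ Cmod (d z - 1) <= 1 / 4) -> 0 < rho ->
  exists z, 0 < Cmod z < rho /\ Cmod z < R1 /\ phi z <> RtoC 0 /\ P z <> 0 /\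
    exists Y, 0 < Y /\ forall v, Y * dP z v = P z * Re (Cconj (phi z) * d z * v)%C.
Proof.
intros HR1 Hphi0 Hd Hrho0. assert (Hr0 := fi_pos _ _ _ _ HP).
set (rho1 := Rmin rho (Rmin (R1 / 4) (r0 / 4))).
assert (Hrho : 0 < rho1) by (apply Rmin_case; [lra | apply Rmin_case; lra]).
destruct (le_Rmin rho1 _ _ (Rle_refl _)) as [B1 [B2 B3]%le_Rmin].
assert (Hd' : forall z, Cmod z < R1 -> is_cderive phi z (d z) /\ Cmod (d z - 1) <= Cmod 1 / 4).
{ intros z Hz. rewrite Cmod_1. now apply Hd. }
assert (Hlow : forall z, Cmod z < R1 -> 3 / 4 * Cmod z <= Cmod (phi z)).
{ intros z Hz. assert (L := near_linear phi d 1 R1 Hd' 0 z). rewrite Cmod_0, Cmod_1, Hphi0 in L.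
  specialize (L HR1 Hz). replace (z - 0)%C with z in L by ring.
  replace (phi z - 0)%C with (phi z) in L by ring. lra. }
assert (Hup : forall z, Cmod z < R1 -> Cmod (phi z) <= 5 / 4 * Cmod z).
{ intros z Hz. assert (L := complex_mean_value phi d R1 (5 / 4) 0 z).
  rewrite Cmod_0, Hphi0 in L. replace (z - 0)%C with z in L by ring.
  replace (phi z - 0)%C with (phi z) in L by ring.
  apply L; auto. intros u Hu. destruct (Hd u Hu) as [D1 D2]. split; auto.
  replace (d u) with ((d u - 1) + 1)%C by ring. eapply Rle_trans; [apply Cmod_triangle|].
  rewrite Cmod_1. lra. }
set (c := (3 / 4 * rho1) ^ 2).
assert (Hc : 0 < c) by (apply pow_lt; lra).
destruct (critical_point P Px Py r0 HP (fun z => -1 * Cmod (phi z) ^ 2 + c) rho1 c 0 Hrho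
  ltac:(lra))
  as (z & Hz & HPz & HYz & Hcrit).
- intros z Hz. apply real_cont_Cmod2; [rewrite Rabs_left; lra|].
  eapply is_cderive_ccont. apply Hd. lra.
- lra.
- intros z Hz. assert (Q := pow2_ge_0 (Cmod (phi z))). simpl pow in *. lra.
- intros z Hz. assert (L := Hlow z ltac:(lra)).
  assert (c <= Cmod (phi z) ^ 2); [|lra]. apply pow_incr. lra.
- destruct (nonzero_on_ray P Px Py r0 HP (RtoC 1) (rho1 / 2) Cmod_1 ltac:(lra)) as (t & Ht &
    HPt).
  exists (RtoC t * 1)%C.
  assert (Hm : Cmod (RtoC t * 1) = t) by (rewrite Cmod_mult, Cmod_1, Cmod_R, Rabs_right; lra).
  split; [lra|split; auto]. assert (U := Hup (RtoC t * 1)%C ltac:(lra)). rewrite Hm in U.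
  assert (Cmod (phi (RtoC t * 1)%C) < 3 / 4 * rho1) by lra.
  assert (G := Cmod_ge_0 (phi (RtoC t * 1)%C)).
  unfold c. nra.
- exists z. split; [lra|split; [lra|split]].
  { apply Cmod_gt_0. assert (L := Hlow z ltac:(lra)). lra. }
  split; auto. exists (-1 * Cmod (phi z) ^ 2 + c). split; auto. intros v.
  assert (D : is_derive (fun t => -1 * Cmod (phi (z + RtoC t * v)%C) ^ 2 + c) 0
    (- (2 * Re (Cconj (phi z) * d z * v)%C))).
  { apply (is_derive_ext (fun t => minus c (Cmod (phi (z + RtoC t * v)%C) ^ 2))).
    { intros t. unfold minus, plus, opp; simpl. ring. }
    assert (D := is_derive_minus _ _ 0 _ _ (is_derive_const c 0) (Cmod2_line_derive phi z _ v
      (proj1 (Hd z ltac:(lra))))).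
    match type of D with is_derive _ _ ?x => replace (- (2 * Re (Cconj (phi z) * d z * v)%C))
      with x; [exact D|] end. unfold minus, plus, opp, zero; simpl. ring. }
  assert (H := Hcrit v _ D). lra.
Qed.

Variables (g : C -> C) (R0 M lam K0 dl : R).
Hypotheses (Hg : holo_bounded g R0 M) (HK0 : 0 <= K0) (Hdl : 0 < dl)
  (Hfield : forall z, Cmod z < dl -> Rabs (dP z (g z) + lam * P z) <= K0 * Rabs (P z) * jet z).

(** The integral curve of [g] through [0] is the inverse of a primitive of
    [1 / g]. By Gronwall's inequality [P] vanishes along it, but [0] is isolated. *)
Lemma order0_impossible b K : b <> RtoC 0 -> 0 <= K ->
  (forall w, Cmod w <= R0 / 8 -> Cmod (g w - b) <= K * Cmod w) -> False.
Proof.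
intros Hb HK Hgb. assert (Hbp : 0 < Cmod b) by now apply Cmod_gt_0.
assert (Hr0 := fi_pos _ _ _ _ HP). destruct Hg as [HR Hgd].
set (r := Rmin (R0 / 8) (Cmod b / (8 * (K + 1)))).
assert (Hr : 0 < r) by (apply Rmin_case; [lra | apply Rdiv_lt_0_compat; lra]).
assert (Hr1 : r <= R0 / 8) by apply Rmin_l.
assert (Hr2 : r * (8 * (K + 1)) <= Cmod b) by (apply (Rle_div_r r (Cmod b)); [lra | apply
  Rmin_r]).
assert (Hgb8 : forall z, Cmod z < r -> Cmod (g z - b) <= Cmod b / 8).
{ intros z Hz. eapply Rle_trans; [apply Hgb; lra|]. assert (Z := Cmod_ge_0 z). nra. }
assert (Hglow : forall z, Cmod z < r -> 7 / 8 * Cmod b <= Cmod (g z)).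
{ intros z Hz. assert (T := Cmod_triangle_rev b (- (g z - b))%C). rewrite Cmod_opp in T.
  replace (b - - (g z - b))%C with (g z) in T by ring. specialize (Hgb8 z Hz). lra. }
assert (Hgne : forall z, Cmod z < r -> g z <> RtoC 0).
{ intros z Hz. apply Cmod_gt_0. specialize (Hglow z Hz). lra. }
assert (Hinv : forall z, Cmod z < r -> differentiable_at (fun z => / g z)%C z).
{ intros z Hz. apply diff_inv; [apply Hgd; lra | now apply Hgne]. }
destruct (holo_primitive (fun z => / g z)%C (RtoC 0) r) as (Phi & HPhi0 & HPhi).
{ intros z Hz. now apply diff_ccont, Hinv. }
{ intros z Hz _. now apply Hinv. }
destruct (local_inverse Phi (fun z => / g z)%C (/ b)%C (r / 4)) as (psi & rho & Hrho & Hpsi0 &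
  Hpsi & _).
{ lra. }
{ rewrite Cmod_inv by auto. now apply Rinv_0_lt_compat. }
{ exact HPhi0. }
{ intros z Hz. split; [now apply HPhi|]. assert (Hzr : Cmod z < r) by lra.
  assert (Hgz := Hgne z Hzr).
  replace (/ g z - / b)%C with (- ((g z - b) / (g z * b)))%C by (field; auto).
  rewrite Cmod_opp, Cmod_div, Cmod_mult, Cmod_inv by (auto; now apply Cmult_neq_0).
  assert (L := Hglow z Hzr). assert (U := Hgb8 z Hzr).
  apply (Rle_div_l _ (/ Cmod b / 4)); [apply Rmult_lt_0_compat; lra|].
  replace (/ Cmod b / 4 * (Cmod (g z) * Cmod b)) with (Cmod (g z) / 4) by (field; lra). lra. }
destruct (jet_small P Px Py r0 HP 1) as (dj & Hdj & Hj); [lra|].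
set (a := Rmin (rho / 2) (Rmin dl dj / (2 * (2 * Cmod b)))).
assert (Hmin : 0 < Rmin dl dj) by (apply Rmin_case; lra).
assert (Ha : 0 < a) by (apply Rmin_case; [lra | apply Rdiv_lt_0_compat; lra]).
assert (Ha1 : a <= rho / 2) by apply Rmin_l.
assert (Ha2 : a * (2 * (2 * Cmod b)) <= Rmin dl dj).
{ apply (Rle_div_r a); [lra|]. apply Rmin_r. }
assert (M1 : Rmin dl dj <= dl) by apply Rmin_l. assert (M2 : Rmin dl dj <= dj) by apply Rmin_r.
set (gam := fun s => psi (RtoC s)).
assert (Hs : forall s, 0 <= s <= a -> Cmod (RtoC s) < rho) by (intros s Hs; rewrite
  Cmod_RtoC_pos; lra).
assert (Hgm : forall s, 0 <= s <= a -> Cmod (gam s) < r /\ Cmod (gam s) < dl /\ Cmod (gam s) <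
  dj).
{ intros s Hs0. destruct (Hpsi (RtoC s) (Hs s Hs0)) as (A1 & A2 & A3 & A4). fold (gam s) in *.
  rewrite Cmod_inv, Cmod_RtoC_pos in A3 by (auto; lra).
  assert (Cmod (gam s) <= 4 / 3 * Cmod b * s).
  { apply (Rmult_le_reg_l (3 / 4 * / Cmod b)).
    - apply Rmult_lt_0_compat; [lra | now apply Rinv_0_lt_compat].
    - eapply Rle_trans; [exact A3|]. right. field. lra. }
  assert (Cmod b * s <= Cmod b * a) by (apply Rmult_le_compat_l; lra).
  assert (0 < Cmod b * a) by now apply Rmult_lt_0_compat.
  split; [lra|split; lra]. }
assert (Hgd' : forall s, 0 <= s <= a -> is_rderive gam s (g (gam s))).
{ intros s Hs0. destruct (Hpsi (RtoC s) (Hs s Hs0)) as (A1 & A2 & A3 & A4). fold (gam s) in *.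
  assert (Hgz : g (gam s) <> RtoC 0) by (apply Hgne; lra).
  replace (g (gam s)) with (/ (/ g (gam s)) * RtoC 1)%C by (field; auto).
  exact (is_rderive_comp psi RtoC s _ _ A4 (is_rderive_RtoC s)). }
assert (HL : 0 <= Rabs lam + K0) by (assert (A := Rabs_pos lam); lra).
assert (Hg0 : gam 0 = RtoC 0) by exact Hpsi0.
assert (HZ : forall s, 0 <= s <= a -> P (gam s) = 0).
{ apply (gronwall_zero (fun s => P (gam s)) (fun s => dP (gam s) (g (gam s))) _ a HL).
  - rewrite Hg0. apply (P_0 P Px Py r0 HP).
  - intros s Hs0. destruct (Hgm s Hs0) as (G1 & G2 & G3). split.
    + apply (P_chain P Px Py r0 HP gam s); [lra | now apply Hgd'].
    + assert (Fd := Hfield (gam s) G2). specialize (Hj _ G3).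
      replace (dP (gam s) (g (gam s))) with ((dP (gam s) (g (gam s)) + lam * P (gam s)) + - (lam
        * P (gam s))) by ring.
      eapply Rle_trans; [apply Rabs_triang|]. rewrite Rabs_Ropp, Rabs_mult.
      assert (Rabs (P (gam s)) * jet (gam s) <= Rabs (P (gam s)) * 1) by (apply
        Rmult_le_compat_l; [apply Rabs_pos | lra]).
      assert (K0 * (Rabs (P (gam s)) * jet (gam s)) <= K0 * (Rabs (P (gam s)) * 1)) by (apply
        Rmult_le_compat_l; lra).
      lra. }
assert (Z : gam a = RtoC 0).
{ apply (fi_isolated _ _ _ _ HP gam a Ha Hg0); [|lra]. intros t Ht.
  destruct (Hgm t Ht) as (G1 & G2 & G3). split; [|split; [lra | now apply HZ]].
  eapply is_rderive_rcont. now apply Hgd'. }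
destruct (Hpsi (RtoC a) (Hs a ltac:(lra))) as (_ & A2 & _). unfold gam in Z.
rewrite Z, HPhi0 in A2.
apply RtoC_inj in A2. lra.
Qed.

(** The infinitesimal form of the theorem. The order of vanishing of [g] decides
    which argument applies, and in the two remaining cases points with
    [dP (g) = 0] show that the rate [lam] vanishes. *)
Lemma field_dichotomy : lam = 0 /\
  ((forall w, Cmod w <= R0 / 8 -> g w = RtoC 0) \/
   exists beta K, beta <> 0 /\ 0 <= K /\
     forall w, Cmod w <= R0 / 8 -> Cmod (g w - Ci * RtoC beta * w) <= K * Cmod w ^ 2).
Proof.
assert (HR : 0 < R0) by apply Hg. assert (Hr0 := fi_pos _ _ _ _ HP).
(* At such points the equation reads [|lam| * |P| <= K0 * |P| * jet], and [jet] tends to [0]. *)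
assert (Hlam : (forall rho, 0 < rho -> exists z, Cmod z < rho /\ P z <> 0 /\ dP z (g z) = 0) ->
  lam = 0).
{ intros H. destruct (Req_dec lam 0) as [|Hne]; auto. exfalso.
  assert (Hl : 0 < Rabs lam) by now apply Rabs_pos_lt.
  destruct (jet_small P Px Py r0 HP (Rabs lam / (K0 + 1))) as (dj & Hdj & Hj); [apply
    Rdiv_lt_0_compat; lra|].
  destruct (H (Rmin dl dj)) as (z & Hz & HPz & HdP); [apply Rmin_case; lra|].
  destruct (lt_Rmin _ _ _ Hz) as [Z1 Z2].
  specialize (Hj z Z2). apply (Rlt_div_r _ (Rabs lam)) in Hj; [|lra].
  assert (Fd := Hfield z Z1). rewrite HdP, Rplus_0_l, Rabs_mult in Fd.
  assert (HPp : 0 < Rabs (P z)) by now apply Rabs_pos_lt.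
  assert (J := jet_ge0 P Px Py z).
  assert (Rabs (P z) * (K0 * jet z) < Rabs (P z) * Rabs lam) by (apply Rmult_lt_compat_l; lra).
  lra. }
destruct (holo_order g R0 M Hg) as [Hz|(m & b & K & Hb & HK & Hgb)].
- split; auto. apply Hlam. intros rho Hrho.
  destruct (nonzero_on_ray P Px Py r0 HP (RtoC 1) (Rmin rho (R0 / 8)) Cmod_1) as (t & Ht & HPt);
    [apply Rmin_case; lra|].
  destruct (lt_Rmin _ _ _ (proj2 Ht)) as [T1 T2].
  assert (Hm : Cmod (RtoC t * 1) = t) by (rewrite Cmod_mult, Cmod_1, Cmod_R, Rabs_right; lra).
  exists (RtoC t * 1)%C. split; [lra|split; auto]. rewrite Hz by lra.
  unfold dir_deriv, Re, Im; simpl. ring.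
- destruct m as [|[|m]].
  + exfalso. apply (order0_impossible b K Hb HK). intros w Hw.
    replace (g w - b)%C with (g w - b * w ^ 0)%C by (simpl; ring).
    rewrite <- (pow_1 (Cmod w)). now apply Hgb.
  + assert (Hgb' : forall w, Cmod w <= R0 / 8 -> Cmod (g w - b * w) <= K * Cmod w ^ 2).
    { intros w Hw. rewrite <- (Cpow_1_r w) at 2. now apply Hgb. }
    assert (Hre := order1_real_part P Px Py r0 HP g R0 M lam K0 dl Hg HK0 Hdl Hfield b K HK
      Hgb').
    assert (Eb : b = (Ci * RtoC (Im b))%C).
    { apply injective_projections; simpl; unfold Re, Im in *; lra. }
    assert (Hbeta : Im b <> 0). { intros E. apply Hb. rewrite Eb, E. ring. }
    split.
    2:{ right. exists (Im b), K. split; [|split]; auto. intros w Hw. rewrite <- Eb.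
    now apply Hgb'. }
    destruct (linearization g R0 M b K Hg Hb Hgb') as (phi & d & R1 & HR1 & Hphi0 & Hphi).
    apply Hlam. intros rho Hrho.
    destruct (circle_critical phi d R1 rho HR1 Hphi0) as (z & Hz & Hz1 & Hphiz & HPz & Y & HY &
      Hc); auto.
    { intros z Hz. destruct (Hphi z Hz) as (A1 & A2 & A3). auto. }
    exists z. split; [lra|split; auto].
    specialize (Hc (g z)). destruct (Hphi z Hz1) as (A1 & A2 & A3).
    replace (Cconj (phi z) * d z * g z)%C with (b * (phi z * Cconj (phi z)))%C in Hc.
    2:{ rewrite <- Cmult_assoc, A2. ring. }
    rewrite <- Cmod2_conj, re_scal_r, Hre in Hc.
    apply (Rmult_eq_reg_l Y); lra.
  + exfalso. exact (order_ge2_impossible P Px Py r0 HP g R0 M lam K0 dl Hg HK0 Hdl Hfield m b K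
      Hb HK Hgb).
Qed.

End PropA.

(** * Smooth functions of two real variables *)

Lemma partial_derive_dx f p q :
  locally_2d (fun x y => ex_diff_n f (S q) x y) 0 0 ->
  partial_derive p q (fun x y => Derive (fun t => f t y) x) 0 0 = partial_derive (S p) q f 0 0.
Proof.
intros H. replace (S p) with (p + 1)%nat by lia. rewrite <- (Nat.add_0_l q) at 2.
rewrite <- partial_derive_add_zero by auto.
unfold partial_derive at 1 2. simpl Derive_n at 3. apply Derive_n_ext_loc.
assert (H2 : locally_2d (fun u v => locally_2d (ex_diff_n f (S q)) u v) 0 0).
{ destruct H as [e He]. exists (mkposreal (e / 2) (is_pos_div_2 e)). simpl. intros u v Hu Hv.
  exists (mkposreal (e / 2) (is_pos_div_2 e)). simpl. intros u' v' Hu' Hv'. apply He.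
  - replace (u' - 0) with ((u' - u) + (u - 0)) by ring.
    eapply Rle_lt_trans; [apply Rabs_triang | lra].
  - replace (v' - 0) with ((v' - v) + (v - 0)) by ring.
    eapply Rle_lt_trans; [apply Rabs_triang | lra]. }
apply locally_2d_1d_const_y in H2. revert H2. apply filter_imp. intros t Ht.
symmetry. exact (Derive_partial_derive_aux1 q f t 0 Ht).
Qed.

Lemma DL_pol_zero n f dx dy : (forall p q, partial_derive p q f 0 0 = 0) ->
  DL_pol n f 0 0 dx dy = 0.
Proof.
intros H. unfold DL_pol.
assert (Hs : forall F m, (forall i, (i <= m)%nat -> F i = 0) -> sum_f_R0 F m = 0).
{ intros F m. induction m as [|m IH]; intros HF; simpl; [now apply HF|].
  rewrite IH, HF by auto. ring. }
apply Hs. intros i _. unfold differential. rewrite Hs; [unfold Rdiv; ring|].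
intros j _. rewrite H. ring.
Qed.

(** Taylor's formula with all coefficients zero. *)
Lemma flat_of_zero_jet f n : locally_2d (fun x y => ex_diff_n f (S n) x y) 0 0 ->
  (forall p q, partial_derive p q f 0 0 = 0) ->
  exists K d, 0 < d /\ forall z : C, Cmod z < d -> Rabs (f (fst z) (snd z)) <= K * Cmod z ^ S n.
Proof.
intros Hf H0. destruct (Taylor_Lagrange_2d f n 0 0 Hf) as [D [e He]].
exists (Rabs D), e. split; [apply cond_pos|]. intros z Hz.
assert (A1 := fst_le_Cmod z). assert (A2 := snd_le_Cmod z).
specialize (He (fst z) (snd z)). rewrite !Rminus_0_r, DL_pol_zero, Rminus_0_r in He by auto.
eapply Rle_trans; [apply He; lra|].
apply Rle_trans with (Rabs D * Rmax (Rabs (fst z)) (Rabs (snd z)) ^ S n).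
- apply Rmult_le_compat_r; [|apply Rle_abs]. apply pow_le.
  eapply Rle_trans; [apply Rabs_pos | apply Rmax_l].
- apply Rmult_le_compat_l; [apply Rabs_pos|]. apply pow_incr. split.
  + eapply Rle_trans; [apply Rabs_pos | apply Rmax_l].
  + now apply Rmax_lub.
Qed.

Lemma differentiable_of_C1 f x y : locally_2d (fun x y => ex_diff_n f 1 x y) x y ->
  differentiable_pt_lim f x y (Derive (fun t => f t y) x) (Derive (fun t => f x t) y).
Proof.
intros H. apply filterdiff_differentiable_pt_lim.
assert (H0 := locally_2d_singleton _ _ _ H). destruct H0 as (_ & Hx & Hy & Hcx & _).
apply (is_derive_filterdiff f x y (fun u v => Derive (fun t => f t v) u)).
- apply (locally_2d_locally (fun u v => is_derive (fun z : R_AbsRing => f z v) u (Derive (fun t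
    => f t v) u))).
  revert H. apply locally_2d_impl, locally_2d_forall. intros u v (_ & Hu & _).
  now apply Derive_correct.
- now apply Derive_correct.
- simpl in Hcx. destruct Hcx as [Hcx _]. apply (continuity_2d_pt_filterlim (fun u v => Derive
    (fun t => f t v) u)) in Hcx. exact Hcx.
Qed.

(** * Connectedness of curves *)

(** The supremum of the parameters for which the curve is in [V] lies in [V] or in
    [W]; either way a common point is found next to it. *)
Lemma curve_separation (gam : R -> C) (V W : C -> Prop) s1 s2 : s1 <= s2 ->
  @open C_UniformSpace V -> @open C_UniformSpace W ->
  (forall s, s1 <= s <= s2 -> rcont gam s) ->
  (forall s, s1 <= s <= s2 -> V (gam s) \/ W (gam s)) ->
  V (gam s1) -> W (gam s2) -> exists s, s1 <= s <= s2 /\ V (gam s) /\ W (gam s).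
Proof.
intros Hs HV HW Hc Hcov H1 H2.
destruct (completeness (fun s => s1 <= s <= s2 /\ V (gam s))) as [sg [Hub Hlub]].
{ exists s2. intros s [Hs' _]. lra. }
{ exists s1. split; auto. lra. }
assert (Hsg : s1 <= sg <= s2).
{ split; [apply Hub; split; auto; lra | apply Hlub; intros s [Hs' _]; lra]. }
destruct (Hcov sg Hsg) as [Hv|Hw].
- destruct (Hc sg Hsg V (HV _ Hv)) as [e He].
  destruct (Rle_lt_or_eq_dec sg s2 ltac:(lra)) as [Hlt|Heq]; [|subst; eauto].
  exfalso. set (s := Rmin s2 (sg + e / 2)). assert (Hep := cond_pos e).
  assert (Hs1 : sg < s) by (apply Rmin_case; lra). assert (Hs2 : s <= s2) by apply Rmin_l.
  assert (Hs3 : s <= sg + e / 2) by apply Rmin_r.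
  assert (HVs : V (gam s)).
  { apply He. change (Rabs (s - sg) < e). rewrite Rabs_right; lra. }
  assert (s <= sg) by (apply Hub; split; auto; lra). lra.
- destruct (Hc sg Hsg W (HW _ Hw)) as [e He].
  assert (Hep := cond_pos e).
  assert (Hex : exists s, (s1 <= s <= s2 /\ V (gam s)) /\ sg - e < s).
  { apply NNPP. intros N. assert (sg <= sg - e); [|lra]. apply Hlub. intros s Hs'.
    apply Rnot_lt_le. intros L. apply N; eauto. }
  destruct Hex as (s & [Hs' HVs] & Hlt). exists s. split; auto. split; auto.
  apply He. change (Rabs (s - sg) < e).
  assert (s <= sg) by (apply Hub; split; auto). rewrite Rabs_left1; lra.
Qed.

Lemma connected_curve (gam : R -> C) a : (forall s, 0 <= s <= a -> rcont gam s) ->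
  @connected C_UniformSpace (fun z => exists s, 0 <= s <= a /\ z = gam s).
Proof.
intros Hc V W HV HW Hcov [x [[s1 [Hs1 ->]] H1]] [y [[s2 [Hs2 ->]] H2]].
assert (Hcov' : forall s, 0 <= s <= a -> V (gam s) \/ W (gam s)) by (intros s Hs; apply Hcov;
  eauto).
destruct (Rle_dec s1 s2) as [L|L].
- destruct (curve_separation gam V W s1 s2) as (s & Hs & A1 & A2); auto.
  { intros s Hs; apply Hc; lra. }
  { intros s Hs; apply Hcov'; lra. }
  exists (gam s). split; auto. exists s. split; auto; lra.
- destruct (curve_separation gam W V s2 s1) as (s & Hs & A1 & A2); auto; try lra.
  { intros s Hs; apply Hc; lra. }
  { intros s Hs. destruct (Hcov' s); [lra | auto | auto]. }
  exists (gam s). split; auto. exists s. split; auto; lra.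
Qed.

Definition deriv_x (P : C -> R) (z : C) : R := Derive (fun x => P (x, Im z)) (Re z).
Definition deriv_y (P : C -> R) (z : C) : R := Derive (fun y => P (Re z, y)) (Im z).

Lemma flat_isolated_intro (U : C -> Prop) (P : C -> R)
    (hU : open U) (hU0 : U (RtoC 0)) (hP : smooth_on U P)
    (hi : forall z : C,
      connected_component (fun w : C => U w /\ P w = 0) (RtoC 0) z
      <-> z = RtoC 0)
    (hii : vanishes_to_infinite_order P) :
  exists r0, flat_isolated P (deriv_x P) (deriv_y P) r0.
Proof.
destruct (hU _ hU0) as [r HU].
assert (Hball : forall x y : R, Rabs x < r -> Rabs y < r -> U (x, y)).
{ intros x y Hx Hy. apply HU. split; [change (Rabs (x - 0) < r) | change (Rabs (y - 0) < r)];
  now rewrite Rminus_0_r. }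
set (f := fun x y => P (x, y)).
assert (Hsm : forall n x y, Rabs x < r -> Rabs y < r -> ex_diff_n f n x y).
{ intros n x y Hx Hy. exact (hP n (x, y) (Hball x y Hx Hy)). }
assert (Hloc : forall n, locally_2d (fun x y => ex_diff_n f n x y) 0 0).
{ intros n. exists r. intros u v. rewrite !Rminus_0_r. apply Hsm. }
exists r. split.
- apply cond_pos.
- intros [x y] Hz. assert (A1 := fst_le_Cmod (x, y)). assert (A2 := snd_le_Cmod (x, y)).
  simpl in A1, A2.
  apply (differentiable_of_C1 f x y). set (s := r - Cmod (x, y)).
  assert (Hs : 0 < s) by (unfold s; lra).
  exists (mkposreal s Hs). intros u v Hu Hv. simpl in Hu, Hv. apply Hsm.
  + replace u with ((u - x) + x) by ring. eapply Rle_lt_trans; [apply Rabs_triang|].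
    unfold s in *; lra.
  + replace v with ((v - y) + y) by ring. eapply Rle_lt_trans; [apply Rabs_triang|].
    unfold s in *; lra.
- intros n.
  destruct (flat_of_zero_jet f n (Hloc _) hii) as (K1 & d1 & D1 & H1).
  destruct (flat_of_zero_jet (fun x y => Derive (fun t => f t y) x) n) as (K2 & d2 & D2 & H2).
  { generalize (Hloc (S (S n))). apply locally_2d_impl, locally_2d_forall. intros u v.
    apply ex_diff_n_deriv_aux1. }
  { intros p q. rewrite partial_derive_dx by apply Hloc. apply hii. }
  destruct (flat_of_zero_jet (fun x y => Derive (fun t => f x t) y) n) as (K3 & d3 & D3 & H3).
  { generalize (Hloc (S (S n))). apply locally_2d_impl, locally_2d_forall. intros u v.
    apply ex_diff_n_deriv_aux2. }
  { intros p q. transitivity (partial_derive p q (partial_derive 0 1 f) 0 0); [reflexivity|].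
    rewrite partial_derive_add_zero by auto. apply hii. }
  exists (Rabs (K1 + K2 + K3)), (Rmin 1 (Rmin d1 (Rmin d2 d3))).
  split; [repeat apply Rmin_case; lra|].
  intros z Hz.
  destruct (lt_Rmin _ _ _ Hz) as [Z0 [Z1 [Z2 Z3]%lt_Rmin]%lt_Rmin].
  specialize (H1 z Z1). specialize (H2 z Z2). specialize (H3 z Z3).
  replace (f (fst z) (snd z)) with (P z) in H1 by (destruct z; reflexivity).
  change (Derive (fun t => f t (snd z)) (fst z)) with (deriv_x P z) in H2.
  change (Derive (fun t => f (fst z) t) (snd z)) with (deriv_y P z) in H3.
  assert (HZ := Cmod_ge_0 z). assert (Hp : 0 <= Cmod z ^ n) by now apply pow_le.
  simpl in H1, H2, H3.
  assert (Q : Rabs (P z) + Rabs (deriv_x P z) + Rabs (deriv_y P z) <= (K1 + K2 + K3) * (Cmod z *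
    Cmod z ^ n)) by lra.
  eapply Rle_trans; [exact Q|]. assert (HA := Rle_abs (K1 + K2 + K3)).
  apply Rle_trans with (Rabs (K1 + K2 + K3) * (Cmod z * Cmod z ^ n)).
  { apply Rmult_le_compat_r; auto. now apply Rmult_le_pos. }
  apply Rmult_le_compat_l; [apply Rabs_pos|]. nra.
- intros gam a Ha H0 Hg t Ht. apply hi.
  exists (fun z => exists s, 0 <= s <= a /\ z = gam s). split; [|split; [|split]].
  + intros z (s & Hs & ->). destruct (Hg s Hs) as (_ & Hr & HPs). split; auto.
    assert (A1 := fst_le_Cmod (gam s)). assert (A2 := snd_le_Cmod (gam s)).
    rewrite (surjective_pairing (gam s)). apply Hball; lra.
  + apply connected_curve. intros s Hs. now apply Hg.
  + exists 0. split; [lra | auto].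
  + exists t. auto.
Qed.

(** * Slices of holomorphic maps of two variables *)

Lemma locally_origin2_elim (Q : C * C -> Prop) : locally origin2 Q ->
  exists r, 0 < r /\ forall z1 z2, Cmod z1 < r -> Cmod z2 < r -> Q (z1, z2).
Proof.
intros [e He]. exists e. split; [apply cond_pos|]. intros z1 z2 H1 H2. apply He.
assert (A1 := fst_le_Cmod z1). assert (A2 := snd_le_Cmod z1).
assert (A3 := fst_le_Cmod z2). assert (A4 := snd_le_Cmod z2).
split; split; [change (Rabs (fst z1 - 0) < e) | change (Rabs (snd z1 - 0) < e) |
  change (Rabs (fst z2 - 0) < e) | change (Rabs (snd z2 - 0) < e)]; rewrite Rminus_0_r; lra.
Qed.

Lemma locally_origin2_intro (Q : C * C -> Prop) r : 0 < r ->
  (forall z1 z2, Cmod z1 < r -> Cmod z2 < r -> Q (z1, z2)) -> locally origin2 Q.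
Proof.
intros Hr H. assert (Hr2 : 0 < r / 2) by lra. exists (mkposreal _ Hr2).
intros [z1 z2] [[B1 B2] [B3 B4]].
change (Rabs (fst z1 - 0) < r / 2) in B1. change (Rabs (snd z1 - 0) < r / 2) in B2.
change (Rabs (fst z2 - 0) < r / 2) in B3. change (Rabs (snd z2 - 0) < r / 2) in B4.
rewrite Rminus_0_r in *. apply H; (eapply Rle_lt_trans; [apply Cmod_le_abs | lra]).
Qed.

Lemma locally_origin_intro (Q : C -> Prop) r : 0 < r ->
  (forall z, Cmod z < r -> Q z) -> @locally C_UniformSpace (RtoC 0) Q.
Proof.
intros Hr H. apply (locally_C (RtoC 0)), locally_C_eps. exists r; split; auto.
intros w Hw. apply H. now replace (w - 0)%C with w in Hw by ring.
Qed.

Definition norm2 (v : C * C) : R := @norm C_AbsRing C2 v.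

Lemma norm2_bounds (v : C * C) : Cmod (fst v) <= norm2 v /\ Cmod (snd v) <= norm2 v /\
  norm2 v <= Cmod (fst v) + Cmod (snd v).
Proof.
assert (E : norm2 v = sqrt (Cmod (fst v) ^ 2 + Cmod (snd v) ^ 2)) by reflexivity.
assert (H1 := Cmod_ge_0 (fst v)). assert (H2 := Cmod_ge_0 (snd v)). rewrite E.
repeat split.
- rewrite <- (sqrt_pow2 (Cmod (fst v))) at 1 by auto. apply sqrt_le_1_alt. nra.
- rewrite <- (sqrt_pow2 (Cmod (snd v))) at 1 by auto. apply sqrt_le_1_alt. nra.
- rewrite <- (sqrt_pow2 (Cmod (fst v) + Cmod (snd v))) by lra. apply sqrt_le_1_alt. nra.
Qed.

Lemma filterdiff2_eps (H : C * C -> C * C) (z : C * C) :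
  @ex_filterdiff C_AbsRing C2 C2 H (locally z) ->
  exists L : C * C -> C * C, @is_linear C_AbsRing C2 C2 L /\
    forall eps, 0 < eps -> exists d, 0 < d /\
      forall y1 y2, Cmod (y1 - fst z) < d -> Cmod (y2 - snd z) < d ->
       norm2 (@minus C2 (@minus C2 (H (y1, y2)) (H z)) (L (@minus C2 (y1, y2) z)))
         <= eps * norm2 (@minus C2 (y1, y2) z).
Proof.
intros [L [HL Hd]]. exists L. split; auto. intros eps He.
destruct (Hd z (fun P HP => HP) (mkposreal eps He)) as [d Hdd].
exists d. split; [apply cond_pos|]. intros y1 y2 H1 H2. apply Hdd.
split; apply C_NormedModule_mixin_compat1; assumption.
Qed.

Lemma partial_differentiable (H : C * C -> C * C) (z1 z2 : C) :
  @ex_filterdiff C_AbsRing C2 C2 H (locally (z1, z2)) ->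
  differentiable_at (fun z => fst (H (z, z2))) z1 /\
  differentiable_at (fun z => snd (H (z, z2))) z1 /\
  differentiable_at (fun z => fst (H (z1, z))) z2 /\
  differentiable_at (fun z => snd (H (z1, z))) z2.
Proof.
intros Hd. destruct (filterdiff2_eps H (z1, z2) Hd) as (L & HL & HLd).
assert (E1 : forall h, L (h, RtoC 0) = ((h * fst (L (RtoC 1, RtoC 0)))%C, (h * snd (L (RtoC 1,
  RtoC 0)))%C)).
{ intros h. assert (S := linear_scal _ HL h (RtoC 1, RtoC 0)).
  transitivity (L (@scal _ C2 h (RtoC 1, RtoC 0))); [f_equal | exact S].
  apply injective_projections; [change (h = (h * 1)%C) | change (RtoC 0 = (h * 0)%C)]; ring. }
assert (E2 : forall h, L (RtoC 0, h) = ((h * fst (L (RtoC 0, RtoC 1)))%C, (h * snd (L (RtoC 0,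
  RtoC 1)))%C)).
{ intros h. assert (S := linear_scal _ HL h (RtoC 0, RtoC 1)).
  transitivity (L (@scal _ C2 h (RtoC 0, RtoC 1))); [f_equal | exact S].
  apply injective_projections; [change (RtoC 0 = (h * 0)%C) | change (h = (h * 1)%C)]; ring. }
assert (D1 : forall eps, 0 < eps -> exists d, 0 < d /\ forall w, Cmod (w - z1) < d ->
   Cmod (fst (H (w, z2)) - fst (H (z1, z2)) - fst (L (RtoC 1, RtoC 0)) * (w - z1)) <= eps * Cmod
     (w - z1) /\
   Cmod (snd (H (w, z2)) - snd (H (z1, z2)) - snd (L (RtoC 1, RtoC 0)) * (w - z1)) <= eps * Cmod
     (w - z1)).
{ intros eps He. destruct (HLd eps He) as (d & Hdp & Hw). exists d. split; auto. intros w Hwd.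
  specialize (Hw w z2 Hwd). simpl fst in Hw; simpl snd in Hw.
  replace (z2 - z2)%C with (RtoC 0) in Hw by ring. rewrite Cmod_0 in Hw. specialize (Hw Hdp).
  replace (@minus C2 (w, z2) (z1, z2)) with (((w - z1)%C, RtoC 0) : C * C) in Hw.
  2:{ apply injective_projections; [reflexivity | change (RtoC 0 = (z2 - z2)%C); ring]. }
  rewrite E1 in Hw.
  destruct (norm2_bounds ((w - z1)%C, RtoC 0)) as (_ & _ & N). simpl in N.
  rewrite Cmod_0, Rplus_0_r in N.
  assert (HE : eps * norm2 ((w - z1)%C, RtoC 0) <= eps * Cmod (w - z1)) by (apply
    Rmult_le_compat_l; lra).
  assert (Hw' := Rle_trans _ _ _ Hw HE).
  match type of Hw' with norm2 ?v <= _ => destruct (norm2_bounds v) as (N1 & N2 & _) end.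
  rewrite (Cmult_comm (fst (L _))), (Cmult_comm (snd (L _))).
  split; [exact (Rle_trans _ _ _ N1 Hw') | exact (Rle_trans _ _ _ N2 Hw')]. }
assert (D2 : forall eps, 0 < eps -> exists d, 0 < d /\ forall w, Cmod (w - z2) < d ->
   Cmod (fst (H (z1, w)) - fst (H (z1, z2)) - fst (L (RtoC 0, RtoC 1)) * (w - z2)) <= eps * Cmod
     (w - z2) /\
   Cmod (snd (H (z1, w)) - snd (H (z1, z2)) - snd (L (RtoC 0, RtoC 1)) * (w - z2)) <= eps * Cmod
     (w - z2)).
{ intros eps He. destruct (HLd eps He) as (d & Hdp & Hw). exists d. split; auto. intros w Hwd.
  specialize (Hw z1 w). simpl fst in Hw; simpl snd in Hw.
  replace (z1 - z1)%C with (RtoC 0) in Hw by ring. rewrite Cmod_0 in Hw.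
  specialize (Hw Hdp Hwd).
  replace (@minus C2 (z1, w) (z1, z2)) with ((RtoC 0, (w - z2)%C) : C * C) in Hw.
  2:{ apply injective_projections; [change (RtoC 0 = (z1 - z1)%C); ring | reflexivity]. }
  rewrite E2 in Hw.
  destruct (norm2_bounds (RtoC 0, (w - z2)%C)) as (_ & _ & N). simpl in N.
  rewrite Cmod_0, Rplus_0_l in N.
  assert (HE : eps * norm2 (RtoC 0, (w - z2)%C) <= eps * Cmod (w - z2)) by (apply
    Rmult_le_compat_l; lra).
  assert (Hw' := Rle_trans _ _ _ Hw HE).
  match type of Hw' with norm2 ?v <= _ => destruct (norm2_bounds v) as (N1 & N2 & _) end.
  rewrite (Cmult_comm (fst (L _))), (Cmult_comm (snd (L _))).
  split; [exact (Rle_trans _ _ _ N1 Hw') | exact (Rle_trans _ _ _ N2 Hw')]. }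
split; [|split; [|split]].
- exists (fst (L (RtoC 1, RtoC 0))). apply is_cderive_eps. intros eps He.
  destruct (D1 eps He) as (d & Hdp & Hw). exists d; split; auto. intros w Hwd. apply (Hw w Hwd).
- exists (snd (L (RtoC 1, RtoC 0))). apply is_cderive_eps. intros eps He.
  destruct (D1 eps He) as (d & Hdp & Hw). exists d; split; auto. intros w Hwd. apply (Hw w Hwd).
- exists (fst (L (RtoC 0, RtoC 1))). apply is_cderive_eps. intros eps He.
  destruct (D2 eps He) as (d & Hdp & Hw). exists d; split; auto. intros w Hwd. apply (Hw w Hwd).
- exists (snd (L (RtoC 0, RtoC 1))). apply is_cderive_eps. intros eps He.
  destruct (D2 eps He) as (d & Hdp & Hw). exists d; split; auto. intros w Hwd. apply (Hw w Hwd).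
Qed.

Lemma locally_bounded (H : C * C -> C * C) :
  @ex_filterdiff C_AbsRing C2 C2 H (locally origin2) ->
  exists r M, 0 < r /\ forall z1 z2, Cmod z1 < r -> Cmod z2 < r ->
    Cmod (fst (H (z1, z2))) <= M /\ Cmod (snd (H (z1, z2))) <= M.
Proof.
intros Hd. destruct (filterdiff2_eps H origin2 Hd) as (L & HL & HLd).
destruct (linear_norm _ HL) as (ML & HML & HLn).
destruct (HLd 1 ltac:(lra)) as (d & Hdp & Hw).
exists (Rmin d 1), (norm2 (H origin2) + (ML + 1) * 2). split; [apply Rmin_case; lra|].
intros z1 z2 H1 H2.
destruct (lt_Rmin _ _ _ H1) as [A1 A2].
destruct (lt_Rmin _ _ _ H2) as [A3 A4].
specialize (Hw z1 z2). simpl fst in Hw; simpl snd in Hw.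
replace (z1 - 0)%C with z1 in Hw by ring. replace (z2 - 0)%C with z2 in Hw by ring.
specialize (Hw A1 A3).
replace (@minus C2 (z1, z2) origin2) with ((z1, z2) : C * C) in Hw.
2:{ apply injective_projections; [change (z1 = (z1 - 0)%C) | change (z2 = (z2 - 0)%C)]; ring. }
assert (HLn' : norm2 (L (z1, z2)) <= ML * norm2 (z1, z2)) by exact (HLn (z1, z2)).
assert (N : norm2 (z1, z2) <= Cmod z1 + Cmod z2) by apply (norm2_bounds (z1, z2)).
set (D := @minus C2 (@minus C2 (H (z1, z2)) (H origin2)) (L (z1, z2))).
assert (Hw' : norm2 D <= 1 * norm2 (z1, z2)) by exact Hw.
destruct (norm2_bounds D) as (D1 & D2 & _).
destruct (norm2_bounds (L (z1, z2))) as (L1 & L2 & _).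
destruct (norm2_bounds (H origin2)) as (O1 & O2 & _).
assert (F1 : fst (H (z1, z2)) = (fst D + fst (L (z1, z2)) + fst (H origin2))%C).
{ change (fst D) with (fst (H (z1, z2)) - fst (H origin2) - fst (L (z1, z2)))%C. ring. }
assert (F2 : snd (H (z1, z2)) = (snd D + snd (L (z1, z2)) + snd (H origin2))%C).
{ change (snd D) with (snd (H (z1, z2)) - snd (H origin2) - snd (L (z1, z2)))%C. ring. }
assert (ML * norm2 (z1, z2) <= ML * 2) by (apply Rmult_le_compat_l; lra).
assert (HD2 : norm2 D <= 2) by (apply (Rle_trans _ _ _ Hw'); lra).
assert (HL2 : norm2 (L (z1, z2)) <= ML * 2) by lra.
rewrite F1, F2. split; (eapply Rle_trans; [apply Cmod_triangle|];
  eapply Rle_trans; [apply Rplus_le_compat_r, Cmod_triangle|];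
  apply Rle_trans with (2 + ML * 2 + norm2 (H origin2)); [|lra];
  apply Rplus_le_compat; [apply Rplus_le_compat|]).
- exact (Rle_trans _ _ _ D1 HD2).
- exact (Rle_trans _ _ _ L1 HL2).
- exact O1.
- exact (Rle_trans _ _ _ D2 HD2).
- exact (Rle_trans _ _ _ L2 HL2).
- exact O2.
Qed.

(** * Second order expansions and the imaginary axis *)

Lemma holo_bounded_shift k r M c : holo_bounded k r M -> Cmod c <= r / 2 -> holo_bounded (fun z
  => k (c + z)%C) (r / 2) M.
Proof.
intros [Hr H] Hc. split; [lra|]. intros z Hz.
assert (Hcz : Cmod (c + z) < r) by (eapply Rle_lt_trans; [apply Cmod_triangle | lra]).
destruct (H _ Hcz) as [H1 H2]. split; auto.
apply (diff_comp k (fun z => c + z)%C); auto.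
apply diff_plus; [apply diff_const | apply diff_id].
Qed.

Lemma holo_bounded_lin f g r M1 M2 (a b : C) : holo_bounded f r M1 -> holo_bounded g r M2 ->
  holo_bounded (fun z => a * f z + b * g z)%C r (Cmod a * M1 + Cmod b * M2).
Proof.
intros [Hr Hf] [_ Hg]. split; auto. intros z Hz.
destruct (Hf z Hz) as [F1 F2]. destruct (Hg z Hz) as [G1 G2]. split.
- apply diff_plus; apply diff_mult; auto using diff_const.
- eapply Rle_trans; [apply Cmod_triangle|]. rewrite !Cmod_mult.
  apply Rplus_le_compat; apply Rmult_le_compat_l; auto using Cmod_ge_0.
Qed.

Lemma holo_bounded_ge0 f r M : holo_bounded f r M -> 0 <= M.
Proof.
intros [Hr H]. eapply Rle_trans; [apply Cmod_ge_0|]. apply (H (RtoC 0)). now rewrite Cmod_0.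
Qed.

Lemma holo_bounded_value_0 k s M c : holo_bounded k s M ->
  (forall n w, Cmod w <= s / 8 -> Cmod (k w - csum c w n) <= 4 * M * (4 / s * Cmod w) ^ n) ->
  c 0%nat = k (RtoC 0).
Proof.
intros [Hs _] Hc. assert (G := Hc 1%nat (RtoC 0)). rewrite Cmod_0 in G.
specialize (G ltac:(lra)).
rewrite Rmult_0_r in G. simpl in G. symmetry. apply Ceq_minus, Cmod_eq_0.
apply Rle_antisym; [|apply Cmod_ge_0].
replace (k 0 - c 0%nat)%C with (k 0 - (0 + c 0%nat * 1))%C by ring. lra.
Qed.

Lemma holo_bounded_lipschitz k s M : holo_bounded k s M -> forall w, Cmod w <= s / 8 ->
  Cmod (k w - k (RtoC 0)) <= 16 * M / s * Cmod w.
Proof.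
intros Hk w Hw. destruct (taylor k s M Hk) as [c Hc].
assert (E := holo_bounded_value_0 k s M c Hk Hc). destruct Hk as [Hs _].
assert (G := Hc 1%nat w Hw). cbn [csum] in G. rewrite E in G.
replace (k w - k (RtoC 0))%C with (k w - (0 + k (RtoC 0) * w ^ 0))%C by (simpl; ring).
eapply Rle_trans; [exact G|]. right. field. lra.
Qed.

Lemma holo_bounded_second_order k s M : holo_bounded k s M -> exists (c1 : C) (K : R), 0 <= K /\
  is_cderive k (RtoC 0) c1 /\
  forall w, Cmod w <= s / 8 -> Cmod (k w - k (RtoC 0) - c1 * w) <= K * Cmod w ^ 2.
Proof.
intros Hk. assert (HM := holo_bounded_ge0 _ _ _ Hk). destruct (taylor k s M Hk) as [c Hc].
assert (E := holo_bounded_value_0 k s M c Hk Hc). destruct Hk as [Hs _].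
set (K := 4 * M * (4 / s) ^ 2).
assert (HK : 0 <= K).
{ unfold K. apply Rmult_le_pos; [lra|]. apply pow2_ge_0. }
assert (Hb : forall w, Cmod w <= s / 8 -> Cmod (k w - k (RtoC 0) - c 1%nat * w) <= K * Cmod w ^
  2).
{ intros w Hw. assert (G := Hc 2%nat w Hw). cbn [csum] in G.
  rewrite E, Cpow_1_r, Rpow_mult_distr in G.
  replace (k w - k (RtoC 0) - c 1%nat * w)%C with (k w - (0 + k (RtoC 0) * w ^ 0 + c 1%nat *
    w))%C by (simpl; ring).
  unfold K. lra. }
exists (c 1%nat), K. split; auto. split; auto.
apply is_cderive_eps. intros eps He. exists (Rmin (s / 8) (eps / (K + 1))). split.
{ apply Rmin_case; [lra | apply Rdiv_lt_0_compat; lra]. }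
intros w Hw. replace (w - 0)%C with w in * by ring.
destruct (lt_Rmin _ _ _ Hw) as [W1 W2].
apply (Rlt_div_r _ eps) in W2; [|lra].
eapply Rle_trans; [apply Hb; lra|]. simpl. assert (Z := Cmod_ge_0 w). nra.
Qed.

Lemma holo_bounded_expansion f r M c : holo_bounded f r M -> Cmod c <= r / 2 ->
  exists (c1 : C) (K : R), 0 <= K /\ is_cderive f c c1 /\
  forall w, Cmod w <= r / 16 -> Cmod (f (c + w)%C - f c - c1 * w) <= K * Cmod w ^ 2.
Proof.
intros Hf Hc. destruct (holo_bounded_second_order _ _ _ (holo_bounded_shift f r M c Hf Hc)) as
  (c1 & K & HK & Hc1 & Hexp).
exists c1, K. split; auto. split.
- apply (is_cderive_ext_loc (fun w => f (c + (w - c))%C) _ _ _ 1); [lra | intros w _; f_equal;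
    ring|].
  apply (is_cderive_eq _ _ ((1 - 0) * c1)%C); [|ring].
  apply (is_cderive_comp (fun w => f (c + w)%C) (fun w => w - c)%C).
  + now replace (c - c)%C with (RtoC 0) by ring.
  + apply (is_cderive_minus (fun w => w) (fun _ => c)); [apply is_cderive_id | apply
      is_cderive_const].
- intros w Hw. specialize (Hexp w ltac:(lra)). now rewrite Cplus_0_r in Hexp.
Qed.

Lemma Cmod_im_axis t : Cmod (0, t) = Rabs t.
Proof.
replace (0, t) with ((0, t) - (0, 0))%C by (apply injective_projections; simpl; ring).
rewrite Cmod_vertical. f_equal; ring.
Qed.

Lemma is_rderive_im_axis t : is_rderive (fun t => (0, t)) t Ci.
Proof.
apply is_rderive_eps. intros eps He. exists 1. split; [lra|]. intros s _.
replace ((0, s) - (0, t) - RtoC (s - t) * Ci)%C with (RtoC 0)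
  by (apply injective_projections; simpl; ring).
rewrite Cmod_0. apply Rmult_le_pos; [lra | apply Rabs_pos].
Qed.

Lemma axis_const (f : C -> C) (k : C) tau :
  (forall t, Rabs t < tau -> exists c : C, is_cderive f (0, t) c /\ Re (k * (c * Ci))%C = 0) ->
  forall s t, Rabs s < tau -> Rabs t < tau -> Re (k * f (0, s)%R)%C = Re (k * f (0, t)%R)%C.
Proof.
intros H.
assert (D : forall t, Rabs t < tau -> is_derive (fun t => Re (k * f (0, t)%R)%C) t 0).
{ intros t Ht. destruct (H t Ht) as (c & Hc & E).
  assert (Q : is_derive (fun t => Re (k * f (0, t)%R)%C) t (Re (k * (c * Ci))%C)); [|rewrite E
    in Q; exact Q].
  apply is_derive_Re.
  replace (k * (c * Ci))%C with ((0 * f (0, t)%R + k * c) * Ci)%C by ring.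
  apply (is_rderive_comp (fun w => k * f w)%C (fun t => (0, t)) t); [|apply is_rderive_im_axis].
  apply (is_cderive_mult (fun _ => k) f); [apply is_cderive_const | exact Hc]. }
assert (Hlt : forall s t, Rabs s < tau -> Rabs t < tau -> s < t -> Re (k * f (0, s)%R)%C = Re (k
  * f (0, t)%R)%C).
{ intros s t Hs Ht L.
  apply (eq_is_derive (fun t => Re (k * f (0, t)%R)%C) s t); auto.
  intros u Hu. apply D. apply Rabs_def2 in Hs. apply Rabs_def2 in Ht. apply Rabs_def1; lra. }
intros s t Hs Ht. destruct (Rtotal_order s t) as [L|[->|L]]; auto. symmetry; auto.
Qed.

(** * Fields tangent to the hypersurface *)

Section Main.
Variables (P Px Py : C -> R) (r0 : R) (HP : flat_isolated P Px Py r0).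
Variables (h1 h2 : C -> C -> C) (r M : R).
Notation dP := (dir_deriv Px Py).
Notation jet := (jet_size P Px Py).
Hypotheses (Hr : 0 < r)
  (Hb1 : forall z, Cmod z < r -> holo_bounded (fun u => h1 u z) r M /\ holo_bounded (h1 z) r M)
  (Hb2 : forall z, Cmod z < r -> holo_bounded (fun u => h2 u z) r M /\ holo_bounded (h2 z) r M)
  (H00 : h1 (RtoC 0) (RtoC 0) = RtoC 0)
  (HT : forall u z, Cmod u < r -> Cmod z < r -> Re u + P z = 0 ->
     Re (h1 u z) + dP z (h2 u z) = 0).

Lemma M_ge0 : 0 <= M.
Proof. destruct (Hb1 (RtoC 0)) as [B _]; [rewrite Cmod_0; auto | exact (holo_bounded_ge0 _ _ _
  B)]. Qed.

Lemma tangent_near_axis t z : Rabs t < r / 2 -> Cmod z < r -> Rabs (P z) < r / 2 ->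
  Re (h1 ((0, t) + RtoC (- P z)) z)%C + dP z (h2 ((0, t) + RtoC (- P z)) z)%C = 0.
Proof.
intros Ht Hz HPz. apply HT; auto.
- eapply Rle_lt_trans; [apply Cmod_triangle|]. rewrite Cmod_im_axis, Cmod_R, Rabs_Ropp. lra.
- unfold Re; simpl. ring.
Qed.

Lemma shift_close (h : C -> C -> C) t z p :
  (forall z, Cmod z < r -> holo_bounded (fun u => h u z) r M /\ holo_bounded (h z) r M) ->
  Rabs t <= r / 2 -> Cmod z < r -> Rabs p <= r / 16 ->
  Cmod (h ((0, t) + RtoC p) z - h (0, t) z)%C <= 32 * M / r * Rabs p.
Proof.
intros Hb Ht Hz Hp. destruct (Hb z Hz) as [B _].
assert (S := holo_bounded_shift _ _ _ (0, t) B ltac:(rewrite Cmod_im_axis; lra)).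
assert (L := holo_bounded_lipschitz _ _ _ S (RtoC p)). rewrite Cmod_R in L.
specialize (L ltac:(lra)).
cbv beta in L. rewrite Cplus_0_r in L. eapply Rle_trans; [exact L|]. right. field. lra.
Qed.

Lemma P_small : exists d, 0 < d /\ d <= r / 8 /\ d <= r0 /\ forall z, Cmod z < d -> Rabs (P z) <
  r / 16 /\ jet z < 1.
Proof.
destruct (jet_small P Px Py r0 HP (Rmin 1 (r / 16))) as (d & Hd & H); [apply Rmin_case; lra|].
exists (Rmin d (r / 8)). split; [apply Rmin_case; lra|]. split; [apply Rmin_r|].
split; [eapply Rle_trans; [apply Rmin_l | lra]|].
intros z Hz. specialize (H z (Rlt_le_trans _ _ _ Hz (Rmin_l _ _))).
assert (A := P_le_jet P Px Py z).
assert (B1 := Rmin_l 1 (r / 16)). assert (B2 := Rmin_r 1 (r / 16)). lra.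
Qed.

Lemma h1_axis_re t : Rabs t < r / 2 -> Re (h1 (0, t) (RtoC 0)) = 0.
Proof.
intros Ht. assert (E := tangent_near_axis t (RtoC 0) Ht).
rewrite Cmod_0, (P_0 P Px Py r0 HP), Rabs_R0 in E.
specialize (E Hr ltac:(lra)).
replace ((0, t) + RtoC (- 0))%C with ((0, t) : C) in E by (apply injective_projections; simpl;
  ring).
assert (J : jet (RtoC 0) = 0).
{ destruct (jet_flat P Px Py r0 HP 1) as (K & d & HK & Hd & H). specialize (H (RtoC 0)).
  rewrite Cmod_0, pow_1, Rmult_0_r in H. specialize (H ltac:(lra)).
  assert (J := jet_ge0 P Px Py (RtoC 0)). lra. }
assert (B := dP_bound P Px Py (RtoC 0) (h2 (0, t) (RtoC 0))). rewrite J, Rmult_0_l in B.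
assert (Rabs (dP (RtoC 0) (h2 (0, t) (RtoC 0))) = 0) by (assert (G := Rabs_pos (dP (RtoC 0) (h2
  (0, t) (RtoC 0)))); lra).
apply Rabs_eq_0 in H. lra.
Qed.

(** Tangency bounds [Re h1 (i t, .)] by [|P|] and [|dP|], which are flat, and the
    real part of a non-constant holomorphic function is not. *)
Lemma h1_axis_indep t z : Rabs t < r / 2 -> Cmod z <= r / 8 -> h1 (0, t) z = h1 (0, t) (RtoC 0).
Proof.
intros Ht Hz. assert (HM := M_ge0).
destruct (Hb1 (0, t)) as [_ B]; [rewrite Cmod_im_axis; lra|].
assert (B2 : holo_bounded (fun _ => h1 (0, t) (RtoC 0)) r M).
{ split; auto. intros w Hw. split; [apply diff_const|]. apply B. now rewrite Cmod_0. }
assert (Bl := holo_bounded_lin _ _ _ _ _ 1 (-(1)) B B2).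
assert (Z := flat_real_part _ _ _ Bl). cbv beta in Z.
apply Ceq_minus. replace (h1 (0, t) z - h1 (0, t) (RtoC 0))%C with
  (1 * h1 (0, t) z + - (1) * h1 (0, t) (RtoC 0))%C by ring.
apply Z; auto; [ring|]. clear Z.
destruct P_small as (d1 & D1 & D1' & D1'' & HPs).
intros n. destruct (jet_flat P Px Py r0 HP n) as (K & d & HK & Hd & H).
exists ((32 * M / r + M) * K), (Rmin d d1). split; [apply Rmin_case; lra|]. intros w Hw.
destruct (lt_Rmin _ _ _ Hw) as [W1 W2].
specialize (H w W1). destruct (HPs w W2) as [P1 P2].
replace (Re (1 * h1 (0, t) w + - (1) * h1 (0, t) (RtoC 0))%C) with (Re (h1 (0, t) w)).
2:{ assert (E := h1_axis_re t Ht). unfold Re in *; simpl. rewrite E. ring. }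
assert (Tg := tangent_near_axis t w Ht ltac:(lra) ltac:(lra)).
assert (Sc := shift_close h1 t w (- P w) Hb1 ltac:(lra) ltac:(lra) ltac:(rewrite Rabs_Ropp;
  lra)).
rewrite Rabs_Ropp in Sc.
assert (R1 := re_le_Cmod (h1 ((0, t) + RtoC (- P w)) w - h1 (0, t) w)%C).
assert (Bd := dP_bound P Px Py w (h2 ((0, t) + RtoC (- P w)) w)%C).
assert (Hm : Cmod (h2 ((0, t) + RtoC (- P w)) w)%C <= M).
{ destruct (Hb2 w ltac:(lra)) as [B' _]. apply B'.
  eapply Rle_lt_trans; [apply Cmod_triangle|]. rewrite Cmod_im_axis, Cmod_R, Rabs_Ropp. lra. }
assert (J := jet_ge0 P Px Py w). assert (A := P_le_jet P Px Py w).
assert (jet w * Cmod (h2 ((0, t) + RtoC (- P w)) w)%C <= jet w * M) by (apply Rmult_le_compat_l;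
  lra).
assert (HL : 0 <= 32 * M / r) by (apply Rmult_le_pos; [lra | left; now apply Rinv_0_lt_compat]).
assert (32 * M / r * Rabs (P w) <= 32 * M / r * jet w) by (apply Rmult_le_compat_l; lra).
assert (jet w * (32 * M / r + M) <= K * Cmod w ^ n * (32 * M / r + M)) by (apply
  Rmult_le_compat_r; lra).
replace (Re (h1 (0, t) w)) with (- dP w (h2 ((0, t) + RtoC (- P w)) w)%C
  - Re (h1 ((0, t) + RtoC (- P w)) w - h1 (0, t) w)%C).
2:{ replace (Re (h1 ((0, t) + RtoC (- P w)) w - h1 (0, t) w)%C) with
    (Re (h1 ((0, t) + RtoC (- P w)) w)%C - Re (h1 (0, t) w)) by (unfold Re; simpl; ring). lra. }
eapply Rle_trans; [apply Rabs_triang|]. rewrite !Rabs_Ropp. lra.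
Qed.

Lemma h1_indep u z : Cmod u <= r / 8 -> Cmod z <= r / 8 -> h1 u z = h1 u (RtoC 0).
Proof.
intros Hu Hz. apply Ceq_minus.
destruct (Hb1 z ltac:(lra)) as [B _]. destruct (Hb1 (RtoC 0)) as [B2 _]; [rewrite Cmod_0; lra|].
assert (Bl := holo_bounded_lin _ _ _ _ _ 1 (-(1)) B B2).
assert (Z := im_axis_zero _ _ _ (r / 2) Bl ltac:(lra)). cbv beta in Z.
replace (h1 u z - h1 u (RtoC 0))%C with (1 * h1 u z + - (1) * h1 u (RtoC 0))%C by ring.
apply Z; auto. intros t Ht. rewrite (h1_axis_indep t z) by auto. ring.
Qed.

(** First order expansion of tangency in [P]: replacing [h2 (i t - P)] by
    [h2 (i t)] costs [O(|P| |dP|)] and linearizing [h1] costs [O(P ^ 2)]. *)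
Lemma field_on_axis t : Rabs t <= r / 16 -> exists (c1 : C) (K0 dl : R),
  is_cderive (fun u => h1 u (RtoC 0)) (0, t) c1 /\ 0 <= K0 /\ 0 < dl /\
  forall z, Cmod z < dl ->
    Rabs (dP z (h2 (0, t) z) + - Re c1 * P z) <= K0 * Rabs (P z) * jet z.
Proof.
intros Ht. assert (HM := M_ge0).
destruct (Hb1 (RtoC 0)) as [B _]; [rewrite Cmod_0; lra|].
destruct (holo_bounded_expansion _ _ _ (0, t) B ltac:(rewrite Cmod_im_axis; lra)) as (c1 & K &
  HK & Hc1 & Hexp).
assert (HL : 0 <= 32 * M / r) by (apply Rmult_le_pos; [lra | left; now apply Rinv_0_lt_compat]).
destruct P_small as (d1 & D1 & D1' & D1'' & HPs).
exists c1, (K + 32 * M / r), d1. split; [exact Hc1 | split; [lra | split; auto]].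
intros z Hz. destruct (HPs z Hz) as [P1 P2]. assert (Hap := Rabs_pos (P z)).
  assert (Tg := tangent_near_axis t z ltac:(lra) ltac:(lra) ltac:(lra)).
  rewrite h1_indep in Tg; [| |lra].
  2:{ eapply Rle_trans; [apply Cmod_triangle|]. rewrite Cmod_im_axis, Cmod_R, Rabs_Ropp. lra. }
  assert (X := Hexp (RtoC (- P z))). rewrite Cmod_R, Rabs_Ropp in X. specialize (X ltac:(lra)).
  assert (R1 := Rle_trans _ _ _ (re_le_Cmod _) X).
  replace (Re (h1 ((0, t) + RtoC (- P z))%C (RtoC 0) - h1 (0, t) (RtoC 0) - c1 * RtoC (- P
    z))%C)
    with (Re (h1 ((0, t) + RtoC (- P z))%C (RtoC 0)) - Re (h1 (0, t) (RtoC 0)) + Re c1 * P z) in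
      R1
    by (unfold Re; simpl; ring).
  rewrite (h1_axis_re t) in R1 by lra.
  assert (Sc := shift_close h2 t z (- P z) Hb2 ltac:(lra) ltac:(lra) ltac:(rewrite Rabs_Ropp;
    lra)).
  rewrite Rabs_Ropp in Sc.
  assert (Bd := dP_bound P Px Py z (h2 ((0, t) + RtoC (- P z)) z - h2 (0, t) z)%C).
  replace (dP z (h2 ((0, t) + RtoC (- P z)) z - h2 (0, t) z)%C) with
    (dP z (h2 ((0, t) + RtoC (- P z)) z)%C - dP z (h2 (0, t) z)) in Bd by (unfold dir_deriv, Re,
      Im; simpl; ring).
  assert (J := jet_ge0 P Px Py z). assert (A := P_le_jet P Px Py z).
  assert (jet z * Cmod (h2 ((0, t) + RtoC (- P z)) z - h2 (0, t) z)%C <= jet z * (32 * M / r *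
    Rabs (P z)))
    by (apply Rmult_le_compat_l; lra).
  assert (K * Rabs (P z) ^ 2 <= K * Rabs (P z) * jet z).
  { simpl. rewrite Rmult_1_r, <- Rmult_assoc. apply Rmult_le_compat_l; auto.
    now apply Rmult_le_pos. }
  replace (dP z (h2 (0, t) z) + - Re c1 * P z) with
    (- (Re (h1 ((0, t) + RtoC (- P z))%C (RtoC 0)) - 0 + Re c1 * P z)
     - (dP z (h2 ((0, t) + RtoC (- P z)) z)%C - dP z (h2 (0, t) z))) by lra.
  eapply Rle_trans; [apply Rabs_triang|]. rewrite !Rabs_Ropp. lra.
Qed.

(** By [field_dichotomy] the derivative of [h1] on the axis is imaginary, so that
    [Im h1] is constant along the axis, as [Re h1] is. *)
Lemma h1_zero u z : Cmod u <= r / 8 -> Cmod z <= r / 8 -> h1 u z = RtoC 0.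
Proof.
intros Hu Hz. rewrite h1_indep by auto.
destruct (Hb1 (RtoC 0)) as [B _]; [rewrite Cmod_0; lra|].
apply (im_axis_zero _ _ _ (r / 16) B); auto; [lra|]. intros t Ht.
assert (E := axis_const (fun u => h1 u (RtoC 0)) (- Ci)%C (r / 16)).
assert (Im0 : Re (- Ci * h1 (0, t)%R (RtoC 0))%C = Re (- Ci * h1 (0, 0)%R (RtoC 0))%C).
{ apply E; auto; [|rewrite Rabs_R0; lra]. intros s Hs.
  destruct (field_on_axis s ltac:(lra)) as (c1 & K0 & dl & Hc1 & HK0 & Hdl & Hf).
  exists c1. split; auto.
  destruct (Hb2 (0, s)) as [_ B2]; [rewrite Cmod_im_axis; lra|].
  destruct (field_dichotomy P Px Py r0 HP _ _ _ _ _ _ B2 HK0 Hdl Hf) as [Hl _].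
  unfold Re in *; simpl. lra. }
change ((0, 0) : C) with (RtoC 0) in Im0. rewrite H00 in Im0.
assert (Re0 := h1_axis_re t ltac:(lra)).
apply injective_projections; unfold Re in *; simpl in *; lra.
Qed.

Lemma h2_field_on_axis t : Rabs t <= r / 16 -> exists K0 dl, 0 <= K0 /\ 0 < dl /\
  forall z, Cmod z < dl -> Rabs (dP z (h2 (0, t) z)) <= K0 * Rabs (P z) * jet z.
Proof.
intros Ht. destruct (field_on_axis t Ht) as (c1 & K0 & dl & Hc1 & HK0 & Hdl & Hf).
destruct (Hb2 (0, t)) as [_ B2]; [rewrite Cmod_im_axis; lra|].
destruct (field_dichotomy P Px Py r0 HP _ _ _ _ _ _ B2 HK0 Hdl Hf) as [Hl _].
exists K0, dl. split; auto. split; auto. intros z Hz. specialize (Hf z Hz).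
rewrite Hl, Rmult_0_l, Rplus_0_r in Hf. exact Hf.
Qed.

Lemma h2_tangent t z : Rabs t <= r / 16 -> Cmod z <= r / 8 -> Rabs (P z) <= r / 16 ->
  dP z (h2 ((0, t) + RtoC (- P z)) z)%C = 0.
Proof.
intros Ht Hz HPz. assert (Tg := tangent_near_axis t z ltac:(lra) ltac:(lra) ltac:(lra)).
rewrite h1_zero in Tg; auto.
- unfold Re in Tg; simpl in Tg. lra.
- eapply Rle_trans; [apply Cmod_triangle|]. rewrite Cmod_im_axis, Cmod_R, Rabs_Ropp. lra.
Qed.

Lemma h2_cases :
  (forall u z, Cmod u <= r / 8 -> Cmod z <= r / 8 -> h2 u z = RtoC 0) \/
  exists t0 beta K, Rabs t0 < r / 16 /\ beta <> 0 /\ 0 <= K /\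
    forall w, Cmod w <= r / 8 -> Cmod (h2 (0, t0) w - Ci * RtoC beta * w) <= K * Cmod w ^ 2.
Proof.
destruct (classic (exists t0 beta K, Rabs t0 < r / 16 /\ beta <> 0 /\ 0 <= K /\
    forall w, Cmod w <= r / 8 -> Cmod (h2 (0, t0) w - Ci * RtoC beta * w) <= K * Cmod w ^ 2)) as
      [|N]; auto.
left. intros u z Hu Hz.
destruct (Hb2 z ltac:(lra)) as [B _].
apply (im_axis_zero _ _ _ (r / 16) B); auto; [lra|]. intros t Ht.
destruct (h2_field_on_axis t ltac:(lra)) as (K0 & dl & HK0 & Hdl & Hf).
destruct (Hb2 (0, t)) as [_ B2]; [rewrite Cmod_im_axis; lra|].
destruct (field_dichotomy P Px Py r0 HP (h2 (0, t)) r M 0 K0 dl B2 HK0 Hdl) as [_ [Z|(beta & K &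
  X1 & X2 & X3)]].
- intros w Hw. rewrite Rmult_0_l, Rplus_0_r. now apply Hf.
- now apply Z.
- exfalso. apply N. exists t, beta, K. auto.
Qed.

Section Rotation.
Variables (t0 beta K : R).
Hypotheses (Ht0 : Rabs t0 < r / 16) (Hbeta : beta <> 0)
  (Hg : forall w, Cmod w <= r / 8 -> Cmod (h2 (0, t0) w - Ci * RtoC beta * w) <= K * Cmod w ^
    2).
Notation g := (h2 (0, t0)).

Lemma linear_coefficient_zero (f : C -> C) (b : C) K1 :
  (forall w, Cmod w <= r / 8 -> f w = RtoC 0) ->
  (forall w, Cmod w <= r / 8 -> Cmod (f w - b * w) <= K1 * Cmod w ^ 2) -> b = RtoC 0.
Proof.
intros H0 H. apply (small_linear b K1 (r / 8)); [lra|]. intros t Ht.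
assert (Hm : Cmod (RtoC t) = t) by (apply Cmod_RtoC_pos; lra).
specialize (H (RtoC t)). rewrite Hm, H0 in H by lra. specialize (H ltac:(lra)).
replace (0 - b * RtoC t)%C with (- (b * RtoC t))%C in H by ring.
rewrite Cmod_opp, Cmod_mult, Hm in H. simpl in H. apply Rmult_le_reg_r with t; lra.
Qed.

Lemma Ci_beta_ne (b : R) : b <> 0 -> (Ci * RtoC b)%C <> RtoC 0.
Proof. intros Hb. apply Cmult_neq_0; [apply Ci_nz|]. intros E. apply RtoC_inj in E. auto. Qed.

(** [field_dichotomy] also applies to real linear combinations of these fields; one
    without linear part must vanish. *)
Lemma h2_proportional t : Rabs t < r / 16 ->
  exists c : R, forall w, Cmod w <= r / 8 -> h2 (0, t) w = (RtoC c * g w)%C.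
Proof.
intros Ht.
destruct (h2_field_on_axis t ltac:(lra)) as (K0 & dl & HK0 & Hdl & Hf).
destruct (h2_field_on_axis t0 ltac:(lra)) as (K0' & dl' & HK0' & Hdl' & Hf').
destruct (Hb2 (0, t)) as [_ B]; [rewrite Cmod_im_axis; lra|].
destruct (Hb2 (0, t0)) as [_ B']; [rewrite Cmod_im_axis; lra|].
destruct (field_dichotomy P Px Py r0 HP (h2 (0, t)) r M 0 K0 dl B HK0 Hdl) as [_ [Z|(b & K1 & X1
  & X2 & X3)]].
{ intros w Hw. rewrite Rmult_0_l, Rplus_0_r. now apply Hf. }
{ exists 0. intros w Hw. rewrite Z by auto. ring. }
assert (Bl := holo_bounded_lin _ _ _ _ _ (RtoC beta) (RtoC (- b)) B B').
set (F := fun z => (RtoC beta * h2 (0, t) z + RtoC (- b) * g z)%C) in *.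
assert (HKK : 0 <= Rabs beta * K0 + Rabs b * K0').
{ apply Rplus_le_le_0_compat; apply Rmult_le_pos; auto using Rabs_pos. }
destruct (field_dichotomy P Px Py r0 HP F r _ 0 (Rabs beta * K0 + Rabs b * K0') (Rmin dl dl') Bl
  HKK) as [_ [Z|(b' & K2 & Y1 & Y2 & Y3)]].
- now apply Rmin_case.
- intros w Hw. rewrite Rmult_0_l, Rplus_0_r. unfold F. rewrite dP_plus, !dP_scal.
  specialize (Hf w (Rlt_le_trans _ _ _ Hw (Rmin_l _ _))).
  specialize (Hf' w (Rlt_le_trans _ _ _ Hw (Rmin_r _ _))).
  eapply Rle_trans; [apply Rabs_triang|]. rewrite !Rabs_mult, Rabs_Ropp.
  assert (Rabs beta * Rabs (dP w (h2 (0, t) w)) <= Rabs beta * (K0 * Rabs (P w) * jet w))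
    by (apply Rmult_le_compat_l; auto using Rabs_pos).
  assert (Rabs b * Rabs (dP w (h2 (0, t0) w)) <= Rabs b * (K0' * Rabs (P w) * jet w))
    by (apply Rmult_le_compat_l; auto using Rabs_pos).
  lra.
- exists (b / beta). intros w Hw. specialize (Z w Hw). unfold F in Z.
  assert (Hbn : RtoC beta <> RtoC 0) by (intros E; apply RtoC_inj in E; auto).
  rewrite RtoC_div by auto. rewrite RtoC_opp in Z.
  replace (h2 (0, t) w) with ((RtoC beta * h2 (0, t) w + - RtoC b * g w + RtoC b * g w) / RtoC
    beta)%C
    by (field; auto).
  rewrite Z. field. auto.
- exfalso. apply (Ci_beta_ne b' Y1).
  apply (small_linear _ (K2 + (Rabs beta * K1 + Rabs b * K)) (r / 8)); [lra|]. intros s Hs.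
  assert (Hm : Cmod (RtoC s) = s) by (apply Cmod_RtoC_pos; lra).
  specialize (X3 (RtoC s)). specialize (Y3 (RtoC s)). assert (G := Hg (RtoC s)).
  rewrite Hm in *.
  specialize (X3 ltac:(lra)). specialize (Y3 ltac:(lra)). specialize (G ltac:(lra)).
  apply Rmult_le_reg_r with s; [lra|].
  replace (Cmod (Ci * RtoC b') * s) with (Cmod (Ci * RtoC b' * RtoC s)) by (rewrite Cmod_mult,
    Hm; auto).
  replace (Ci * RtoC b' * RtoC s)%C with (- (F (RtoC s) - Ci * RtoC b' * RtoC s) +
    (RtoC beta * (h2 (0, t) (RtoC s) - Ci * RtoC b * RtoC s) + RtoC (- b) * (g (RtoC s) - Ci *
      RtoC beta * RtoC s)))%C
    by (unfold F; rewrite RtoC_opp; ring).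
  eapply Rle_trans; [apply Cmod_triangle|]. rewrite Cmod_opp.
  eapply Rle_trans; [apply Rplus_le_compat_l, Cmod_triangle|].
  rewrite !Cmod_mult, !Cmod_R, Rabs_Ropp.
  assert (Rabs beta * Cmod (h2 (0, t) (RtoC s) - Ci * RtoC b * RtoC s) <= Rabs beta * (K1 * s ^
    2))
    by (apply Rmult_le_compat_l; auto using Rabs_pos).
  assert (Rabs b * Cmod (g (RtoC s) - Ci * RtoC beta * RtoC s) <= Rabs b * (K * s ^ 2))
    by (apply Rmult_le_compat_l; auto using Rabs_pos).
  simpl in *. lra.
Qed.

(** Evaluating at a point where [g] does not vanish gives [h2 = f (z1) g (z2)]. *)
Lemma h2_product : exists f Mf, holo_bounded f r Mf /\ (forall t, Rabs t < r / 16 -> Im (f (0,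
  t)) = 0) /\
  f (0, t0) = RtoC 1 /\
  forall u z, Cmod u <= r / 8 -> Cmod z <= r / 8 -> h2 u z = (f u * g z)%C.
Proof.
assert (Hex : exists z, Cmod z <= r / 8 /\ g z <> RtoC 0).
{ apply NNPP. intros N. apply (Ci_beta_ne beta Hbeta).
  apply (linear_coefficient_zero g _ K); auto. intros w Hw.
  destruct (Ceq_dec (g w) 0%C); auto. exfalso. apply N. eauto. }
destruct Hex as (zs & Hzs & Hgz).
destruct (Hb2 zs ltac:(lra)) as [B _].
exists (fun u => / g zs * h2 u zs + 0 * h2 u zs)%C, (Cmod (/ g zs) * M + Cmod 0 * M).
assert (Bf := holo_bounded_lin _ _ _ _ _ (/ g zs)%C 0 B B). split; [exact Bf|].
assert (Hax : forall t, Rabs t < r / 16 -> forall z, Cmod z <= r / 8 ->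
  exists c : R, (/ g zs * h2 (0, t)%R zs + 0 * h2 (0, t)%R zs)%C = RtoC c /\ h2 (0, t) z = (RtoC
    c * g z)%C).
{ intros t Ht z Hz. destruct (h2_proportional t Ht) as (c & Hc). exists c.
  split; [|now apply Hc].
  rewrite Hc by auto. field. auto. }
split; [|split].
- intros t Ht. destruct (Hax t Ht zs Hzs) as (c & E & _). rewrite E. apply im_RtoC.
- field. auto.
- intros u z Hu Hz. destruct (Hb2 z ltac:(lra)) as [Bz _].
  assert (Bl := holo_bounded_lin _ _ _ _ _ 1 (- g z)%C Bz Bf).
  assert (Z := im_axis_zero _ _ _ (r / 16) Bl ltac:(lra)). cbv beta in Z.
  assert (E : (1 * h2 u z + - g z * (/ g zs * h2 u zs + 0 * h2 u zs))%C = RtoC 0).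
  { apply Z; auto. intros t Ht. destruct (Hax t Ht z Hz) as (c & E1 & E2). rewrite E1, E2. ring.
    }
  apply Ceq_minus. etransitivity; [|exact E]. ring.
Qed.

Variables (phi d : C -> C) (R1 : R).
Hypotheses (HR1 : 0 < R1) (Hphi0 : phi (RtoC 0) = RtoC 0)
  (Hphi : forall z, Cmod z < R1 -> is_cderive phi z (d z) /\
     (d z * g z)%C = (Ci * RtoC beta * phi z)%C /\ Cmod (d z - 1) <= 1 / 4).

(** At points where [P] is critical along the circles of [phi], tangency forces
    [f (i t - P)] to be real. Such points accumulate at the origin, so the first
    order term of [f (i t - P)] in [P] is real. *)
Lemma factor_real_derivative f Mf : holo_bounded f r Mf ->
  (forall t, Rabs t < r / 16 -> Im (f (0, t)) = 0) ->
  (forall u z, Cmod u <= r / 8 -> Cmod z <= r / 8 -> h2 u z = (f u * g z)%C) ->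
  forall t, Rabs t < r / 16 -> exists c1 : C, is_cderive f (0, t) c1 /\ Im c1 = 0.
Proof.
intros Bf Hfi Hfac t Ht.
destruct (holo_bounded_expansion _ _ _ (0, t) Bf ltac:(rewrite Cmod_im_axis; lra)) as (c1 & Kf &
  HKf & Hc1 & Hexp).
exists c1. split; [exact Hc1|].
destruct (Req_dec (Im c1) 0) as [|Hne]; auto. exfalso.
assert (Hi : 0 < Rabs (Im c1)) by now apply Rabs_pos_lt.
destruct P_small as (d1 & D1 & D1' & D1'' & HPs).
destruct (jet_small P Px Py r0 HP (Rabs (Im c1) / (Kf + 1))) as (d2 & D2 & Hj); [apply
  Rdiv_lt_0_compat; lra|].
destruct (circle_critical P Px Py r0 HP phi d R1 (Rmin d1 d2) HR1 Hphi0) as (z & Hz & Hz1 & Hpz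
  & HPz & Y & HY & Hc).
{ intros w Hw. destruct (Hphi w Hw) as (A1 & A2 & A3). auto. }
{ apply Rmin_case; lra. }
destruct (lt_Rmin _ _ _ (proj2 Hz)) as [Z1 Z2].
destruct (HPs z Z1) as [P1 P2]. specialize (Hj z Z2).
apply (Rlt_div_r _ (Rabs (Im c1))) in Hj; [|lra].
set (u := ((0, t) + RtoC (- P z))%C).
assert (Hu : Cmod u <= r / 8).
{ unfold u. eapply Rle_trans; [apply Cmod_triangle|]. rewrite Cmod_im_axis, Cmod_R, Rabs_Ropp.
  lra. }
assert (Tg := h2_tangent t z ltac:(lra) ltac:(lra) ltac:(lra)). fold u in Tg.
rewrite Hfac in Tg by lra.
specialize (Hc (f u * g z)%C). rewrite Tg, Rmult_0_r in Hc.
destruct (Hphi z Hz1) as (_ & A2 & _).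
replace (Cconj (phi z) * d z * (f u * g z))%C with (Ci * RtoC beta * f u * (phi z * Cconj (phi
  z)))%C in Hc.
2:{ replace (Cconj (phi z) * d z * (f u * g z))%C with (Cconj (phi z) * f u * (d z * g z))%C by
  ring.
    rewrite A2. ring. }
rewrite <- Cmod2_conj, re_scal_r in Hc.
assert (Hfu : Im (f u) = 0).
{ symmetry in Hc. apply Rmult_integral in Hc. destruct Hc as [|Hc]; [tauto|].
  apply Rmult_integral in Hc. destruct Hc as [Hc|Hc].
  - replace (Re (Ci * RtoC beta * f u)%C) with (- (beta * Im (f u))) in Hc by (unfold Re, Im;
      simpl; ring).
    apply Ropp_eq_0_compat in Hc. rewrite Ropp_involutive in Hc. apply Rmult_integral in Hc.
    tauto.
  - exfalso. apply Cmod_gt_0 in Hpz. assert (Cmod (phi z) ^ 2 <> 0) by (apply pow_nonzero; lra).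
    auto. }
assert (X := Hexp (RtoC (- P z))). rewrite Cmod_R, Rabs_Ropp in X. specialize (X ltac:(lra)).
fold u in X.
assert (R2 := Rle_trans _ _ _ (im_le_Cmod _) X).
replace (Im (f u - f (0, t)%R - c1 * RtoC (- P z))%C) with (Im (f u) - Im (f (0, t)) + Im c1 * P
  z) in R2
  by (unfold Im; simpl; ring).
rewrite Hfu, (Hfi t Ht) in R2. rewrite Rminus_0_r, Rplus_0_l, Rabs_mult in R2.
assert (HPp : 0 < Rabs (P z)) by now apply Rabs_pos_lt. assert (A := P_le_jet P Px Py z).
assert (Rabs (P z) * (Kf * Rabs (P z)) < Rabs (P z) * Rabs (Im c1)); [|simpl in R2; lra].
apply Rmult_lt_compat_l; auto.
assert (Kf * Rabs (P z) <= Kf * jet z) by (apply Rmult_le_compat_l; lra).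
assert (J := jet_ge0 P Px Py z). lra.
Qed.

(** The factor [f] is real along the axis and its derivative is real, so it does
    not vary there; it equals [1] at [i t0]. *)
Lemma h2_indep u z : Cmod u <= r / 8 -> Cmod z <= r / 8 -> h2 u z = g z.
Proof.
destruct h2_product as (f & Mf & Bf & Hfi & Hft & Hfac). intros Hu Hz. rewrite Hfac by auto.
assert (E : f u = RtoC 1); [|rewrite E; ring].
assert (B1 : holo_bounded (fun _ => RtoC 1) r 1).
{ split; auto. intros w _. split; [apply diff_const | rewrite Cmod_1; lra]. }
assert (Bl := holo_bounded_lin _ _ _ _ _ 1 (-(1)) Bf B1).
assert (Z := im_axis_zero _ _ _ (r / 16) Bl ltac:(lra)). cbv beta in Z.
apply Ceq_minus. replace (f u - 1)%C with (1 * f u + - (1) * 1)%C by ring.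
apply Z; auto. intros t Ht.
assert (Q : Re (1 * f (0, t)%R)%C = Re (1 * f (0, t0)%R)%C).
{ apply (axis_const f 1 (r / 16)); auto. intros s Hs.
  destruct (factor_real_derivative f Mf Bf Hfi Hfac s Hs) as (c1 & H1 & H2).
  exists c1. split; auto. unfold Re, Im in *; simpl. lra. }
rewrite Hft in Q. assert (I := Hfi t Ht).
apply injective_projections; unfold Re, Im in *; simpl in *; lra.
Qed.

Lemma P_invariant : exists dl, 0 < dl /\ forall z, Cmod z < dl -> Cmod z < r0 /\ dP z (g z) = 0.
Proof.
destruct P_small as (d1 & D1 & D1' & D1'' & HPs). exists d1. split; auto. intros z Hz.
destruct (HPs z Hz) as [P1 P2]. split; [lra|].
assert (Tg := h2_tangent 0 z ltac:(rewrite Rabs_R0; lra) ltac:(lra) ltac:(lra)).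
rewrite h2_indep in Tg; auto; [|lra].
eapply Rle_trans; [apply Cmod_triangle|]. rewrite Cmod_im_axis, Cmod_R, Rabs_Ropp, Rabs_R0. lra.
Qed.

(** In the coordinate [phi] the field [g] is the angular one, so [dP (g) = 0]
    integrates to invariance of [P] on circles. *)
Lemma rotation_coordinate : exists psi rho, 0 < rho /\ psi (RtoC 0) = RtoC 0 /\
  (forall w, Cmod w < rho -> Cmod (psi w) < R1 /\ Cmod (psi w) < r / 8 /\ phi (psi w) = w /\
     is_cderive psi w (/ d (psi w))%C /\ P (psi w) = P (psi (RtoC (Cmod w)))) /\
  (forall z, Cmod z < rho -> psi (phi z) = z).
Proof.
destruct (local_inverse phi d 1 R1 HR1 ltac:(rewrite Cmod_1; lra) Hphi0) as (psi & rho & Hrho &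
  Hpsi0 & Hpsi & Hinv).
{ intros z Hz. destruct (Hphi z Hz) as (A1 & A2 & A3). rewrite Cmod_1. split; auto. }
destruct P_invariant as (dl & Hdl & HdP).
exists psi, (Rmin (Rmin (rho / 2) R1) (Rmin (r / 16) (dl / 2))). split.
{ repeat apply Rmin_case; lra. }
assert (Hw' : forall w, Cmod w < Rmin (Rmin (rho / 2) R1) (Rmin (r / 16) (dl / 2)) ->
  Cmod w < rho / 2 /\ Cmod w < R1 /\ Cmod w < r / 16 /\ Cmod w < dl / 2).
{ intros w [[W1 W2]%lt_Rmin [W3 W4]%lt_Rmin]%lt_Rmin. auto. }
split; auto. split.
- intros w Hw. destruct (Hw' w Hw) as (W1 & W2 & W3 & W4).
  assert (Hps : forall v, Cmod v = Cmod w -> Cmod (psi v) < R1 /\ phi (psi v) = v /\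
    Cmod (psi v) <= 4 / 3 * Cmod w /\ is_cderive psi v (/ d (psi v))%C).
  { intros v Hv. destruct (Hpsi v ltac:(lra)) as (A1 & A2 & A3 & A4). rewrite Cmod_1, Hv in A3.
    split; auto. split; auto. split; auto. lra. }
  destruct (Hps w eq_refl) as (A1 & A2 & A3 & A4).
  assert (Hw0 := Cmod_ge_0 w).
  split; auto. split; [lra|]. split; auto. split; auto.
  destruct (polar w) as [th Hth].
  set (gam := fun s => (RtoC (Cmod w) * cis s)%C).
  assert (Hgm : forall s, Cmod (gam s) = Cmod w).
  { intros s. unfold gam. rewrite Cmod_mult, Cmod_cis, Cmod_R, Rabs_right; lra. }
  assert (Hgd : forall s, is_rderive gam s (Ci * gam s)%C).
  { intros s.
    assert (D := is_rderive_comp (fun z => RtoC (Cmod w) * cexp z)%C (fun t => (0, t)) s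
       (RtoC (Cmod w) * cis s)%C Ci).
    assert (Hex : forall t, cexp (0, t) = cis t).
    { intros t. unfold cexp. simpl. rewrite exp_0. ring. }
    assert (D' : is_rderive (fun t => RtoC (Cmod w) * cexp (0, t)%R)%C s (RtoC (Cmod w) * cis s
      * Ci)%C).
    { apply D; [|apply is_rderive_im_axis].
      apply (is_cderive_eq _ _ (0 * cexp (0, s)%R + RtoC (Cmod w) * cexp (0, s)%R)%C).
      - apply (is_cderive_mult (fun _ => RtoC (Cmod w)) cexp); [apply is_cderive_const | apply
          is_cderive_cexp].
      - rewrite Hex. ring. }
    unfold gam. replace (Ci * (RtoC (Cmod w) * cis s))%C with (RtoC (Cmod w) * cis s * Ci)%C by
      ring.
    revert D'. apply is_derive_ext. intros t. now rewrite Hex. }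
  assert (HD : forall s, is_derive (fun s => P (psi (gam s))) s 0).
  { intros s. destruct (Hps (gam s) (Hgm s)) as (G1 & G2 & G3 & G4).
    destruct (HdP (psi (gam s)) ltac:(lra)) as [HR0 HdPz].
    assert (D := P_chain P Px Py r0 HP (fun s => psi (gam s)) s _ HR0
       (is_rderive_comp psi gam s _ _ G4 (Hgd s))).
    cbv beta in D.
    destruct (Hphi _ G1) as (_ & E & _). rewrite G2 in E.
    assert (Hdne : d (psi (gam s)) <> RtoC 0).
    { apply Cmod_gt_0. destruct (Hphi _ G1) as (_ & _ & E3).
      assert (T := Cmod_triangle_rev 1 (- (d (psi (gam s)) - 1))%C).
      rewrite Cmod_opp, Cmod_1 in T.
      replace (1 - - (d (psi (gam s)) - 1))%C with (d (psi (gam s))) in T by ring. lra. }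
    assert (Hbn : RtoC beta <> RtoC 0) by (intros Q; apply RtoC_inj in Q; auto).
    assert (E4 : (/ d (psi (gam s)) * (Ci * gam s))%C = (RtoC (/ beta) * g (psi (gam s)))%C).
    { rewrite RtoC_inv by auto.
      replace (g (psi (gam s))) with (d (psi (gam s)) * g (psi (gam s)) / d (psi (gam s)))%C by
        (field; auto).
      rewrite E. field. auto. }
    rewrite E4, dP_scal, HdPz, Rmult_0_r in D. exact D. }
  assert (E0 : RtoC (Cmod w) = gam 0).
  { unfold gam, cis. rewrite cos_0, sin_0. apply injective_projections; simpl; ring. }
  assert (E1 : w = gam th) by exact Hth.
  assert (Hcst : forall a b, a < b -> P (psi (gam a)) = P (psi (gam b))).
  { intros a b Hab. exact (eq_is_derive (fun s => P (psi (gam s))) a b (fun t _ => HD t) Hab). }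
  rewrite E0. rewrite E1 at 1.
  destruct (Rtotal_order 0 th) as [L|[<-|L]]; auto. symmetry; auto.
- intros z Hz. destruct (Hw' z Hz) as (W1 & W2 & W3 & W4). apply Hinv; auto.
  assert (L := complex_mean_value phi d R1 (5 / 4) 0 z).
  rewrite Cmod_0, Hphi0 in L. replace (z - 0)%C with z in L by ring.
  replace (phi z - 0)%C with (phi z) in L by ring.
  eapply Rle_lt_trans; [apply L; auto|].
  + intros u Hu. destruct (Hphi u Hu) as (A1 & A2 & A3). split; auto.
    replace (d u) with ((d u - 1) + 1)%C by ring. eapply Rle_trans; [apply Cmod_triangle|].
    rewrite Cmod_1. lra.
  + lra.
Qed.

End Rotation.
End Main.

(** * The theorem *)

Lemma wirtinger_dP (P : C -> R) (z v : C) :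
  2 * Re (wirtinger P z * v)%C = dir_deriv (deriv_x P) (deriv_y P) z v.
Proof. unfold wirtinger, dir_deriv, deriv_x, deriv_y, Re, Im; simpl. field. Qed.

Theorem theorem3 (U : C -> Prop) (P : C -> R)
    (hU : open U) (hU0 : U (RtoC 0)) (hP : smooth_on U P)
    (hi : forall z : C,
      connected_component (fun w : C => U w /\ P w = 0) (RtoC 0) z
      <-> z = RtoC 0)
    (hii : vanishes_to_infinite_order P)
    (H : C * C -> C * C)
    (hH : holomorphic_vector_field H)
    (hH0 : H origin2 = origin2)
    (hT : tangent_to_M P H) :
  locally origin2 (fun z : C * C => H z = origin2)
  \/
  exists phi psi : C -> C,
    local_biholomorphism phi psi /\
    exists beta : R,
      beta <> 0 /\
      locally origin2 (fun v : C * C =>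
        push_field phi psi H v = rotation_field beta v) /\
      rotationally_symmetric (fun w => P (psi w)).
Proof.
destruct (flat_isolated_intro U P hU hU0 hP hi hii) as [r0 HP].
destruct (locally_origin2_elim _ hH) as (ra & Hra & Ha).
destruct (locally_bounded H) as (rb & M & Hrb & Hb).
{ apply (Ha (RtoC 0) (RtoC 0)); rewrite Cmod_0; auto. }
apply tangent_to_M_explicit in hT.
destruct (locally_origin2_elim _ hT) as (rc & Hrc & Hc).
set (r := Rmin ra (Rmin rb rc)).
assert (Hr : 0 < r) by (repeat apply Rmin_case; lra).
destruct (le_Rmin r _ _ (Rle_refl _)) as [Rra [Rrb Rrc]%le_Rmin].
set (h1 := fun u z => fst (H (u, z))). set (h2 := fun u z => snd (H (u, z))).
assert (Hb1 : forall z, Cmod z < r -> holo_bounded (fun u => h1 u z) r M /\ holo_bounded (h1 z)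
  r M).
{ intros z Hz. split; (split; [exact Hr|]); intros w Hw.
  - split; [apply (partial_differentiable H w z), Ha | apply Hb]; lra.
  - split; [apply (partial_differentiable H z w), Ha | apply Hb]; lra. }
assert (Hb2 : forall z, Cmod z < r -> holo_bounded (fun u => h2 u z) r M /\ holo_bounded (h2 z)
  r M).
{ intros z Hz. split; (split; [exact Hr|]); intros w Hw.
  - split; [apply (partial_differentiable H w z), Ha | apply Hb]; lra.
  - split; [apply (partial_differentiable H z w), Ha | apply Hb]; lra. }
assert (H00 : h1 (RtoC 0) (RtoC 0) = RtoC 0).
{ exact (f_equal fst hH0). }
assert (HT : forall u z, Cmod u < r -> Cmod z < r -> Re u + P z = 0 ->
     Re (h1 u z) + dir_deriv (deriv_x P) (deriv_y P) z (h2 u z) = 0).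
{ intros u z Hu Hz E. assert (Q := Hc u z ltac:(lra) ltac:(lra) E).
  simpl fst in Q; simpl snd in Q.
  rewrite <- wirtinger_dP. fold (h1 u z) (h2 u z) in Q.
  rewrite re_plus, re_scal_l in Q. lra. }
assert (Z1 := h1_zero P (deriv_x P) (deriv_y P) r0 HP h1 h2 r M Hr Hb1 Hb2 H00 HT).
destruct (h2_cases P (deriv_x P) (deriv_y P) r0 HP h1 h2 r M Hr Hb1 Hb2 HT) as [Z2|(t0 & beta &
  K & Ht0 & Hbeta & HK & Hg)].
- left. apply (locally_origin2_intro _ (r / 8)); [lra|]. intros z1 z2 G1 G2.
  apply injective_projections; [apply Z1 | apply Z2]; lra.
- right.
  destruct (Hb2 (0, t0)) as [_ Bg]; [rewrite Cmod_im_axis; lra|].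
  destruct (linearization (h2 (0, t0)) r M (Ci * RtoC beta)%C K Bg (Ci_beta_ne beta Hbeta) Hg)
    as (phi & d & R1 & HR1 & Hphi0 & Hphi).
  assert (Hind := h2_indep P (deriv_x P) (deriv_y P) r0 HP h1 h2 r M Hr Hb1 Hb2 H00 HT t0 beta K
     Ht0 Hbeta Hg phi d R1 HR1 Hphi0 Hphi).
  destruct (rotation_coordinate P (deriv_x P) (deriv_y P) r0 HP h1 h2 r M Hr Hb1 Hb2 H00 HT t0
    beta K
     Ht0 Hbeta Hg phi d R1 HR1 Hphi0 Hphi) as (psi & rho & Hrho & Hpsi0 & Hpsi & Hinv).
  exists phi, psi. split; [|exists beta; split; [exact Hbeta | split]].
  + split; [exact Hphi0 | split; [exact Hpsi0 | split; [|split; [|split]]]].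
    * apply (locally_origin_intro _ R1 HR1). intros z Hz. exists (d z). now apply Hphi.
    * apply (locally_origin_intro _ rho Hrho). intros w Hw. exists (/ d (psi w))%C.
      now apply Hpsi.
    * now apply (locally_origin_intro _ rho Hrho).
    * apply (locally_origin_intro _ rho Hrho). intros w Hw. now apply Hpsi.
  + apply (locally_origin2_intro _ (Rmin (r / 8) rho)); [apply Rmin_case; lra|].
    intros z1 z2 G1 G2.
    assert (A1 := Rlt_le_trans _ _ _ G1 (Rmin_l _ _)).
    assert (A2 := Rlt_le_trans _ _ _ G2 (Rmin_r _ _)).
    destruct (Hpsi z2 A2) as (P1 & P2 & P3 & P4 & P5).
    destruct (Hphi (psi z2) P1) as (Q1 & Q2 & Q3).
    unfold push_field, rotation_field. simpl fst; simpl snd. f_equal.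
    * apply Z1; lra.
    * rewrite (is_C_derive_unique phi (psi z2) (d (psi z2)) Q1).
      change (snd (H (z1, psi z2))) with (h2 z1 (psi z2)). rewrite Hind by lra.
      rewrite Q2, P3. reflexivity.
  + apply (locally_origin_intro _ rho Hrho). intros w Hw. now apply Hpsi.
Qed.
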